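(* Let $n\ge 2$, let $c_0,c_1,\ldots,c_n\ge 0$, and let $\Gamma=([n],w)$ be the weighted hypergraph with $w_B=c_{|B|}$ for every $B\subseteq[n]$. Then \[ \min_{\mathrm{triv}\ne\rho\in\mathrm{Irr}(\mathrm{U}(n))}\lambda_{\min}(\Gamma,\rho)=\lambda_{\min}\big(\Gamma,\rho_{(2,0,\ldots,0,-2)}\big)=\sum_{\ell=0}^{n}c_\ell\,\frac{n+1}{\ell+1}\binom{n-2}{\ell-2}, \] with the convention $\binom{a}{b}=0$ when $b<0$ or $a<b$. (In particular the minimum over the infinitely many non-trivial irreducible representations is attained.)
   Context: A weighted hypergraph $\Gamma=([n],w)$ is an assignment of a weight $w_B\ge0$ to every subset $B\subseteq[n]$. For $B\subseteq[n]$, $\mathrm{U}_B\le\mathrm{U}(n)$ denotes the subgroup of unitary matrices that coincide with the identity matrix outside the $|B|\times|B|$ minor with rows and columns in $B$ (so $\mathrm{U}_B\cong\mathrm{U}(|B|)$), and $\mu_B$ is the Haar probability measure on $\mathrm{U}_B$. For a finite-dimensional representation $\rho\colon\mathrm{U}(n)\to\mathrm{GL}_d(\mathbb{C})$, the Laplacian is ${\cal L}(\Gamma,\rho)=\sum_{B\subseteq[n]}w_B\big[I_d-\int_{\mathrm{U}_B}\rho(A)\,d\mu_B(A)\big]$; its spectrum is real, and $\lambda_{\min}(\Gamma,\rho)$ denotes its smallest eigenvalue. $\mathrm{Irr}(\mathrm{U}(n))$ is the set of irreducible representations of $\mathrm{U}(n)$; these are indexed by highest weights, i.e. non-increasing integer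 vectors $\mu=(\mu_1\ge\cdots\ge\mu_n)\in\mathbb{Z}^n$, and $\rho_\mu$ denotes the irreducible representation with highest weight $\mu$; $\mathrm{triv}=\rho_{(0,\ldots,0)}$. For $n=2$, $(2,0,\ldots,0,-2)$ means $(2,-2)$. *)

(* Defs.v *)
(* mathcomp + real_closed's complex numbers R[i]. *)
From HB Require Import structures.
From mathcomp Require Import all_boot all_order all_algebra.
From mathcomp Require Import complex.
Set Implicit Arguments. Unset Strict Implicit. Unset Printing Implicit Defensive.
Import Order.TTheory GRing.Theory Num.Theory ComplexField.
Local Open Scope ring_scope.

Section Defs.
Variable R : rcfType.
Local Notation C := R[i].

(* conjugate transpose *)
Definition adjmx m n (A : 'M[C]_(m, n)) : 'M[C]_(n, m) := (map_mx (fun z => z^*) A)^T.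

(* U(n) *)
Definition unitary n (A : 'M[C]_n) : Prop := A *m adjmx A = 1%:M.

(* U_B : unitary matrices equal to the identity outside the B x B minor *)
Definition UB n (B : {set 'I_n}) (A : 'M[C]_n) : Prop :=
  unitary A /\ forall i j, (i \notin B) || (j \notin B) -> A i j = (i == j)%:R.

(* entrywise epsilon-delta continuity on a set S of matrices *)
Definition cont_on m n p q (S : 'M[C]_(m, n) -> Prop) (f : 'M[C]_(m, n) -> 'M[C]_(p, q)) : Prop :=
  forall A, S A -> forall e : C, 0 < e -> exists2 dl : C, 0 < dl &
    forall A', S A' -> (forall i j, `|A' i j - A i j| < dl) ->
      forall k l, `|f A' k l - f A k l| < e.

(* scalar functions viewed as 1x1-matrix-valued *)
Definition cont_on_fun n (S : 'M[C]_n -> Prop) (f : 'M[C]_n -> C) : Prop :=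
  cont_on S (fun A => (f A)%:M : 'M[C]_1).

(* I is the Haar integral (Haar probability mean) of the compact group S, viewed
   as a functional on continuous functions S -> C: it only depends on values on S,
   is C-linear, positive, normalized and left-invariant on continuous functions.
   By the Riesz representation theorem and uniqueness of Haar measure, this
   determines I f = \int_S f d(mu_S) for every continuous f. *)
Definition haar_integral n (S : 'M[C]_n -> Prop) (I : ('M[C]_n -> C) -> C) : Prop :=
  (forall f g, (forall A, S A -> f A = g A) -> I f = I g) /\
  [/\ (forall f g, cont_on_fun S f -> cont_on_fun S g ->
         I (fun A => f A + g A) = I f + I g),
      (forall (a : C) f, cont_on_fun S f -> I (fun A => a * f A) = a * I f),
      (forall f, cont_on_fun S f -> (forall A, S A -> 0 <= f A) -> 0 <= I f),
      I (fun _ => 1) = 1 &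
      (forall f g, S g -> cont_on_fun S f -> I (fun A => f (g *m A)) = I f)].

(* finite-dimensional continuous representation of U(n) *)
Definition is_rep n d (rho : 'M[C]_n -> 'M[C]_d) : Prop :=
  [/\ rho 1%:M = 1%:M,
      (forall A B, unitary A -> unitary B -> rho (A *m B) = rho A *m rho B) &
      cont_on (@unitary n) rho].

(* irreducible: nonzero, and no invariant subspace other than 0 and everything
   (subspaces of row vectors, mxalgebra convention; for a group this is
   equivalent to the column-vector convention) *)
Definition irrep n d (rho : 'M[C]_n -> 'M[C]_d) : Prop :=
  [/\ is_rep rho, (0 < d)%N &
      forall W : 'M[C]_d, (forall A, unitary A -> stablemx W (rho A)) ->
        \rank W = 0%N \/ \rank W = d].

(* isomorphic to the trivial representation *)
Definition iso_triv n d (rho : 'M[C]_n -> 'M[C]_d) : Prop :=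
  d = 1%N /\ forall A, unitary A -> rho A = 1%:M.

(* weights: nu is a weight of rho if some nonzero vector v satisfies
   rho(diag(t_1..t_n)) v = t_1^nu_1 ... t_n^nu_n v for all |t_i| = 1 *)
Definition is_weight n d (rho : 'M[C]_n -> 'M[C]_d) (nu : 'I_n -> int) : Prop :=
  exists2 v : 'cV[C]_d, v != 0 &
    forall t : 'rV[C]_n, (forall i, `|t 0 i| = 1) ->
      rho (diag_mx t) *m v = (\prod_(i < n) t 0 i ^ nu i) *: v.

(* mu - nu is a nonnegative integer combination of the simple roots e_i - e_{i+1} *)
Definition dom_le n (nu mu : 'I_n -> int) : Prop :=
  (forall k : nat, 0 <= \sum_(i < n | (i < k)%N) (mu i - nu i)) /\
  \sum_(i < n) (mu i - nu i) = 0.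

(* rho has highest weight mu *)
Definition highest_weight n d (rho : 'M[C]_n -> 'M[C]_d) (mu : 'I_n -> int) : Prop :=
  is_weight rho mu /\ forall nu, is_weight rho nu -> dom_le nu mu.

(* the Laplacian L(Gamma, rho) with w_B = c_|B|, integral via I B over U_B *)
Definition laplacian n d (c : nat -> R) (I : {set 'I_n} -> ('M[C]_n -> C) -> C)
    (rho : 'M[C]_n -> 'M[C]_d) : 'M[C]_d :=
  \sum_(B : {set 'I_n}) real_complex R (c #|B|) *:
     (1%:M - \matrix_(k, l) I B (fun A => rho A k l)).

(* x is the smallest eigenvalue of M (in particular it is real and all
   eigenvalues are real and >= x; the order on C compares real numbers) *)
Definition lambda_min d (M : 'M[C]_d) (x : C) : Prop :=
  eigenvalue M x /\ forall z, eigenvalue M z -> x <= z.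

(* the highest weight (2,0,...,0,-2) *)
Definition mu20m2 n : 'I_n -> int :=
  fun i => if val i == 0%N then 2 else if val i == n.-1 then -2 else 0.

(* binomial with the convention binom(a,b) = 0 for b < 0 *)
Definition binomz (a : nat) (b : int) : nat :=
  match b with Posz b' => 'C(a, b') | Negz _ => 0%N end.

Definition target_value n (c : nat -> R) : R :=
  \sum_(l < n.+1) c l * ((n.+1)%:R / (l.+1)%:R) *
     (binomz (n - 2) (l%:Z - 2))%:R.

End Defs.

(* Main.v *)
(** Lower bound.  By unitarization assume [rho] unitary, and let [P B] be the orthogonal projection
    onto the [U_B]-invariants.  If [x] is orthogonal to the [U_D]-invariants and [m = #|D| >= 3], then
      [\sum_(i in D) |x P(D \ i)|^2 <= (1 + 2 / m) |x|^2].
    Indeed, [P(D \ i)] commutes with the projection onto the invariants of the circle [U_{i}].  The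
    parts killed by the circles are pairwise orthogonal and contribute at most [|x|^2].  The invariant
    parts are zonal vectors, whose pairwise overlaps are governed by the reflection exchanging two
    poles.  The matrix coefficient of a zonal vector is a polynomial in [t = |g_ii|^2], and a
    functional equation for it shows that the overlaps are numbers
    [(-1)^K E |A_jj|^(2K)], [K > 0], [A] Haar distributed on [U(m - 1)]; these lie between
    [- 2 / m] and [2 / (m (m - 1))], and a Gram matrix estimate follows.  Summing over all [D] of a
    given size and descending from [D = [n]] bounds each level of the Laplacian separately.

    Equality.  In [V (x) V (x) V^* (x) V^*] the tensor [\sum_i e_i (x) e_i (x) e_i^* (x) e_i^*] is an
    eigenvector of the Laplacian up to a [U(n)]-invariant tensor, by the fourth moments of the entries.
    A minimal invariant subspace containing [e_1 (x) e_1 (x) e_n^* (x) e_n^*] realizes the highest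
    weight [(2,0,...,0,-2)].  Conversely, the weights of any such representation are weights of the
    tensor space, so its character is a symmetric combination of torus monomials, hence a combination
    of matrix coefficients of the tensor space; character orthogonality then yields a nonzero
    intertwiner, through which the tensor above projects to an eigenvector. *)
Require Import Defs.
From HB Require Import structures.
From mathcomp Require Import all_boot all_order all_algebra all_fingroup.
From mathcomp Require Import complex ring zify.
From mathcomp Require Import boolp reals topology normedtype trigo.
Set Implicit Arguments. Unset Strict Implicit. Unset Printing Implicit Defensive.
Import Order.TTheory GRing.Theory Num.Theory ComplexField numFieldNormedType.Exports.
Local Open Scope ring_scope.

(** * Unitary matrices and continuity *)

(** There are infinitely many representations, so the overlaps need a uniform bound. For this reason
    only the degree [K] of the zonal polynomial is used, read off from the leading coefficients of
    its functional equation. Degree [K] belongs to the zonal function of highest weight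
    [(K,0,...,0,-K)]; since [E |A_jj|^(2K)] decreases with [K], the largest positive overlap is the
    fourth moment at [K = 2], and this singles out [(2,0,...,0,-2)]. In the Gram estimate the
    vectors are moved to one pole and split into their mean and deviations. The deviations see the
    overlaps with a minus sign, the mean sees them [m (m - 1)] times, and the two ends of the range
    of overlaps cost the same [2 / m]. The factors [m - (1 + 2 / m)] met along the descent multiply
    up to exactly the coefficients of the claimed value, so no level loses anything. For the
    equality, the Laplacian is computable on tensors, whereas the given representation is known only
    through its weights; the intertwiner bridges the two. *)

Section Adjoint.
Variable R : rcfType.
Local Notation C := R[i].

Lemma adjmxE m n (A : 'M[C]_(m, n)) i j : adjmx A i j = (A j i)^*.
Proof. by rewrite !mxE. Qed.

Lemma adjmxK m n (A : 'M[C]_(m, n)) : adjmx (adjmx A) = A.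
Proof. by apply/matrixP=> i j; rewrite !adjmxE conjCK. Qed.

Lemma adjmxM m n p (A : 'M[C]_(m, n)) (B : 'M[C]_(n, p)) :
  adjmx (A *m B) = adjmx B *m adjmx A.
Proof.
apply/matrixP=> i j; rewrite adjmxE !mxE rmorph_sum; apply: eq_bigr => k _.
by rewrite rmorphM !adjmxE mulrC.
Qed.

Lemma adjmxD m n (A B : 'M[C]_(m, n)) : adjmx (A + B) = adjmx A + adjmx B.
Proof. by apply/matrixP=> i j; rewrite !(adjmxE, mxE) rmorphD. Qed.

Lemma adjmxN m n (A : 'M[C]_(m, n)) : adjmx (- A) = - adjmx A.
Proof. by apply/matrixP=> i j; rewrite !(adjmxE, mxE) rmorphN. Qed.

Lemma adjmxB m n (A B : 'M[C]_(m, n)) : adjmx (A - B) = adjmx A - adjmx B.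
Proof. by rewrite adjmxD adjmxN. Qed.

Lemma adjmxZ m n a (A : 'M[C]_(m, n)) : adjmx (a *: A) = a^* *: adjmx A.
Proof. by apply/matrixP=> i j; rewrite !(adjmxE, mxE) rmorphM. Qed.

Lemma adjmx0 m n : adjmx (0 : 'M[C]_(m, n)) = 0.
Proof. by apply/matrixP=> i j; rewrite !(adjmxE, mxE) rmorph0. Qed.

Lemma adjmx_sum m n (I : Type) (r : seq I) (P : pred I) (F : I -> 'M[C]_(m, n)) :
  adjmx (\sum_(i <- r | P i) F i) = \sum_(i <- r | P i) adjmx (F i).
Proof. by apply: (big_morph _ (@adjmxD m n) (adjmx0 m n)). Qed.

Lemma adjmx_scalar n (a : C) : adjmx (a%:M : 'M_n) = (a^*)%:M.
Proof.
apply/matrixP=> i j; rewrite !(adjmxE, mxE) eq_sym.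
by case: eqP => _; rewrite /= ?mulr1n ?mulr0n ?rmorph0.
Qed.

Lemma adjmx1 n : adjmx (1%:M : 'M[C]_n) = 1%:M.
Proof. by rewrite adjmx_scalar rmorph1. Qed.

Lemma adjmx_inj m n : injective (@adjmx R m n).
Proof. exact: can_inj (@adjmxK m n). Qed.

(** Vectors are rows and matrices act from the right, in accordance with [eigenvalue] and
    [stablemx]; the form is linear in its first argument. *)
Definition dotr n (u v : 'rV[C]_n) : C := (u *m adjmx v) 0 0.
Definition nrm n (u : 'rV[C]_n) : C := dotr u u.

Lemma dotrE n (u v : 'rV[C]_n) : dotr u v = \sum_i u 0 i * (v 0 i)^*.
Proof. by rewrite /dotr mxE; apply: eq_bigr => i _; rewrite adjmxE. Qed.

Lemma dotrC n (u v : 'rV[C]_n) : dotr u v = (dotr v u)^*.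
Proof.
rewrite !dotrE rmorph_sum; apply: eq_bigr => i _.
by rewrite rmorphM /= conjCK mulrC.
Qed.

Lemma dotrDl n (u v w : 'rV[C]_n) : dotr (u + v) w = dotr u w + dotr v w.
Proof. by rewrite /dotr mulmxDl mxE. Qed.

Lemma dotrDr n (u v w : 'rV[C]_n) : dotr w (u + v) = dotr w u + dotr w v.
Proof. by rewrite /dotr adjmxD mulmxDr mxE. Qed.

Lemma dotrNl n (u w : 'rV[C]_n) : dotr (- u) w = - dotr u w.
Proof. by rewrite /dotr mulNmx mxE. Qed.

Lemma dotrNr n (u w : 'rV[C]_n) : dotr w (- u) = - dotr w u.
Proof. by rewrite /dotr adjmxN mulmxN mxE. Qed.

Lemma dotrBl n (u v w : 'rV[C]_n) : dotr (u - v) w = dotr u w - dotr v w.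
Proof. by rewrite dotrDl dotrNl. Qed.

Lemma dotrBr n (u v w : 'rV[C]_n) : dotr w (u - v) = dotr w u - dotr w v.
Proof. by rewrite dotrDr dotrNr. Qed.

Lemma dotrZl n a (u w : 'rV[C]_n) : dotr (a *: u) w = a * dotr u w.
Proof. by rewrite /dotr -scalemxAl mxE. Qed.

Lemma dotrZr n a (u w : 'rV[C]_n) : dotr w (a *: u) = a^* * dotr w u.
Proof. by rewrite /dotr adjmxZ -scalemxAr mxE. Qed.

Lemma dotr0l n (w : 'rV[C]_n) : dotr 0 w = 0.
Proof. by rewrite /dotr mul0mx mxE. Qed.

Lemma dotr_suml n (I : Type) (r : seq I) (P : pred I) (F : I -> 'rV[C]_n) w :
  dotr (\sum_(i <- r | P i) F i) w = \sum_(i <- r | P i) dotr (F i) w.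
Proof. exact: (big_morph (fun u => dotr u w) (fun u v => dotrDl u v w) (dotr0l w)). Qed.

Lemma dotr_sumr n (I : Type) (r : seq I) (P : pred I) (F : I -> 'rV[C]_n) w :
  dotr w (\sum_(i <- r | P i) F i) = \sum_(i <- r | P i) dotr w (F i).
Proof.
rewrite dotrC dotr_suml rmorph_sum; apply: eq_bigr => i _.
by rewrite /= -dotrC.
Qed.

Lemma dotr_mul m n (u : 'rV[C]_m) (v : 'rV[C]_n) A :
  dotr (u *m A) v = dotr u (v *m adjmx A).
Proof. by rewrite /dotr adjmxM adjmxK mulmxA. Qed.

Lemma nrm_ge0 n (u : 'rV[C]_n) : 0 <= nrm u.
Proof. by rewrite /nrm dotrE sumr_ge0 // => i _; apply: mul_conjC_ge0. Qed.

Lemma nrm_eq0 n (u : 'rV[C]_n) : (nrm u == 0) = (u == 0).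
Proof.
apply/eqP/eqP => [|->]; last by rewrite /nrm dotr0l.
rewrite /nrm dotrE => /eqP; rewrite psumr_eq0 => [/allP h|i _]; last exact: mul_conjC_ge0.
apply/rowP => i; rewrite mxE; apply/eqP; rewrite -mul_conjC_eq0.
by apply: h; rewrite mem_index_enum.
Qed.

Lemma nrm_gt0 n (u : 'rV[C]_n) : (0 < nrm u) = (u != 0).
Proof. by rewrite lt_def nrm_ge0 nrm_eq0 andbT. Qed.

End Adjoint.

Section Groups.
Variables (R : rcfType) (n : nat).
Local Notation C := R[i].
Implicit Types (A : 'M[C]_n) (B D : {set 'I_n}).

Lemma unitary_adjl A : unitary A -> adjmx A *m A = 1%:M.
Proof. by move=> /mulmx1C. Qed.

Lemma unitary1 : unitary (1%:M : 'M[C]_n).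
Proof. by rewrite /unitary adjmx1 mulmx1. Qed.

Lemma unitaryM A A' : unitary A -> unitary A' -> unitary (A *m A').
Proof.
rewrite /unitary => hA hA'.
by rewrite adjmxM mulmxA -(mulmxA A) hA' mulmx1.
Qed.

Lemma unitary_adj A : unitary A -> unitary (adjmx A).
Proof. by move=> hA; rewrite /unitary adjmxK unitary_adjl. Qed.

Lemma unitary_entry_le1 A i j : unitary A -> `|A i j| <= 1.
Proof.
move=> hA; have := congr1 (fun M : 'M_n => M i i) hA.
rewrite !mxE eqxx (bigD1 j) //= adjmxE -normCK => h.
rewrite -(@expr_le1 _ 2) // -[leRHS]h ler_wpDr // sumr_ge0 // => k _.
by rewrite adjmxE mul_conjC_ge0.
Qed.

Lemma UB1 B : UB B (1%:M : 'M[C]_n).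
Proof. by split; [exact: unitary1|move=> i j _; rewrite mxE]. Qed.

Lemma UBM B A A' : UB B A -> UB B A' -> UB B (A *m A').
Proof.
move=> [uA hA] [uA' hA']; split; first exact: unitaryM.
move=> i j /orP[iB|jB].
  rewrite mxE (bigD1 i) //= hA ?iB // eqxx mul1r hA' ?iB //.
  by rewrite big1 ?addr0 // => k /negbTE ki; rewrite hA ?iB // eq_sym ki mul0r.
rewrite mxE (bigD1 j) //= hA' ?jB ?orbT // eqxx mulr1 hA ?jB ?orbT //.
by rewrite big1 ?addr0 // => k /negbTE kj; rewrite hA' ?jB ?orbT // kj mulr0.
Qed.

Lemma UB_adj B A : UB B A -> UB B (adjmx A).
Proof.
move=> [uA hA]; split; first exact: unitary_adj.
by move=> i j ijB; rewrite adjmxE hA; [rewrite rmorph_nat eq_sym|rewrite orbC].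
Qed.

Lemma UB_sub B D A : B \subset D -> UB B A -> UB D A.
Proof.
move=> BD [uA hA]; split=> // i j ijD; apply: hA.
case/orP: ijD => h; apply/orP; [left|right]; apply: contra h; exact: (subsetP BD).
Qed.

Lemma UB_unitary B A : UB B A -> unitary A. Proof. by case. Qed.

Lemma UBT A : UB [set: 'I_n] A <-> unitary A.
Proof. by split=> [[]//|uA]; split=> // i j; rewrite !inE. Qed.

(** [A - 1] is supported on [B x B] and [A' - 1] on [D x D], so their products in both orders
    vanish; expanding the two zero products gives the commutation. *)
Lemma UB_comm B D A A' : [disjoint B & D] -> UB B A -> UB D A' ->
  A *m A' = A' *m A.
Proof.
have prod0 B1 D1 (X Y : 'M[C]_n) : [disjoint B1 & D1] -> UB B1 X -> UB D1 Y ->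
    (X - 1%:M) *m (Y - 1%:M) = 0.
  move=> dis [_ hX] [_ hY]; apply/matrixP => i j; rewrite mxE big1 ?mxE // => k _.
  have [kB|kB] := boolP (k \in B1); rewrite !mxE.
    by rewrite hY ?(disjointFr dis kB) // subrr mulr0.
  by rewrite hX ?kB ?orbT // subrr mul0r.
move=> dis hA hA'; have := prod0 _ _ _ _ dis hA hA'.
rewrite disjoint_sym in dis; have := prod0 _ _ _ _ dis hA' hA.
rewrite !(mulmxBl, mulmxBr, mulmx1, mul1mx).
move=> e1 e2; have := etrans e1 (esym e2).
set x := A' *m A; set y := A *m A' => e.
have h : A' + (A - 1%:M) = A + (A' - 1%:M) by rewrite addrCA.
by move: e; rewrite -!addrA -!opprD h => /addIr.
Qed.

End Groups.

Section Continuity.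
Variables (R : rcfType) (n : nat) (S : 'M[R[i]]_n -> Prop).
Local Notation C := R[i].
Implicit Types f g : 'M[C]_n -> C.

Lemma cont_funP f : cont_on_fun S f <->
  forall A, S A -> forall e : C, 0 < e -> exists2 dl : C, 0 < dl &
    forall A', S A' -> (forall i j, `|A' i j - A i j| < dl) -> `|f A' - f A| < e.
Proof.
split=> h A SA e e0; have [dl dl0 hdl] := h A SA e e0; exists dl => // A' SA' hA'.
  by have := hdl A' SA' hA' 0 0; rewrite !mxE eqxx.
by move=> k l; have := hdl A' SA' hA'; rewrite !mxE !ord1 eqxx.
Qed.

Lemma pos_lower2 (a b : C) : 0 < a -> 0 < b -> exists2 c, 0 < c & (c < a) && (c < b).
Proof.
move=> a0 b0; have ab0 : 0 < a + b by apply: addr_gt0.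
(* The order on [C] is only partial; in place of a minimum, half the harmonic mean is a positive
   number below both. *)
exists (a * b / (a + b)); first by rewrite divr_gt0 ?mulr_gt0.
rewrite !ltr_pdivrMr // ltr_pM2l // ltrDr a0 /=.
by rewrite mulrC ltr_pM2l // ltrDl.
Qed.

Lemma pos_lower_seq (T : eqType) (P : T -> C -> Prop) (s : seq T) :
  (forall x a b, 0 < b -> b < a -> P x a -> P x b) ->
  (forall x, x \in s -> exists2 a, 0 < a & P x a) ->
  exists2 a, 0 < a & forall x, x \in s -> P x a.
Proof.
move=> mono; elim: s => [|x s IH] h; first by exists 1 => //; rewrite ltr01.
have [a a0 ha] := h x (mem_head _ _).
have [|b b0 hb] := IH; first by move=> y ys; apply: h; rewrite inE ys orbT.
have [c c0 /andP[ca cb]] := pos_lower2 a0 b0; exists c => // y.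
rewrite inE => /predU1P[->|ys]; first exact: mono ha.
exact: mono (hb _ ys).
Qed.

Lemma cont_on_entries p q (F : 'M[C]_n -> 'M[C]_(p, q)) :
  cont_on S F <-> forall k l, cont_on_fun S (fun A => F A k l).
Proof.
split=> [h k l|h A SA e e0].
  apply/cont_funP => A SA e e0; have [dl dl0 hdl] := h A SA e e0; exists dl => // A' SA' hA'.
  exact: hdl.
pose P (kl : 'I_p * 'I_q) (dl : C) :=
  forall A', S A' -> (forall i j, `|A' i j - A i j| < dl) ->
   `|F A' kl.1 kl.2 - F A kl.1 kl.2| < e.
have [||dl dl0 hdl] := @pos_lower_seq _ P (enum [set: 'I_p * 'I_q]).
- move=> x a b b0 ba Pa A' SA' hA'; apply: Pa => // i j.
  exact: lt_trans (hA' i j) ba.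
- by move=> [k l] _; have /cont_funP/(_ A SA e e0) := h k l.
by exists dl => // A' SA' hA' k l; apply: (hdl (k, l)); rewrite ?mem_enum ?inE.
Qed.

Lemma cont_cst (a : C) : cont_on_fun S (fun=> a).
Proof. by apply/cont_funP => A _ e e0; exists 1 => // A' _ _; rewrite subrr normr0. Qed.

Lemma cont_entry i j : cont_on_fun S (fun A => A i j).
Proof. by apply/cont_funP => A _ e e0; exists e. Qed.

Lemma cont_ext f g : (forall A, S A -> f A = g A) -> cont_on_fun S f -> cont_on_fun S g.
Proof.
move=> fg /cont_funP h; apply/cont_funP => A SA e e0; have [dl dl0 hdl] := h A SA e e0.
by exists dl => // A' SA' hA'; rewrite -!fg //; apply: hdl.
Qed.

Lemma cont_add f g : cont_on_fun S f -> cont_on_fun S g -> cont_on_fun S (fun A => f A + g A).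
Proof.
move=> /cont_funP hf /cont_funP hg; apply/cont_funP => A SA e e0.
have e20 : 0 < e / 2 by rewrite divr_gt0.
have [a a0 ha] := hf A SA _ e20; have [b b0 hb] := hg A SA _ e20.
have [c c0 /andP[ca cb]] := pos_lower2 a0 b0; exists c => // A' SA' hA'.
rewrite opprD addrACA [ltRHS]splitr; apply: le_lt_trans (ler_normD _ _) _.
apply: ltrD; [apply: ha => // i j; exact: lt_trans ca|apply: hb => // i j; exact: lt_trans cb].
Qed.

Lemma cont_mul f g : cont_on_fun S f -> cont_on_fun S g -> cont_on_fun S (fun A => f A * g A).
Proof.
move=> /cont_funP hf /cont_funP hg; apply/cont_funP => A SA e e0.
pose M := `|f A| + `|g A| + 1.
have M0 : 0 < M by rewrite ltr_wpDl ?addr_ge0.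
have [d d0 /andP[d1 dM]] := @pos_lower2 1 (e / (M * 2)) ltr01
  ltac:(by rewrite divr_gt0 ?mulr_gt0).
have [a a0 ha] := hf A SA _ d0; have [b b0 hb] := hg A SA _ d0.
have [c c0 /andP[ca cb]] := pos_lower2 a0 b0; exists c => // A' SA' hA'.
have h1 : `|f A' - f A| < d by apply: ha => // i j; exact: lt_trans ca.
have h2 : `|g A' - g A| < d by apply: hb => // i j; exact: lt_trans cb.
have -> : f A' * g A' - f A * g A =
  (f A' - f A) * (g A' - g A) + ((f A' - f A) * g A + f A * (g A' - g A)) by ring.
have dMe : d * (M * 2) < e by rewrite -ltr_pdivlMr ?mulr_gt0.
apply: le_lt_trans (ler_normD _ _) _.
apply: (@le_lt_trans _ _ (d * 1 + (d * `|g A| + `|f A| * d))).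
  apply: lerD.
    by rewrite normrM; apply: ler_pM => //; [exact: ltW|apply: ltW; apply: lt_trans d1].
  apply: le_trans (ler_normD _ _) _; rewrite !normrM; apply: lerD.
    by apply: ler_wpM2r => //; apply: ltW.
  by apply: ler_wpM2l => //; apply: ltW.
have -> : d * 1 + (d * `|g A| + `|f A| * d) = d * M by rewrite /M; ring.
apply: le_lt_trans dMe; rewrite mulrA ler_peMr //; last by rewrite ler1n.
by rewrite mulr_ge0 ?ltW.
Qed.

Lemma cont_conj f : cont_on_fun S f -> cont_on_fun S (fun A => (f A)^*).
Proof.
move=> /cont_funP h; apply/cont_funP => A SA e e0; have [dl dl0 hdl] := h A SA e e0.
by exists dl => // A' SA' hA'; rewrite -rmorphB norm_conjC; apply: hdl.
Qed.

Lemma cont_scale a f : cont_on_fun S f -> cont_on_fun S (fun A => a * f A).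
Proof. exact: (cont_mul (cont_cst a)). Qed.

Lemma cont_opp f : cont_on_fun S f -> cont_on_fun S (fun A => - f A).
Proof.
by move=> h; apply: cont_ext (cont_mul (cont_cst (-1)) h) => A _; rewrite mulN1r.
Qed.

Lemma cont_sum (I : Type) (r : seq I) (P : pred I) (F : I -> 'M[C]_n -> C) :
  (forall i, P i -> cont_on_fun S (F i)) ->
  cont_on_fun S (fun A => \sum_(i <- r | P i) F i A).
Proof.
move=> h; elim: r => [|x r IH].
  by apply: cont_ext (cont_cst 0) => A _; rewrite big_nil.
have [Px|Px] := boolP (P x).
  by apply: cont_ext (cont_add (h x Px) IH) => A _; rewrite big_cons Px.
by apply: cont_ext IH => A _; rewrite big_cons (negbTE Px).
Qed.

Lemma cont_prod (I : Type) (r : seq I) (P : pred I) (F : I -> 'M[C]_n -> C) :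
  (forall i, P i -> cont_on_fun S (F i)) ->
  cont_on_fun S (fun A => \prod_(i <- r | P i) F i A).
Proof.
move=> h; elim: r => [|x r IH].
  by apply: cont_ext (cont_cst 1) => A _; rewrite big_nil.
have [Px|Px] := boolP (P x).
  by apply: cont_ext (cont_mul (h x Px) IH) => A _; rewrite big_cons Px.
by apply: cont_ext IH => A _; rewrite big_cons (negbTE Px).
Qed.

Lemma cont_exp f k : cont_on_fun S f -> cont_on_fun S (fun A => f A ^+ k).
Proof.
move=> h; elim: k => [|k IH]; first by apply: cont_ext (cont_cst 1) => A _; rewrite expr0.
by apply: cont_ext (cont_mul h IH) => A _; rewrite exprS.
Qed.

Lemma cont_norm2 f : cont_on_fun S f -> cont_on_fun S (fun A => `|f A| ^+ 2).
Proof.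
by move=> h; apply: cont_ext (cont_mul h (cont_conj h)) => A _; rewrite normCK.
Qed.

Lemma cont_on_comp (S' : 'M[C]_n -> Prop) p q (F : 'M[C]_n -> 'M[C]_(p, q)) (h : 'M[C]_n -> 'M[C]_n) :
  (forall A, S A -> S' (h A)) -> cont_on S h -> cont_on S' F ->
  cont_on S (fun A => F (h A)).
Proof.
move=> hS ch cF A SA e e0; have [d d0 hd] := cF _ (hS _ SA) e e0.
have [d' d'0 hd'] := ch A SA d d0; exists d' => // A' SA' hA' k l.
by apply: hd => //; [exact: hS|exact: hd'].
Qed.

Lemma cont_on_sub (S' : 'M[C]_n -> Prop) p q (F : 'M[C]_n -> 'M[C]_(p, q)) :
  (forall A, S A -> S' A) -> cont_on S' F -> cont_on S F.
Proof. by move=> h; apply: cont_on_comp => //; apply/cont_on_entries => k l; apply: cont_entry. Qed.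

Lemma cont_on_cst p q (F : 'M[C]_(p, q)) : cont_on S (fun=> F).
Proof. by apply/cont_on_entries => k l; apply: cont_cst. Qed.

Lemma cont_on_id : cont_on S id.
Proof. by apply/cont_on_entries => k l; apply: cont_entry. Qed.

Lemma cont_on_mulmx p q r (F : 'M[C]_n -> 'M[C]_(p, q)) (G : 'M[C]_n -> 'M[C]_(q, r)) :
  cont_on S F -> cont_on S G -> cont_on S (fun A => F A *m G A).
Proof.
move=> /cont_on_entries hF /cont_on_entries hG; apply/cont_on_entries => k l.
apply: (@cont_ext (fun A => \sum_j F A k j * G A j l)) => [A _|]; first by rewrite mxE.
by apply: cont_sum => j _; apply: cont_mul.
Qed.

Lemma cont_on_adj p q (F : 'M[C]_n -> 'M[C]_(p, q)) :
  cont_on S F -> cont_on S (fun A => adjmx (F A)).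
Proof.
move=> /cont_on_entries hF; apply/cont_on_entries => k l.
by apply: (@cont_ext (fun A => (F A l k)^*)) => [A _|]; rewrite ?adjmxE //; apply: cont_conj.
Qed.

End Continuity.

(** * Haar integrals and averaging projections *)

Section Haar.
Variables (R : rcfType) (n : nat) (S : 'M[R[i]]_n -> Prop).
Local Notation C := R[i].
Variable I : ('M[C]_n -> C) -> C.
Hypothesis hI : haar_integral S I.
Local Notation cont := (cont_on_fun S).
Implicit Types f g : 'M[C]_n -> C.

Lemma haar_ext f g : (forall A, S A -> f A = g A) -> I f = I g.
Proof. exact: (proj1 hI). Qed.

Lemma haar_add f g : cont f -> cont g -> I (fun A => f A + g A) = I f + I g.
Proof. by case: hI => _ [h _ _ _ _]; apply: h. Qed.

Lemma haar_scale a f : cont f -> I (fun A => a * f A) = a * I f.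
Proof. by case: hI => _ [_ h _ _ _]; apply: h. Qed.

Lemma haar_ge0 f : cont f -> (forall A, S A -> 0 <= f A) -> 0 <= I f.
Proof. by case: hI => _ [_ _ h _ _]; apply: h. Qed.

Lemma haar_inv f (g : 'M[C]_n) : S g -> cont f -> I (fun A => f (g *m A)) = I f.
Proof. by case: hI => _ [_ _ _ _ h]; apply: h. Qed.

Lemma haar_cst a : I (fun=> a) = a.
Proof.
case: hI => _ [_ _ _ h _]; rewrite -[RHS]mulr1 -h -haar_scale; last exact: cont_cst.
by apply: haar_ext => A _; rewrite mulr1.
Qed.

Lemma haar_opp f : cont f -> I (fun A => - f A) = - I f.
Proof.
move=> cf; rewrite -mulN1r -haar_scale //.
by apply: haar_ext => A _; rewrite mulN1r.
Qed.

Lemma haar_sub f g : cont f -> cont g -> I (fun A => f A - g A) = I f - I g.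
Proof. by move=> cf cg; rewrite haar_add ?haar_opp //; apply: cont_opp. Qed.

Lemma haar_sum (J : Type) (r : seq J) (P : pred J) (F : J -> 'M[C]_n -> C) :
  (forall i, P i -> cont (F i)) ->
  I (fun A => \sum_(i <- r | P i) F i A) = \sum_(i <- r | P i) I (F i).
Proof.
move=> cF; elim: r => [|x r IH].
  by rewrite big_nil -[RHS](haar_cst 0); apply: haar_ext => A _; rewrite big_nil.
rewrite big_cons; have [Px|Px] := boolP (P x); last first.
  by rewrite -IH; apply: haar_ext => A _; rewrite big_cons (negbTE Px).
rewrite -IH -haar_add; [|exact: cF|exact: cont_sum].
by apply: haar_ext => A _; rewrite big_cons Px.
Qed.

Lemma haar_le f g : cont f -> cont g -> (forall A, S A -> f A <= g A) -> I f <= I g.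
Proof.
move=> cf cg h; rewrite -subr_ge0 -haar_sub //; apply: haar_ge0 => [|A SA].
  by apply: cont_add => //; apply: cont_opp.
by rewrite subr_ge0 h.
Qed.

Lemma haar_real f : cont f -> (forall A, S A -> f A \is Num.real) -> I f \is Num.real.
Proof.
(* [f] is a difference of two squares *)
move=> cf rf; pose g (e : C) A := 4^-1 * ((f A + e) * (f A + e)).
have cg e : cont (g e).
  by apply: cont_scale; apply: cont_mul; apply: cont_add => //; apply: cont_cst.
have g0 (e : C) A : e \is Num.real -> S A -> 0 <= g e A.
  move=> re SA; rewrite mulr_ge0 ?invr_ge0 ?ler0n // -expr2 real_exprn_even_ge0 //.
  by rewrite rpredD ?rf.
have -> : I f = I (g 1) - I (g (-1)).
  by rewrite -haar_sub //; apply: haar_ext => A SA; rewrite /g; field.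
by apply: rpredB; apply: ger0_real; apply: haar_ge0 (cg _) _ => A SA; apply: g0; rewrite // ?rpredN real1.
Qed.

(** The axioms speak of linearity and positivity only. Positivity makes means of real functions real
    ([haar_real]), and this is applied to the real and imaginary parts of [f]. *)
Lemma haar_conj f : cont f -> I (fun A => (f A)^*) = (I f)^*.
Proof.
move=> cf; pose a A := 'Re (f A); pose b A := 'Im (f A).
have ca : cont a.
  apply: (cont_ext (f := fun A => 2^-1 * (f A + (f A)^*))) => [A _|].
    by rewrite /a ReE mulrC.
  by apply: cont_scale; apply: cont_add => //; apply: cont_conj.
have cb : cont b.
  apply: (cont_ext (f := fun A => ('i / 2) * ((f A)^* - f A))) => [A _|].
    by rewrite /b ImE mulrAC.
  by apply: cont_scale; apply: cont_add; [apply: cont_conj|apply: cont_opp].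
have ra A : a A \is Num.real := Creal_Re _.
have rb A : b A \is Num.real := Creal_Im _.
have fE A : f A = a A + 'i * b A := Crect _.
have -> : I f = I a + 'i * I b.
  rewrite -haar_scale // -haar_add //; first exact: haar_ext.
  by apply: cont_scale.
rewrite rmorphD rmorphM /= conjCi.
rewrite (CrealP (haar_real ca (fun A _ => ra A))) (CrealP (haar_real cb (fun A _ => rb A))).
rewrite -haar_scale // -haar_add //; last by apply: cont_scale.
apply: haar_ext => A _; rewrite {1}fE rmorphD rmorphM /= conjCi.
by rewrite (CrealP (ra A)) (CrealP (rb A)).
Qed.

Definition intmx p q (F : 'M[C]_n -> 'M[C]_(p, q)) : 'M[C]_(p, q) :=
  \matrix_(k, l) I (fun A => F A k l).

Lemma intmx_ext p q (F G : 'M[C]_n -> 'M[C]_(p, q)) :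
  (forall A, S A -> F A = G A) -> intmx F = intmx G.
Proof.
by move=> h; apply/matrixP => k l; rewrite !mxE; apply: haar_ext => A SA; rewrite h.
Qed.

Lemma intmx_cst p q (F : 'M[C]_(p, q)) : intmx (fun=> F) = F.
Proof. by apply/matrixP => k l; rewrite !mxE haar_cst. Qed.

Lemma intmx_mull p q r (X : 'M[C]_(r, p)) (F : 'M[C]_n -> 'M[C]_(p, q)) :
  cont_on S F -> intmx (fun A => X *m F A) = X *m intmx F.
Proof.
move=> /cont_on_entries cF; apply/matrixP => k l; rewrite !mxE.
rewrite (haar_ext (g := fun A => \sum_j X k j * F A j l)); last by move=> A _; rewrite mxE.
rewrite haar_sum => [|j _]; last by apply: cont_scale.
by apply: eq_bigr => j _; rewrite haar_scale // mxE.
Qed.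

Lemma intmx_adj p q (F : 'M[C]_n -> 'M[C]_(p, q)) :
  cont_on S F -> intmx (fun A => adjmx (F A)) = adjmx (intmx F).
Proof.
move=> /cont_on_entries cF; apply/matrixP => k l; rewrite adjmxE !mxE -haar_conj //.
by apply: haar_ext => A _; rewrite adjmxE.
Qed.

Lemma intmx_mulr p q r (X : 'M[C]_(q, r)) (F : 'M[C]_n -> 'M[C]_(p, q)) :
  cont_on S F -> intmx (fun A => F A *m X) = intmx F *m X.
Proof.
move=> cF; apply: adjmx_inj; rewrite adjmxM -!intmx_adj //; last by apply: cont_on_mulmx => //; apply: cont_on_cst.
rewrite -intmx_mull; last exact: cont_on_adj.
by apply: intmx_ext => A _; rewrite adjmxM.
Qed.

Lemma intmx_inv p q (F : 'M[C]_n -> 'M[C]_(p, q)) (g : 'M[C]_n) :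
  cont_on S F -> S g -> intmx (fun A => F (g *m A)) = intmx F.
Proof.
move=> /cont_on_entries cF Sg; apply/matrixP => k l; rewrite !mxE.
exact: (haar_inv (f := fun A => F A k l)).
Qed.

Lemma intmx_tr p (F : 'M[C]_n -> 'M[C]_p) :
  cont_on S F -> I (fun A => \tr (F A)) = \tr (intmx F).
Proof.
move=> /cont_on_entries cF; rewrite /mxtrace haar_sum //.
by apply: eq_bigr => k _; rewrite mxE.
Qed.

End Haar.

Definition urep (R : rcfType) n d (rho : 'M[R[i]]_n -> 'M[R[i]]_d) : Prop :=
  is_rep rho /\ forall A, unitary A -> unitary (rho A).

Section UnitaryRep.
Variables (R : rcfType) (n d : nat) (rho : 'M[R[i]]_n -> 'M[R[i]]_d).
Hypothesis rhoP : urep rho.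

Lemma urep1 : rho 1%:M = 1%:M. Proof. by case: rhoP => [[]]. Qed.

Lemma urepM A B : unitary A -> unitary B -> rho (A *m B) = rho A *m rho B.
Proof. by case: rhoP => [[_ h _] _]; apply: h. Qed.

Lemma urep_adj A : unitary A -> rho (adjmx A) = adjmx (rho A).
Proof.
move=> uA; have uA' := unitary_adj uA; case: rhoP => _ urho.
have h : rho A *m rho (adjmx A) = 1%:M by rewrite -urepM // uA urep1.
by rewrite -[LHS]mul1mx -(unitary_adjl (urho _ uA)) -mulmxA h mulmx1.
Qed.

Lemma urep_cont : cont_on (@unitary R n) rho. Proof. by case: rhoP => [[]]. Qed.

Lemma urep_unitary A : unitary A -> unitary (rho A). Proof. by case: rhoP => _; apply. Qed.

Lemma urep_nrm A x : unitary A -> nrm (x *m rho A) = nrm x.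
Proof. by move=> uA; rewrite /nrm dotr_mul -mulmxA urep_unitary ?mulmx1. Qed.

Lemma urep_dot A x y : unitary A -> dotr (x *m rho A) y = dotr x (y *m rho (adjmx A)).
Proof. by move=> uA; rewrite dotr_mul urep_adj. Qed.

Variable I : {set 'I_n} -> ('M[R[i]]_n -> R[i]) -> R[i].
Hypothesis hI : forall B, haar_integral (@UB R n B) (I B).

Definition proj B : 'M[R[i]]_d := \matrix_(k, l) I B (fun A => rho A k l).

Let contB B : cont_on (@UB R n B) rho.
Proof. by apply: cont_on_sub urep_cont => A []. Qed.

Lemma projE B : proj B = intmx (I B) rho. Proof. by []. Qed.

Lemma projL B g : UB B g -> rho g *m proj B = proj B.
Proof.
move=> Bg; rewrite projE -(intmx_mull (hI B) _ (@contB B)).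
rewrite -[RHS](intmx_inv (hI B) (@contB B) Bg).
by apply: (intmx_ext (hI B)) => A [uA _]; rewrite urepM //; apply: UB_unitary Bg.
Qed.

(** By left invariance [proj B] absorbs [rho (adjmx A)], so averaging [adjmx (rho A) *m proj B]
    shows that [proj B] equals [adjmx (proj B) *m proj B], which is Hermitian. Right invariance,
    [projR], is then obtained by taking adjoints. *)
Lemma proj_adj B : adjmx (proj B) = proj B.
Proof.
have h : adjmx (proj B) *m proj B = proj B.
  rewrite {1}projE -(intmx_adj (hI B) (@contB B)).
  rewrite -(intmx_mulr (hI B)); last exact: cont_on_adj.
  rewrite -[RHS](intmx_cst (hI B)); apply: (intmx_ext (hI B)) => A BA.
  by rewrite -urep_adj ?projL //; [exact: UB_adj|exact: UB_unitary BA].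
by rewrite -{1}h adjmxM adjmxK.
Qed.

Lemma projR B g : UB B g -> proj B *m rho g = proj B.
Proof.
move=> Bg; apply: adjmx_inj; rewrite adjmxM proj_adj -urep_adj; last exact: UB_unitary Bg.
by rewrite projL //; apply: UB_adj.
Qed.

Lemma proj_fixed q B (x : 'M_(q, d)) :
  x *m proj B = x <-> forall g, UB B g -> x *m rho g = x.
Proof.
split=> [<- g Bg|h]; first by rewrite -mulmxA projR.
rewrite projE -(intmx_mull (hI B) _ (@contB B)) -[RHS](intmx_cst (hI B)).
exact: (intmx_ext (hI B)).
Qed.

Lemma projLfix q B (x : 'M_(d, q)) : (forall g, UB B g -> rho g *m x = x) -> proj B *m x = x.
Proof.
move=> h; rewrite projE -(intmx_mulr (hI B) _ (@contB B)) -[RHS](intmx_cst (hI B)).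
exact: (intmx_ext (hI B)).
Qed.

Lemma proj_idem B : proj B *m proj B = proj B.
Proof. by apply/proj_fixed => g; apply: projR. Qed.

Lemma proj_subL (B D : {set 'I_n}) : B \subset D -> proj B *m proj D = proj D.
Proof. by move=> BD; apply: projLfix => g Bg; apply: projL; apply: UB_sub Bg. Qed.

Lemma proj_subR (B D : {set 'I_n}) : B \subset D -> proj D *m proj B = proj D.
Proof. by move=> BD; apply/proj_fixed => g Bg; apply: projR; apply: UB_sub Bg. Qed.

Lemma proj_comm_rho (B D : {set 'I_n}) g : [disjoint B & D] -> UB D g -> proj B *m rho g = rho g *m proj B.
Proof.
move=> dis Dg; rewrite projE -(intmx_mull (hI B) _ (@contB B)) -(intmx_mulr (hI B) _ (@contB B)).
apply: (intmx_ext (hI B)) => A BA; rewrite -!urepM; try by [exact: UB_unitary BA|exact: UB_unitary Dg].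
by rewrite (UB_comm dis BA Dg).
Qed.

Lemma proj_comm (B D : {set 'I_n}) : [disjoint B & D] -> proj B *m proj D = proj D *m proj B.
Proof.
move=> dis; rewrite {1 2}(projE D) -(intmx_mull (hI D) _ (@contB D)) -(intmx_mulr (hI D) _ (@contB D)).
by apply: (intmx_ext (hI D)) => A DA; apply: proj_comm_rho DA.
Qed.

End UnitaryRep.

Section OrthProj.
Variables (R : rcfType) (d : nat).
Implicit Types (P Q : 'M[R[i]]_d) (x : 'rV[R[i]]_d).

Definition oproj P := adjmx P = P /\ P *m P = P.

Lemma oproj_nrm P x : oproj P -> nrm (x *m P) = dotr (x *m P) x.
Proof. by case=> aP pP; rewrite /nrm [RHS]dotr_mul aP dotr_mul aP -mulmxA pP. Qed.

Lemma oprojC P : oproj P -> oproj (1%:M - P).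
Proof.
case=> aP pP; split; first by rewrite adjmxB adjmx1 aP.
by rewrite mulmxBl mul1mx mulmxBr mulmx1 pP subrr subr0.
Qed.

Lemma oproj_pyth P x : oproj P -> nrm x = nrm (x *m P) + nrm (x *m (1%:M - P)).
Proof.
move=> oP; rewrite !oproj_nrm //; last exact: oprojC.
by rewrite -dotrDl -mulmxDr addrC subrK mulmx1.
Qed.

Lemma oproj_le P x : oproj P -> nrm (x *m P) <= nrm x.
Proof. by move=> oP; rewrite (oproj_pyth x oP) lerDl nrm_ge0. Qed.

Lemma oproj_comm P Q : oproj P -> oproj Q -> P *m Q = Q *m P -> oproj (P *m Q).
Proof.
move=> [aP pP] [aQ pQ] c; split; first by rewrite adjmxM aP aQ.
by rewrite {2}c mulmxA -(mulmxA P) pQ c -mulmxA pP.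
Qed.

End OrthProj.

(** * Elements and moments of the unitary group *)

Section Elements.
Variables (R : rcfType) (n : nat).
Local Notation C := R[i].
Implicit Types (u v w : 'rV[C]_n) (B : {set 'I_n}).

Lemma conj_unit (z : C) : `|z| = 1 -> z * z^* = 1.
Proof. by move=> z1; rewrite -normCK z1 expr1n. Qed.

(** One rank-one family serves twice: for the Householder reflections of [UB_transitive] and for the
    circle subgroups [gz]. For fixed [w] it is closed under products, by [reflM]. *)
Definition refl w (b : C) : 'M[C]_n := 1%:M - b *: (adjmx w *m w).

Lemma reflE w b i j : refl w b i j = (i == j)%:R - b * ((w 0 i)^* * w 0 j).
Proof. by rewrite !mxE big_ord1 adjmxE. Qed.

Lemma mul_refl u w b : u *m refl w b = u - (b * dotr u w) *: w.
Proof.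
rewrite /refl mulmxBr mulmx1 -scalemxAr mulmxA -scalerA; congr (_ - b *: _).
by rewrite {1}[u *m adjmx w]mx11_scalar mul_scalar_mx.
Qed.

Lemma reflM w b b' : refl w b *m refl w b' = refl w (b + b' - b * b' * nrm w).
Proof.
rewrite /refl mulmxBl mul1mx mulmxBr mulmx1 -scalemxAl -scalemxAr.
have -> : adjmx w *m w *m (adjmx w *m w) = nrm w *: (adjmx w *m w).
  rewrite mulmxA -(mulmxA (adjmx w)) [w *m adjmx w]mx11_scalar mul_mx_scalar.
  by rewrite -scalemxAl.
set X := adjmx w *m w; rewrite !scalerA.
by apply/matrixP => i j; rewrite !mxE; ring.
Qed.

Lemma refl_adj w b : adjmx (refl w b) = refl w (b^*).
Proof. by rewrite /refl adjmxB adjmx1 adjmxZ adjmxM adjmxK. Qed.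

Lemma refl_UB B w b : b + b^* = b * b^* * nrm w -> (forall i, i \notin B -> w 0 i = 0) ->
  UB B (refl w b).
Proof.
move=> hb hw; split; first by rewrite /unitary refl_adj reflM hb subrr /refl scale0r subr0.
move=> i j ijB; rewrite reflE; case/orP: ijB => /hw ->.
  by rewrite rmorph0 mul0r mulr0 subr0.
by rewrite !mulr0 subr0.
Qed.

(* complex Householder reflection along [u - v] *)
Lemma UB_transitive B u v : nrm u = nrm v ->
  (forall i, i \notin B -> u 0 i = 0) -> (forall i, i \notin B -> v 0 i = 0) ->
  exists2 k, UB B k & u *m k = v.
Proof.
move=> uv hu hv; pose c := dotr u (u - v).
(* This is the unitarity condition of [refl_UB] for the parameter [c^-1]; it also shows that [c = 0]
   forces [u = v]. *)
have cE : c + c^* = nrm (u - v).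
  rewrite -dotrC /nrm !(dotrBl, dotrBr) -!/(nrm _) -uv.
  by rewrite /c dotrBr -/(nrm u); ring.
have [c0|c0] := eqVneq c 0.
  exists 1%:M; first exact: UB1.
  move: cE; rewrite c0 rmorph0 addr0 => /esym/eqP.
  by rewrite nrm_eq0 subr_eq0 mulmx1 => /eqP.
exists (refl (u - v) c^-1).
  apply: refl_UB => [|i iB]; last by rewrite !mxE hu ?hv ?subrr.
  have c0' : c^* != 0 by rewrite conjC_eq0.
  by rewrite -cE fmorphV /=; field; rewrite c0 c0'.
by rewrite mul_refl mulVf // scale1r opprB addrC subrK.
Qed.

Definition dz (i : 'I_n) (z : C) : 'M[C]_n := diag_mx (\row_j (if j == i then z else 1)).

Lemma diag_unitary (t : 'rV[C]_n) : (forall i, `|t 0 i| = 1) -> unitary (diag_mx t).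
Proof.
move=> ht; rewrite /unitary; apply/matrixP => i j; rewrite mxE (bigD1 i) //=.
rewrite adjmxE !mxE eqxx mulr1n eq_sym big1 ?addr0 => [|k /negbTE ki]; last first.
  by rewrite !mxE eq_sym ki mulr0n mul0r.
case: eqP => [->|_]; first by rewrite conj_unit.
by rewrite mulr0n rmorph0 mulr0.
Qed.

Lemma dz_UB i z : `|z| = 1 -> UB [set i] (dz i z).
Proof.
move=> z1; split; first by apply: diag_unitary => j; rewrite mxE; case: ifP; rewrite // normr1.
move=> j k; rewrite !inE !mxE => h; have [jk|_] := eqVneq j k; last by rewrite mulr0n.
by move: h; rewrite jk orbb => /negbTE ->.
Qed.

Lemma dz_mulE i z (A : 'M[C]_n) j k : (dz i z *m A) j k = (if j == i then z else 1) * A j k.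
Proof. by rewrite mul_diag_mx !mxE. Qed.

Lemma dzM i z z' : dz i z *m dz i z' = dz i (z * z').
Proof.
rewrite /dz mulmx_diag; congr diag_mx; apply/rowP => j; rewrite !mxE.
by case: ifP => // _; rewrite mulr1.
Qed.

Lemma dz1 i : dz i 1 = 1%:M.
Proof.
apply/matrixP => j k; rewrite !mxE; congr (_ *+ _).
by case: ifP.
Qed.

(* the copy of U(1) acting by [z] on the line of [e_i + e_j] *)
Definition gz (i j : 'I_n) (z : C) : 'M[C]_n :=
  refl (delta_mx 0 i + delta_mx 0 j) ((1 - z) / 2).

Section Gz.
Variables (i j : 'I_n).
Hypothesis ij : i != j.

Let wE k : (delta_mx 0 i + delta_mx 0 j : 'rV[C]_n) 0 k = ((k == i) || (k == j))%:R.
Proof.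
rewrite !mxE !eqxx /=; have [->|_] := eqVneq k i; last by rewrite add0r.
by rewrite (negbTE ij) addr0.
Qed.

Let nrmw : nrm (delta_mx 0 i + delta_mx 0 j : 'rV[C]_n) = 2.
Proof.
rewrite /nrm dotrE (bigD1 i) //= (bigD1 j) 1?eq_sym //= !wE !eqxx orbT !rmorph1 !mulr1.
rewrite big1 ?addr0 // => k /andP[ki kj].
by rewrite wE (negbTE ki) (negbTE kj) mul0r.
Qed.

Lemma gzE z k l : gz i j z k l = (k == l)%:R -
  (if ((k == i) || (k == j)) && ((l == i) || (l == j)) then (1 - z) / 2 else 0).
Proof.
rewrite /gz reflE !wE rmorph_nat -natrM mulnb.
by case: ifP => _; rewrite ?mulr1 ?mulr0.
Qed.

Lemma gz_UB z : `|z| = 1 -> UB [set i; j] (gz i j z).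
Proof.
move=> z1; apply: refl_UB => [|k].
  rewrite nrmw fmorph_div rmorphB rmorph1 rmorph_nat /=.
  have h := conj_unit z1; set y := z^* in h *.
  by field: h.
by rewrite !inE negb_or => /andP[ki kj]; rewrite wE (negbTE ki) (negbTE kj).
Qed.

Lemma gzM z z' : gz i j z *m gz i j z' = gz i j (z * z').
Proof. by rewrite reflM nrmw; congr refl; field. Qed.

Lemma gz1 : gz i j 1 = 1%:M.
Proof. by rewrite /gz subrr mul0r /refl scale0r subr0. Qed.

Lemma gz_ii z : gz i j z i i = (1 + z) / 2.
Proof. by rewrite gzE !eqxx /=; field. Qed.
Lemma gz_jj z : gz i j z j j = (1 + z) / 2.
Proof. by rewrite gzE !eqxx orbT /=; field. Qed.
Lemma gz_ij z : gz i j z i j = (z - 1) / 2.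
Proof. by rewrite gzE (negbTE ij) !eqxx orbT /=; field. Qed.
Lemma gz_ji z : gz i j z j i = (z - 1) / 2.
Proof. by rewrite gzE eq_sym (negbTE ij) !eqxx orbT /=; field. Qed.

Lemma gz_mulE z (A : 'M[C]_n) k : (gz i j z *m A) i k = (1 + z) / 2 * A i k + (z - 1) / 2 * A j k.
Proof.
rewrite mxE (bigD1 i) //= (bigD1 j) 1?eq_sym //= gz_ii gz_ij big1 ?addr0 // => l /andP[li lj].
by rewrite gzE (negbTE li) (negbTE lj) andbF subr0 eq_sym (negbTE li) mul0r.
Qed.

End Gz.

End Elements.

Section Moments.
Variables (R : rcfType) (n : nat) (B : {set 'I_n}).
Local Notation C := R[i].
Variable I : ('M[C]_n -> C) -> C.
Hypothesis hI : haar_integral (@UB R n B) I.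
Variable i : 'I_n.
Hypothesis iB : i \in B.
Local Notation cont := (cont_on_fun (@UB R n B)).

(** Left multiplication mixes rows only, so moments of one fixed column [i] form a closed system
    under invariance. *)
Definition mom (a b c d : 'I_n) : C :=
  I (fun A => A a i * A b i * ((A c i)^* * (A d i)^*)).

Lemma cont_mom a b c d : cont (fun A => A a i * A b i * ((A c i)^* * (A d i)^*)).
Proof.
have ce x : cont (fun A => A x i) by apply: cont_entry.
exact: (cont_mul (cont_mul (ce a) (ce b)) (cont_mul (cont_conj (ce c)) (cont_conj (ce d)))).
Qed.

Lemma mom_inv (g : 'M[C]_n) a b c d : UB B g ->
  mom a b c d = I (fun A => (g *m A) a i * (g *m A) b i * (((g *m A) c i)^* * ((g *m A) d i)^*)).
Proof.
move=> Bg; rewrite -[LHS](haar_inv hI Bg) //; exact: cont_mom.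
Qed.

(** Multiplying row [e] by the imaginary unit multiplies the moment by a power of it. If [a, b] and
    [c, d] differ as multisets, some [e] gives a factor other than 1. The sign -1 in place of ['i]
    would not distinguish [a, a] from [c, c]. *)
Lemma mom_eq0 a b c d : a \in B -> b \in B ->
  ~~ ((a == c) && (b == d) || (a == d) && (b == c)) -> mom a b c d = 0.
Proof.
move=> aB bB h.
have key e (w := fun x : 'I_n => if x == e then 'i else 1 : C) : e \in B ->
    w a * w b * ((w c)^* * (w d)^*) != 1 -> mom a b c d = 0.
  move=> eB wN1.
  have Be : UB B (dz e ('i : C)).
    by apply: UB_sub (dz_UB e (normCi _)); rewrite sub1set.
  have : mom a b c d = w a * w b * ((w c)^* * (w d)^*) * mom a b c d.
    rewrite {1}(mom_inv _ _ _ _ Be) -(haar_scale hI); last exact: cont_mom.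
    apply: (haar_ext hI) => A _; rewrite !dz_mulE !rmorphM /= -!/(w _).
    by ring.
  move/eqP; rewrite -subr_eq0 -{1}[mom _ _ _ _]mul1r -mulrBl mulf_eq0 subr_eq0 eq_sym.
  by rewrite (negbTE wN1) => /eqP.
have i1 : 'i != 1 :> C.
  by apply/eqP => /(congr1 (fun x => x ^+ 2)); rewrite sqrCi expr1n => /eqP; rewrite eq_sym -subr_eq0 opprK -(natrD _ 1 1) pnatr_eq0.
have iN1 : - 'i != 1 :> C.
  by apply/eqP => /(congr1 (fun x => x ^+ 2)); rewrite sqrrN sqrCi expr1n => /eqP; rewrite eq_sym -subr_eq0 opprK -(natrD _ 1 1) pnatr_eq0.
have N11 : -1 != 1 :> C by rewrite eq_sym -subr_eq0 opprK -(natrD _ 1 1) pnatr_eq0.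
have ii : 'i * - 'i = 1 :> C by rewrite mulrN mulCii opprK.
have NiNi : - 'i * - 'i = -1 :> C by rewrite mulrNN mulCii.
have [ha|ha] := boolP ((a == c) || (a == d)); last first.
  apply: (key a) => //=; rewrite eqxx !(eq_sym _ a).
  move: ha; rewrite negb_or => /andP[/negbTE -> /negbTE ->].
  by case: ifP; rewrite rmorph1 !mulr1 ?mulCii.
have [hb|hb] := boolP ((b == c) || (b == d)); last first.
  apply: (key b) => //=; rewrite eqxx !(eq_sym _ b).
  move: hb; rewrite negb_or => /andP[/negbTE -> /negbTE ->].
  by case: ifP; rewrite rmorph1 !mulr1 ?mulCii ?mul1r.
apply: (key a) => //=; rewrite eqxx !(eq_sym _ a).
move: h ha hb; have [<-|ab] := eqVneq a b.
  case: (a == c); case: (a == d) => //= _ _ _; rewrite ?rmorph1 ?conjCi ?mulCii ?mulN1r ?mulr1 ?mul1r ?opprK //.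
case: (eqVneq a c) => [<-|ac]; case: (eqVneq a d) => [<-|ad] //=.
all: rewrite ?andbT ?andbF ?orbF ?(negbTE ab) // 1?eq_sym ?(negbTE ab) //.
all: rewrite ?[b == a]eq_sym ?(negbTE ab) ?orbF //=.
all: by move=> /negbTE ->.
Qed.

Lemma momC a b c d : mom a b c d = mom a b d c.
Proof. by apply: (haar_ext hI) => A _; rewrite [(A c i)^* * _]mulrC. Qed.

(** Invariance under [gz a b z] expands the moment into sixteen terms, indexed by four booleans;
    [mom_eq0] leaves the two pure ones and four equal mixed ones. *)
Lemma mom_rot a b z : a \in B -> b \in B -> a != b -> `|z| = 1 ->
  mom a a a a = `|(1 + z) / 2| ^+ 4 * mom a a a a + `|(z - 1) / 2| ^+ 4 * mom b b b b
    + 4 * `|(1 + z) / 2| ^+ 2 * `|(z - 1) / 2| ^+ 2 * mom a b a b.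
Proof.
move=> aB bB ab z1; set p := (1 + z) / 2; set q := (z - 1) / 2.
have Bg : UB B (gz a b z).
  by apply: UB_sub (gz_UB ab z1); apply/subsetP => k; rewrite !inE => /orP[]/eqP->.
pose s (x : bool) := if x then a else b; pose e (x : bool) := if x then p else q.
pose F x y x' y' (A : 'M[C]_n) := (e x * e y * ((e x')^* * (e y')^*)) *
  (A (s x) i * A (s y) i * ((A (s x') i)^* * (A (s y') i)^*)).
have cF x y x' y' : cont (F x y x' y') by apply: cont_scale; apply: cont_mom.
have FE x y x' y' : I (F x y x' y') =
    e x * e y * ((e x')^* * (e y')^*) * mom (s x) (s y) (s x') (s y').
  by rewrite (haar_scale hI) //; apply: cont_mom.
rewrite {1}(mom_inv _ _ _ _ Bg).
pose G (w : bool * bool * (bool * bool)) := F w.1.1 w.1.2 w.2.1 w.2.2.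
have split4 (H : bool -> bool -> bool -> bool -> C) :
    \sum_(w : bool * bool * (bool * bool)) H w.1.1 w.1.2 w.2.1 w.2.2 =
    \sum_x \sum_y \sum_x' \sum_y' H x y x' y'.
  rewrite -(pair_bigA _ (fun u v => H u.1 u.2 v.1 v.2)) /=.
  rewrite -(pair_bigA _ (fun x y => \sum_v H x y v.1 v.2)) /=.
  apply: eq_bigr => x _; apply: eq_bigr => y _.
  by rewrite -(pair_bigA _ (fun x' y' => H x y x' y')).
rewrite (haar_ext hI (g := fun A => \sum_w G w A)); last first.
  move=> A _; rewrite (split4 (fun x y x' y' => F x y x' y' A)) !gz_mulE // -/p -/q.
  by rewrite !big_bool /F /s /e !rmorphD !rmorphM /=; ring.
rewrite (haar_sum hI) => [|w _]; last exact: cF.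
rewrite (eq_bigr _ (fun w _ => FE w.1.1 w.1.2 w.2.1 w.2.2)).
rewrite (split4 (fun x y x' y' => e x * e y * ((e x')^* * (e y')^*) * mom (s x) (s y) (s x') (s y'))).
have ba : b == a = false by rewrite eq_sym (negbTE ab).
have z0 x y x' y' : ~~ ((s x == s x') && (s y == s y') || (s x == s y') && (s y == s x')) ->
    mom (s x) (s y) (s x') (s y') = 0.
  by apply: mom_eq0; rewrite /s; case: ifP.
rewrite !big_bool /=.
rewrite (z0 true true true false) ?(z0 true true false true) ?(z0 true true false false)
  ?(z0 true false true true) ?(z0 true false false false) ?(z0 false true true true)
  ?(z0 false true false false) ?(z0 false false true true) ?(z0 false false true false)
  ?(z0 false false false true) ?mulr0 ?addr0 ?add0r; try by rewrite /s ?eqxx ?ba ?(negbTE ab).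
rewrite /s /e.
have -> : mom a b b a = mom a b a b by rewrite momC.
have -> : mom b a a b = mom a b a b.
  by apply: (haar_ext hI) => A _; rewrite [A b i * _]mulrC.
have -> : mom b a b a = mom a b a b.
  by rewrite momC; apply: (haar_ext hI) => A _; rewrite [A b i * _]mulrC.
rewrite -[4%N]/(2 * 2)%N !exprM !normCK; ring.
Qed.

Lemma col_sum (A : 'M[C]_n) : UB B A -> \sum_(b in B) A b i * (A b i)^* = 1.
Proof.
move=> [uA hA]; have := congr1 (fun M : 'M_n => M i i) (unitary_adjl uA).
rewrite !mxE eqxx => e1; rewrite -[RHS]e1 [RHS](bigID (mem B)) /= [X in _ = _ + X]big1 ?addr0.
  by apply: eq_bigr => b _; rewrite adjmxE mulrC.
move=> b bB; rewrite hA ?bB // (_ : b == i = false) ?mulr0 //.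
by apply: contraNF bB => /eqP ->.
Qed.

Local Notation l := #|B|.

Let l0 : (l%:R : C) != 0.
Proof. by rewrite pnatr_eq0 -lt0n; apply/card_gt0P; exists i. Qed.

Let l1 : (l.+1%:R : C) != 0.
Proof. by rewrite pnatr_eq0. Qed.

(** The rotation with [z = -1] exchanges the two rows up to sign, so the pure moments agree. With
    [z = 'i] both coefficients have squared modulus 1/2, and the pure moment is half of itself plus
    the mixed one. *)
Lemma mom_ab a b : a \in B -> b \in B -> a != b -> mom a a a a = 2 * mom a b a b.
Proof.
move=> aB bB ab.
have h1 := mom_rot aB bB ab (normrN1 _).
rewrite subrr mul0r normr0 !expr0n /= mul0r add0r mulr0 !mul0r addr0 in h1.
have e1 : (-1 - 1) / 2 = -1 :> C by field.
rewrite e1 normrN1 expr1n mul1r in h1.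
have h2 := mom_rot aB bB ab (normCi _).
have n1 : `|(1 + 'i) / 2| ^+ 2 = 2^-1 :> C.
  rewrite normCK fmorph_div rmorphD rmorph1 rmorph_nat /= conjCi.
  have := sqrCi R[i]; rewrite expr2 => h; by field: h.
have n2 : `|('i - 1) / 2| ^+ 2 = 2^-1 :> C.
  rewrite normCK fmorph_div rmorphB rmorph1 rmorph_nat /= conjCi.
  have := sqrCi R[i]; rewrite expr2 => h; by field: h.
rewrite -[4%N]/(2 * 2)%N !exprM n1 n2 -h1 in h2.
have : mom a a a a - 2^-1 * mom a a a a = mom a b a b.
  by rewrite {1}h2; field.
by move=> <-; field.
Qed.

(** The squared moduli in a column add up to 1. Squaring this relation and averaging gives [l] pure
    moments and [l (l - 1)] mixed ones, the latter half as large. *)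
Lemma mom_aa a : a \in B -> mom a a a a = 2 / (l%:R * l.+1%:R).
Proof.
move=> aB.
have al b : b \in B -> mom b b b b = mom a a a a.
  move=> bB; have [->//|ba] := eqVneq b a.
  rewrite (mom_ab bB aB ba) (mom_ab aB bB) 1?eq_sym //; congr (_ * _).
  by apply: (haar_ext hI) => A _; rewrite [A b i * _]mulrC [(A b i)^* * _]mulrC.
have ab b c : b \in B -> c \in B -> mom b c b c = (1 + (b == c)%:R) / 2 * mom a a a a.
  move=> bB cB; have [->|bc] := eqVneq b c; first by rewrite al //=; field.
  by rewrite -(al b) // (mom_ab bB cB bc) /=; field.
have : \sum_(b in B) \sum_(c in B) mom b c b c = 1.
  rewrite (eq_bigr (fun b => I (fun A => \sum_(c in B) A b i * A c i * ((A b i)^* * (A c i)^*)))); last first.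
    by move=> b _; rewrite (haar_sum hI) // => c _; apply: cont_mom.
  rewrite -(haar_sum hI); last by move=> b _; apply: cont_sum => c _; apply: cont_mom.
  rewrite -[RHS](haar_cst hI); apply: (haar_ext hI) => A BA.
  rewrite -[RHS](mulr1 1) -{1}(col_sum BA) -(col_sum BA) mulr_suml.
  apply: eq_bigr => b _; rewrite mulr_sumr; apply: eq_bigr => c _; ring.
under eq_bigr => b bB do under eq_bigr => c cB do rewrite ab //.
under eq_bigr => b bB.
  rewrite -mulr_suml -mulr_suml big_split /= sumr_const (bigD1 b) //= eqxx big1 => [|c /andP[_ /negbTE]].
    rewrite addr0 -natrD; over.
  by rewrite eq_sym => ->.
rewrite sumr_const addn1 => h.
have h3 : l%:R * l.+1%:R * mom a a a a = 2 * (l.+1%:R / 2 * mom a a a a *+ l).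
  by rewrite -mulr_natl; field.
rewrite h mulr1 in h3.
by rewrite -h3 mulrAC divff ?mul1r // mulf_neq0.
Qed.

(** The one-column case of the Weingarten formula. *)
Lemma momE a b c d : a \in B -> b \in B ->
  mom a b c d = ((a == c) && (b == d))%:R / (l%:R * l.+1%:R)
              + ((a == d) && (b == c))%:R / (l%:R * l.+1%:R).
Proof.
move=> aB bB; have [h|h] := boolP ((a == c) && (b == d) || (a == d) && (b == c)); last first.
  by rewrite mom_eq0 //; move: h; rewrite negb_or => /andP[/negbTE -> /negbTE ->]; rewrite !mul0r addr0.
have ab : a != b -> mom a b a b = 1 / (l%:R * l.+1%:R).
  move=> ab; have := mom_aa aB; rewrite (mom_ab aB bB ab) => e.
  by apply: (@mulfI _ 2); rewrite ?pnatr_eq0 // e mul1r.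
case/orP: h => /andP[/eqP <- /eqP <-].
  rewrite !eqxx /= [b == a]eq_sym; have [<-|nab] := eqVneq a b.
    by rewrite mom_aa //= -mulrDl.
  by rewrite ab // mul0r addr0.
rewrite !eqxx /= [b == a]eq_sym momC; have [<-|nab] := eqVneq a b.
  by rewrite mom_aa //= -mulrDl.
by rewrite ab // mul0r add0r.
Qed.

Lemma mom4 a : a \in B -> I (fun A => `|A a i| ^+ 4) = 2 / (l%:R * l.+1%:R).
Proof.
move=> aB; rewrite -(mom_aa aB); apply: (haar_ext hI) => A _.
by rewrite -[4%N]/(2 * 2)%N exprM normCK; ring.
Qed.

Lemma mom2 a : a \in B -> I (fun A => `|A a i| ^+ 2) = l%:R^-1.
Proof.
move=> aB; have -> : I (fun A => `|A a i| ^+ 2) = \sum_(b in B) mom a b a b.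
  rewrite -(haar_sum hI) => [|b _]; last exact: cont_mom.
  apply: (haar_ext hI) => A BA; rewrite normCK -[LHS]mulr1 -(col_sum BA) mulr_sumr.
  by apply: eq_bigr => b _; ring.
under eq_bigr => b bB do rewrite momE // !eqxx /= -mulrDl.
rewrite -mulr_suml big_split /= sumr_const (bigD1 a) //= eqxx big1 => [|c /andP[_ /negbTE]]; last first.
  by rewrite eq_sym => ->.
by rewrite addr0 -natrD addn1 invfM mulrCA mulfV // mulr1.
Qed.

End Moments.

(** * Characters of the circle and weight bases *)

Section CircleCharacters.
Variable R : realType.
Local Notation C := R[i].
Local Notation "x %:C" := (real_complex R x).

Definition expi (x : R) : C := Complex (cos x) (sin x).

Lemma expiD x y : expi (x + y) = expi x * expi y.
Proof. by apply/eqP; rewrite eq_complex /= cosD sinD eqxx /= addrC eqxx. Qed.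

Lemma expi0 : expi 0 = 1.
Proof. by rewrite /expi cos0 sin0. Qed.

Lemma norm_expi x : `|expi x| = 1.
Proof. by rewrite normc_def /= cos2Dsin2 sqrtr1. Qed.

Lemma expi_neq0 x : expi x != 0.
Proof. by rewrite -normr_eq0 norm_expi oner_eq0. Qed.

Lemma expiN x : expi (- x) = (expi x)^-1.
Proof.
apply: (mulfI (expi_neq0 x)); rewrite -expiD subrr expi0 mulfV //.
exact: expi_neq0.
Qed.

Lemma expiMn x k : expi (x *+ k) = expi x ^+ k.
Proof.
elim: k => [|k IH]; first by rewrite mulr0n expi0 expr0.
by rewrite mulrS expiD IH exprS.
Qed.

Lemma expiMz x (j : int) : expi (x *~ j) = expi x ^ j.
Proof.
case: j => k; first by rewrite -pmulrn expiMn.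
by rewrite NegzE mulrNz expiN -pmulrn expiMn exprnN.
Qed.

Lemma unit_expi (z : C) : `|z| = 1 -> exists x, z = expi x.
Proof.
case: z => a b; rewrite normc_def /= => -[] /(congr1 (fun x => x ^+ 2)).
rewrite expr1n sqr_sqrtr ?addr_ge0 ?sqr_ge0 // => ab.
have a1 : -1 <= a <= 1.
  by rewrite -ler_norml -(@expr_le1 _ 2) // real_normK ?num_real // -ab lerDl sqr_ge0.
have sE : sin (acos a) = `|b|.
  by rewrite sin_acos // -ab addrC addKr sqrtr_sqr.
have [b0|b0] := leP 0 b.
  by exists (acos a); rewrite /expi acosK // sE ger0_norm.
by exists (- acos a); rewrite /expi cosN sinN acosK // sE ltr0_norm // opprK.
Qed.

Lemma right_unit_expi (z : C) : `|z| = 1 -> 0 < complex.Re z ->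
  exists2 x, z = expi x & - (pi / 2) <= x <= pi / 2.
Proof.
case: z => a b; rewrite normc_def /= => -[] /(congr1 (fun x => x ^+ 2)).
rewrite expr1n sqr_sqrtr ?addr_ge0 ?sqr_ge0 // => ab a0.
have b1 : -1 <= b <= 1.
  by rewrite -ler_norml -(@expr_le1 _ 2) // real_normK ?num_real // -ab lerDr sqr_ge0.
exists (asin b); last by rewrite asin_geNpi2 // asin_lepi2.
by rewrite /expi asinK // cos_asin // -ab addrK sqrtr_sqr ger0_norm // ltW.
Qed.

Lemma expi_eq1 x : expi x = 1 -> exists j : int, x = (pi *+ 2) *~ j.
Proof.
move=> ex; have p2 : 0 < (pi *+ 2 : R) by rewrite pmulrn_lgt0 // pi_gt0.
pose j := Num.floor (x / (pi *+ 2)); exists j.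
have /andP[j1 j2] := floor_itv (x / (pi *+ 2)).
rewrite -/j in j1 j2.
set y := x - (pi *+ 2) *~ j.
have ey : expi y = 1.
  rewrite /y expiD expiN expiMz ex mul1r /expi cos2pi sin2pi.
  have -> : Complex 1 0 = 1 :> C by [].
  by rewrite exp1rz invr1.
have y0 : 0 <= y.
  by rewrite /y subr_ge0 -mulrzr mulrC -ler_pdivlMr.
have y2 : y < pi *+ 2.
  rewrite /y ltrBlDr; rewrite ltr_pdivrMr // rmorphD /= mulrDl mul1r in j2.
  by rewrite -[X in _ < _ + X]mulrzr mulrC addrC.
suff: y = 0 by move/eqP; rewrite subr_eq0 => /eqP.
have cy : cos y = 1 by move/(congr1 (@complex.Re R)): ey.
have [yp|yp] := leP y pi.
  by apply: cos_inj; rewrite ?in_itv /= ?y0 ?lexx ?pi_ge0 // cos0.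
(* The cosine is injective on [[0, pi]] only, so an angle beyond [pi] is reflected to [2 pi - y]. *)
suff h : pi *+ 2 - y = 0 by move: y2; rewrite -subr_gt0 h ltxx.
apply: cos_inj; rewrite ?in_itv /= ?lexx ?pi_ge0 //.
  by rewrite subr_ge0 ltW //= lerBlDr mulr2n lerD2l ltW.
by rewrite cos0 -cosN opprB -[LHS]cosD2pi subrK.
Qed.

Lemma norm_le_ReIm (z : C) : `|z| <= (`|complex.Re z| + `|complex.Im z|)%:C.
Proof.
rewrite {1}(complexE z) rmorphD /=; apply: le_trans (ler_normD _ _) _.
rewrite normrM [`|'i%C|](_ : _ = 1) ?mul1r; last first.
  by rewrite normc_def /= expr0n add0r expr1n sqrtr1.
have nE (x : R) : `|x%:C| = `|x|%:C :> C.
  by rewrite normc_def /= expr0n addr0 sqrtr_sqr.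
by rewrite !nE.
Qed.

Lemma expi_cont0 (e : R) : 0 < e ->
  exists2 dl, 0 < dl & forall x, `|x| < dl -> `|expi x - 1| < e%:C.
Proof.
move=> e0; have e20 : 0 < e / 2 by rewrite divr_gt0.
have /cvgrPdist_lt/(_ _ e20)/nbhs_ballP[d1 /= d10 h1] := @continuous_cos R 0.
have /cvgrPdist_lt/(_ _ e20)/nbhs_ballP[d2 /= d20 h2] := @continuous_sin R 0.
exists (Num.min d1 d2); first by rewrite lt_min d10.
move=> x; rewrite lt_min => /andP[x1 x2].
apply: le_lt_trans (norm_le_ReIm _) _; rewrite ltcR [ltRHS]splitr /=.
apply: ltrD.
  by have := h1 x; rewrite /ball /= sub0r normrN cos0 distrC; apply.
have := h2 x; rewrite /ball /= sub0r normrN sin0 sub0r normrN subr0; exact.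
Qed.

(* near 1 the square root with positive real part is unique, which determines a
   continuous character on dyadic multiples of a small angle *)
Theorem circle_character (chi : C -> C) :
  (forall z z', `|z| = 1 -> `|z'| = 1 -> chi (z * z') = chi z * chi z') ->
  (forall z, `|z| = 1 -> `|chi z| = 1) ->
  (forall e : C, 0 < e -> exists2 dl : C, 0 < dl &
     forall z, `|z| = 1 -> `|z - 1| < dl -> `|chi z - 1| < e) ->
  exists j : int, forall z, `|z| = 1 -> chi z = z ^ j.
Proof.
move=> chiM chi_norm chi_cont; pose h x := chi (expi x).
have hD x y : h (x + y) = h x * h y by rewrite /h expiD chiM ?norm_expi.
have hn x : `|h x| = 1 by rewrite chi_norm ?norm_expi.
have hne x : h x != 0 by rewrite -normr_eq0 hn oner_eq0.
have h0 : h 0 = 1 by apply: (mulfI (hne 0)); rewrite -hD addr0 mulr1.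
have hN x : h (- x) = (h x)^-1.
  by apply: (mulfI (hne x)); rewrite -hD subrr h0 mulfV.
have hMn x k : h (x *+ k) = h x ^+ k.
  by elim: k => [|k IH]; rewrite ?mulr0n ?expr0 // mulrS hD IH exprS.
have hc (e : R) : 0 < e -> exists2 dl : R, 0 < dl & forall x, `|x| < dl -> `|h x - 1| < e%:C.
  move=> e0; have [|d d0 hd] := chi_cont e%:C; first by rewrite ltcR.
  have dR : d = (complex.Re d)%:C by rewrite RRe_real // gtr0_real.
  have [|d' d'0 hd'] := @expi_cont0 (complex.Re d); first by rewrite -ltcR -dR.
  by exists d' => // x xd; apply: hd; rewrite ?norm_expi // dR; apply: hd'.
have [dl dl0 hdl] := hc 1 ltr01.
have Re_pos x : `|x| < dl -> 0 < complex.Re (h x).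
  move=> /hdl; have := normc_ge_Re (h x - 1); move=> /le_lt_trans H /H.
  rewrite ltcR; case: (h x) => a b /=; rewrite ltr_norml => /andP[+ _].
  by rewrite ltrBrDl subrr.
pose x0 := dl / 2.
have x00 : 0 < x0 by rewrite divr_gt0.
have x0dl : x0 < dl by rewrite ltr_pdivrMr // mulr_natr mulr2n ltrDl.
have [phi hphi /andP[phi1 phi2]] : exists2 x, h x0 = expi x & - (pi / 2) <= x <= pi / 2.
  by apply: right_unit_expi => //; apply: Re_pos; rewrite gtr0_norm.
have dy k : h (x0 / 2 ^+ k) = expi (phi / 2 ^+ k).
  elim: k => [|k IH]; first by rewrite !divr1.
  have half (x : R) : x / 2 ^+ k = (x / 2 ^+ k.+1) *+ 2.
    by rewrite exprS invfM -[RHS]mulr_natr; set Y := (2 ^+ k)^-1; field.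
  have k1 : 1 <= (2 ^+ k : R) by rewrite exprn_ege1 // ler1n.
  have k2 : 2 <= (2 ^+ k.+1 : R) by rewrite exprS ler_peMr.
  have k0 : 0 < (2 ^+ k.+1 : R) by apply: lt_le_trans k2.
  move: IH; rewrite !half hMn expiMn => /eqP.
  rewrite eqf_sqr => /orP[/eqP//|/eqP e1].
  have r1 : 0 < complex.Re (h (x0 / 2 ^+ k.+1)).
    apply: Re_pos; rewrite gtr0_norm ?divr_gt0 //; apply: le_lt_trans x0dl.
    by rewrite ler_pdivrMr // ler_peMr ?(ltW x00) // (le_trans _ k2) // ler1n.
  have r2 : 0 < complex.Re (expi (phi / 2 ^+ k.+1)).
    rewrite /= cos_gt0_pihalf //.
    have pp := pi_gt0 R.
    rewrite ltr_pdivlMr // ltr_pdivrMr //; apply/andP; split.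
      apply: lt_le_trans phi1; rewrite mulNr ltrN2.
      by rewrite ltr_pMr ?divr_gt0 // (lt_le_trans _ k2) // ltr1n.
    apply: le_lt_trans phi2 _.
    by rewrite ltr_pMr ?divr_gt0 // (lt_le_trans _ k2) // ltr1n.
  by move: r1; rewrite e1 /= oppr_gt0 => /lt_trans /(_ r2); rewrite ltxx.
pose lam := phi / x0.
have dy2 k m : h ((x0 / 2 ^+ k) *+ m) = expi (lam * ((x0 / 2 ^+ k) *+ m)).
  rewrite hMn dy mulrnAr expiMn; congr (expi _ ^+ _).
  by rewrite /lam mulrA divfK // gt_eqF.
(* Suppose the two values differ by [d = 2 e]. A dyadic multiple [y] of [x0] just below [x] leaves a
   remainder [r] so small that [h r] and [expi (lam * r)] are both within [e] of 1; as the values at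
   [y] agree, this contradicts the size of [d]. *)
have hpos x : 0 <= x -> h x = expi (lam * x).
  move=> xge0; apply/eqP; rewrite -subr_eq0; apply: contraT; rewrite -normr_gt0 => pos.
  set d := `|h x - expi (lam * x)| in pos.
  have dR : d = (complex.Re d)%:C by rewrite RRe_real // gtr0_real.
  pose e := complex.Re d / 2.
  have e0 : 0 < e by rewrite divr_gt0 // -ltcR -dR.
  have [d1 d10 hd1] := hc e e0; have [d2 d20 hd2] := expi_cont0 e0.
  pose d3 := Num.min d1 (d2 / (`|lam| + 1)).
  have l1 : 0 < `|lam| + 1 by rewrite ltr_wpDl.
  have d30 : 0 < d3 by rewrite lt_min d10 divr_gt0.
  pose k := (Num.truncn (x0 / d3)).+1.
  have xk : x0 / 2 ^+ k < d3.
    rewrite ltr_pdivrMr ?exprn_gt0 // mulrC -ltr_pdivrMr //.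
    apply: lt_le_trans (truncnS_gt _) _.
    by rewrite -/k -natrX ler_nat ltnW // ltn_expl.
  have xk0 : 0 < x0 / 2 ^+ k by rewrite divr_gt0 // exprn_gt0.
  pose m := Num.truncn (x / (x0 / 2 ^+ k)).
  have /andP[m1 m2] : m%:R <= x / (x0 / 2 ^+ k) < m.+1%:R.
    by apply: truncn_itv; rewrite divr_ge0 // ltW.
  pose y := (x0 / 2 ^+ k) *+ m; pose r := x - y.
  have r0 : 0 <= r by rewrite subr_ge0 /y -mulr_natl -ler_pdivlMr.
  have rd3 : r < d3.
    apply: le_lt_trans xk; rewrite /r lerBlDr /y -mulrS.
    rewrite -[leRHS]mulr_natl.
    rewrite -ler_pdivrMr //; exact: ltW.
  have hy : h y = expi (lam * y) by exact: dy2.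
  have: d < (e + e)%:C.
    rewrite /d (_ : x = y + r); last by rewrite /r addrC subrK.
    rewrite hD mulrDr expiD hy -mulrBr normrM norm_expi mul1r.
    rewrite -[h r](subrK 1) -addrA rmorphD /=; apply: le_lt_trans (ler_normD _ _) _.
    apply: ltrD.
      by apply: hd1; rewrite ger0_norm //; apply: lt_le_trans rd3 _; rewrite ge_min lexx.
    rewrite distrC; apply: hd2; rewrite normrM (ger0_norm r0).
    have : r < d2 / (`|lam| + 1) by apply: lt_le_trans rd3 _; rewrite ge_min lexx orbT.
    rewrite ltr_pdivlMr // mulrC; apply: le_lt_trans.
    by rewrite ler_wpM2r // lerDl.
  by rewrite /e -splitr -dR ltxx.
have hall x : h x = expi (lam * x).
  have [|x_lt0] := leP 0 x; first exact: hpos.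
  have -> : expi (lam * x) = (expi (lam * - x))^-1 by rewrite -expiN mulrN opprK.
  by rewrite -hpos ?oppr_ge0 ?ltW // -hN opprK.
(* Periodicity: [h] is 1 at [2 pi], and this makes the slope an integer. *)
have [j hj] : exists j : int, lam * (pi *+ 2) = (pi *+ 2) *~ j.
  by apply: expi_eq1; rewrite -hall /h /expi cos2pi sin2pi -h0 /h expi0.
have lamj : lam = j%:~R.
  have p2 : (pi *+ 2 : R) != 0 by rewrite mulrn_eq0 /= gt_eqF // pi_gt0.
  by apply: (mulIf p2); rewrite hj -mulrzl.
exists j => z /unit_expi[x ->].
by rewrite -/(h x) hall lamj mulrzl expiMz.
Qed.

End CircleCharacters.

(** Simultaneous triangularization applies to finite lists, while the circle and the torus are
    infinite families. A list whose span has maximal dimension spans everything. *)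
Lemma finite_spanning_seq (K : fieldType) (V : vectType K) (T : Type) (F : T -> V) :
  exists s : seq T, forall a, F a \in <<map F s>>%VS.
Proof.
pose P k := `[< exists s : seq T, \dim <<map F s>>%VS = k >].
have exP : exists k, P k by exists (\dim <<map F [::]>>%VS); apply/asboolP; exists [::].
have bound k : P k -> (k <= \dim {:V})%N by move/asboolP => [s <-]; rewrite dimvS ?subvf.
case: (ex_maxnP exP bound) => k /asboolP[s sk] kmax; exists s => a.
have sub : (<<map F s>> <= <<map F (a :: s)>>)%VS by rewrite /= span_cons addvSr.
have : (<<map F s>> == <<map F (a :: s)>>)%VS.
  by rewrite eqEdim sub sk; apply: kmax; apply/asboolP; exists (a :: s).
by move/eqP ->; rewrite memv_span //= mem_head.
Qed.

Lemma in_map_ex (T : Type) (U : eqType) (F : T -> U) (s : seq T) u :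
  u \in map F s -> exists a, u = F a.
Proof.
elim: s => //= a s IH; rewrite inE => /predU1P[->|]; [by exists a|exact: IH].
Qed.

(** * Simultaneous diagonalization of circles and of the torus *)

Section Diagonalization.
Variable R : realType.
Local Notation C := R[i].

Lemma adjmx_tC m n (A : 'M[C]_(m, n)) : adjmx A = map_mx Num.conj A^T.
Proof. by rewrite /adjmx map_trmx. Qed.

Lemma unitarymx_unitary n (P : 'M[C]_n) : P \is unitarymx -> unitary P.
Proof. by move=> /unitarymxP h; rewrite /unitary adjmx_tC. Qed.

(** A common unitary triangularization kills the entries above the diagonal; applied to the
    adjoints, which belong to the family, it kills those below. *)
Lemma unitary_family_diag (T : Type) d (F : T -> 'M[C]_d) :
  (forall a b, F a *m F b = F b *m F a) -> (forall a, exists b, F b = adjmx (F a)) ->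
  exists2 P : 'M[C]_d, unitary P & forall a, is_diag_mx (P *m F a *m adjmx P).
Proof.
move=> comF adjF; have [s hs] := finite_spanning_seq F.
have [|P uP /allP hP] := @cotrigonalization _ _ (map F s).
  by move=> A B /in_map_ex[a ->] /in_map_ex[b ->]; apply: comF.
exists P; first exact: unitarymx_unitary.
have trigF a (i j : 'I_d) : (i < j)%N -> (P *m F a *m adjmx P) i j = 0.
  move=> ij; rewrite (coord_span (X := in_tuple (map F s)) (hs a)).
  rewrite mulmx_sumr mulmx_suml summxE big1 // => k _.
  rewrite -scalemxAr -scalemxAl mxE adjmx_tC.
  set X := _`_k; have : X \in map F s by apply: mem_nth; apply: ltn_ord.
  move=> /hP /= XP; have /is_trig_mxP/(_ i j ij) := XP.
  by rewrite conjymx // => ->; rewrite mulr0.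
move=> a; apply/is_diag_mxP => i j; case: ltngtP => // [ij|ji] _; first exact: trigF.
have [b hb] := adjF a; have := trigF b j i ji.
rewrite hb => /(congr1 Num.conj); rewrite rmorph0 -adjmxE !adjmxM !adjmxK mulmxA //.
Qed.

Variables (n d : nat) (rho : 'M[C]_n -> 'M[C]_d).
Hypothesis rhoP : urep rho.

(** On diagonal unitary matrices a diagonal entry is multiplicative and of modulus 1. The Lipschitz
    condition on [g] transports the continuity of [rho] at the identity, so [circle_character]
    applies. *)
Lemma diag_entry_character (P : 'M[C]_d) (g : C -> 'M[C]_n) r :
  unitary P ->
  (forall z, `|z| = 1 -> unitary (g z)) ->
  (forall z z', g z *m g z' = g (z * z')) -> g 1 = 1%:M ->
  (forall z i j, `|g z i j - (1%:M : 'M[C]_n) i j| <= `|z - 1|) ->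
  (forall z, `|z| = 1 -> is_diag_mx (P *m rho (g z) *m adjmx P)) ->
  exists j : int, forall z, `|z| = 1 -> (P *m rho (g z) *m adjmx P) r r = z ^ j.
Proof.
move=> uP ug gM g1 gc dg; pose F A := P *m rho A *m adjmx P.
have FM A A' : unitary A -> unitary A' -> F (A *m A') = F A *m F A'.
  move=> uA uA'; rewrite /F (urepM rhoP) // !mulmxA; congr (_ *m _ *m _).
  by rewrite -(mulmxA _ (adjmx P)) unitary_adjl // mulmx1.
have uF A : unitary A -> unitary (F A).
  move=> uA; rewrite /F; apply: unitaryM; last exact: unitary_adj.
  by apply: unitaryM => //; apply: urep_unitary.
have FD z s : `|z| = 1 -> s != r -> F (g z) r s = 0.
  by move=> z1 sr; have /is_diag_mxP -> // := dg z z1; rewrite eq_sym.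
apply: (circle_character (chi := fun z => F (g z) r r)) => [z z' z1 z'1|z z1|e e0].
- rewrite -gM FM; [|exact: ug|exact: ug]; rewrite mxE (bigD1 r) //= big1 ?addr0 // => s sr.
  by rewrite FD // mul0r.
- have h : (F (g z) *m adjmx (F (g z))) r r = 1 by rewrite (uF _ (ug _ z1)) mxE eqxx.
  rewrite mxE (bigD1 r) //= big1 ?addr0 in h => [|s sr]; last by rewrite FD // mul0r.
  rewrite adjmxE -normCK in h; apply/eqP.
  by rewrite -(@eqrXn2 _ 2) // expr1n h.
- have cF : cont_on (@unitary R n) F.
    by apply: cont_on_mulmx (cont_on_cst _); apply: cont_on_mulmx (urep_cont rhoP); apply: cont_on_cst.
  have [dl dl0 hdl] := cF _ (unitary1 R n) e e0; exists dl => // z z1 zdl.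
  have := hdl (g z) (ug z z1) _ r r.
  rewrite {2}/F (urep1 rhoP) mulmx1 uP [X in _ - X]mxE eqxx; apply => i j.
  exact: le_lt_trans (gc z i j) zdl.
Qed.

Lemma circle_diag (g : C -> 'M[C]_n) :
  (forall z, `|z| = 1 -> unitary (g z)) ->
  (forall z z', g z *m g z' = g (z * z')) -> g 1 = 1%:M ->
  (forall z i j, `|g z i j - (1%:M : 'M[C]_n) i j| <= `|z - 1|) ->
  exists P : 'M[C]_d, exists m : 'I_d -> int, unitary P /\
    forall z, `|z| = 1 -> rho (g z) = adjmx P *m diag_mx (\row_r z ^ m r) *m P.
Proof.
move=> ug gM g1 gc; pose F (z : {z : C | `|z| = 1}) := rho (g (sval z)).
have ugz (z : {z : C | `|z| = 1}) : unitary (g (sval z)) by case: z => z z1; apply: ug.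
have [z z'|z|P uP hP] := unitary_family_diag (F := F).
- rewrite /F -!(urepM rhoP) //.
  by rewrite !gM mulrC.
- have z1 : `|(sval z)^* | = 1 by rewrite norm_conjC (svalP z).
  exists (exist (fun z : C => `|z| = 1) _ z1); rewrite /F /= -(urep_adj rhoP) //; congr rho.
  have uz := ugz z; rewrite -[LHS]mul1mx -(unitary_adjl uz) -mulmxA gM.
  by rewrite conj_unit ?(svalP z) // g1 mulmx1.
have hP' z : `|z| = 1 -> is_diag_mx (P *m rho (g z) *m adjmx P).
  by move=> z1; apply: (hP (exist (fun z : C => `|z| = 1) _ z1)).
have /choice[m hm] : forall r, exists j : int,
    forall z, `|z| = 1 -> (P *m rho (g z) *m adjmx P) r r = z ^ j.
  by move=> r; apply: diag_entry_character.
exists P, m; split=> // z z1.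
have -> : diag_mx (\row_r z ^ m r) = P *m rho (g z) *m adjmx P.
  apply/matrixP => r s; rewrite !mxE; have [<-|rs] := eqVneq r s.
    by rewrite mulr1n -hm // mxE.
  by rewrite mulr0n; have /is_diag_mxP/(_ r s rs) := hP' _ z1; rewrite mxE => ->.
rewrite !mulmxA unitary_adjl // mul1mx -mulmxA unitary_adjl // mulmx1 //.
Qed.

Lemma gz_diag i j : i != j -> exists P : 'M[C]_d, exists m : 'I_d -> int, unitary P /\
  forall z, `|z| = 1 -> rho (gz i j z) = adjmx P *m diag_mx (\row_r z ^ m r) *m P.
Proof.
move=> ij; apply: circle_diag.
- by move=> z z1; apply: UB_unitary (gz_UB ij z1).
- exact: gzM.
- exact: gz1.
move=> z k l; rewrite (gzE ij) mxE addrAC subrr add0r normrN.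
case: ifP => _; last by rewrite normr0.
by rewrite normrM distrC normfV normr_nat ler_pdivrMr // ler_peMr ?ler1n.
Qed.

Lemma torus_diag : exists P : 'M[C]_d, exists nu : 'I_d -> 'I_n -> int, unitary P /\
  forall t : 'rV[C]_n, (forall i, `|t 0 i| = 1) ->
    rho (diag_mx t) = adjmx P *m diag_mx (\row_r \prod_i t 0 i ^ nu r i) *m P.
Proof.
pose U := {t : 'rV[C]_n | forall i, `|t 0 i| = 1}.
pose F (t : U) := rho (diag_mx (sval t)).
have ut (t : U) : unitary (diag_mx (sval t)) by apply: diag_unitary (svalP t).
have [s t|t|P uP hP] := unitary_family_diag (F := F).
- by rewrite /F -!(urepM rhoP) // diag_mxC.
- have t1 i : `|(map_mx Num.conj (sval t)) 0 i| = 1 by rewrite mxE norm_conjC (svalP t).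
  exists (exist _ _ t1); rewrite /F /= -(urep_adj rhoP) //; congr rho.
  by rewrite adjmx_tC tr_diag_mx map_diag_mx.
have hP' (t : 'rV[C]_n) : (forall i, `|t 0 i| = 1) -> is_diag_mx (P *m rho (diag_mx t) *m adjmx P).
  by move=> t1; apply: (hP (exist _ _ t1)).
have dz1u (i : 'I_n) (z : C) : `|z| = 1 -> forall j : 'I_n, `|(\row_j (if j == i then z else 1)) 0 j| = 1.
  by move=> z1 j; rewrite mxE; case: ifP; rewrite ?normr1.
have /choice[nu hnu] : forall ri : 'I_d * 'I_n, exists j : int,
    forall z, `|z| = 1 -> (P *m rho (dz ri.2 z) *m adjmx P) ri.1 ri.1 = z ^ j.
  move=> [r i] /=; apply: diag_entry_character => //.
  - by move=> z z1; apply: UB_unitary (dz_UB i z1).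
  - exact: dzM.
  - exact: dz1.
  - move=> z j k; rewrite !mxE -mulrnBl; case: (j == k); last by rewrite mulr0n normr0.
    by rewrite mulr1n; case: ifP; rewrite // subrr normr0.
  - by move=> z z1; apply: hP'; apply: dz1u.
exists P, (fun r i => nu (r, i)); split=> // t t1.
have -> : diag_mx (\row_r \prod_i t 0 i ^ nu (r, i)) = P *m rho (diag_mx t) *m adjmx P; last first.
  by rewrite !mulmxA unitary_adjl // mul1mx -mulmxA unitary_adjl // mulmx1.
apply/matrixP => r s; rewrite 2!mxE; have [<-|rs] := eqVneq r s; last first.
  by rewrite mulr0n; have /is_diag_mxP/(_ r s rs) -> := hP' _ t1.
rewrite mulr1n -big_enum /=.
(* The exponents are known for the coordinate circles only; a torus element is built up as their
   product, one coordinate of the enumeration at a time. *)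
pose tt (q : seq 'I_n) : 'rV[C]_n := \row_j (if j \in q then t 0 j else 1).
have tt1 q i : `|tt q 0 i| = 1 by rewrite mxE; case: ifP; rewrite ?normr1.
have -> : t = tt (enum 'I_n) by apply/rowP => j; rewrite mxE mem_enum.
under eq_bigr => j _ do rewrite mxE mem_enum /=.
elim: (enum 'I_n) (enum_uniq 'I_n) => [_|x q IH /= /andP[xq uq]].
  rewrite big_nil (_ : diag_mx _ = 1%:M) ?(urep1 rhoP) ?mulmx1 ?uP ?mxE ?eqxx //.
  by apply/matrixP => j k; rewrite !mxE in_nil.
rewrite big_cons IH // -(hnu (r, x)) //=.
have -> : diag_mx (tt (x :: q)) = dz x (t 0 x) *m diag_mx (tt q).
  rewrite /dz mulmx_diag; congr diag_mx; apply/rowP => j; rewrite !mxE in_cons.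
  have [->|] := eqVneq j x; first by rewrite (negbTE xq) mulr1.
  by rewrite mul1r.
rewrite (urepM rhoP); first last.
- exact: diag_unitary.
- by apply: UB_unitary (dz_UB x _).
set A := rho _; set B := rho _.
have -> : P *m (A *m B) *m adjmx P = (P *m A *m adjmx P) *m (P *m B *m adjmx P).
  by rewrite !mulmxA -(mulmxA _ (adjmx P) P) unitary_adjl // mulmx1.
rewrite [RHS]mxE (bigD1 r) //= [X in _ = _ + X]big1 ?addr0 // => k kr.
have /is_diag_mxP/(_ r k) := hP' _ (dz1u x _ (t1 x)); rewrite eq_sym kr => -> //.
by rewrite mul0r.
Qed.

End Diagonalization.

Lemma poly_eq_on_unit (C : numClosedFieldType) (p q : {poly C}) :
  (forall t, 0 <= t <= 1 -> p.[t] = q.[t]) -> p = q.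
Proof.
move=> h; apply/eqP; rewrite -subr_eq0; apply: contraT => nz.
(* Distinct points of the unit interval, one more than the degree of [p - q] allows as roots. *)
pose s : seq C := [seq (k.+1)%:R^-1 | k <- iota 0 (size (p - q))].
have := max_poly_roots nz (rs := s); rewrite size_map size_iota ltnn; apply.
  apply/allP => _ /mapP[k _ ->]; rewrite /root !hornerE h ?subrr //.
  by rewrite invr_ge0 ler0n invf_le1 ?ltr0n // ler1n.
rewrite map_inj_uniq ?iota_uniq // => a b /invr_inj/eqP.
by rewrite eqr_nat eqSS => /eqP.
Qed.

(** Chebyshev recursion in [w = z + z^-1], written in the variable [(2 + w) / 4], which on the unit
    circle is the squared modulus of [(1 + z) / 2], the corner entry of [gz]. Two consecutive
    polynomials are carried because the recursion has two steps. *)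
Lemma zpow_sum_poly (F : fieldType) (k : nat) : (2 : F) != 0 -> exists q : {poly F},
  forall z : F, z != 0 -> z ^+ k + z ^- k = q.[(2 + z + z^-1) / 4].
Proof.
move=> F2; have F4 : (4 : F) != 0 by rewrite (natrM _ 2 2) mulf_neq0.
suff [q [_ [hq _]]] : exists q q' : {poly F},
    (forall z, z != 0 -> z ^+ k + z ^- k = q.[(2 + z + z^-1) / 4]) /\
    (forall z, z != 0 -> z ^+ k.+1 + z ^- k.+1 = q'.[(2 + z + z^-1) / 4]) by exists q.
elim: k => [|k [q [q' [hq hq']]]].
  exists 2%:P, (4%:P * 'X - 2%:P); split=> z z0; rewrite !hornerE /=.
    by rewrite !expr0 invr1.
  by rewrite expr1; field; rewrite z0 F4.
exists q', ((4%:P * 'X - 2%:P) * q' - q); split=> // z z0.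
rewrite !hornerE /= -hq // -hq' // !exprS; field.
by rewrite F4 z0 expf_neq0.
Qed.

(** * Zonal vectors *)

Section Zonal.
Variables (R : realType) (n d : nat) (rho : 'M[R[i]]_n -> 'M[R[i]]_d).
Local Notation C := R[i].
Hypothesis rhoP : urep rho.
Variables (D : {set 'I_n}) (i0 j0 : 'I_n).
Hypotheses (Di : i0 \in D) (Dj : j0 \in D) (ij : i0 != j0).
Local Notation B := (D :\ i0).

(** The fixed vectors of the stabilizer of the line of [e_i0] in [U(D)], that is, of a point of
    complex projective space; their coefficients are the zonal spherical functions. *)
Definition zonal (x : 'rV[C]_d) :=
  (forall h, UB B h -> x *m rho h = x) /\ (forall z, `|z| = 1 -> x *m rho (dz i0 z) = x).

(** Once row [i0] is a basis vector, orthogonality of the other rows to it clears column [i0]. *)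
Lemma UB_row (h : 'M[C]_n) : UB D h -> row i0 h = delta_mx 0 i0 -> UB B h.
Proof.
move=> [uh hD] r0; have r0E j : h i0 j = (j == i0)%:R.
  by have := congr1 (fun M : 'rV_n => M 0 j) r0; rewrite !mxE eqxx /=.
split=> // i j; rewrite !inE !negb_and !negbK => h1.
have [->|ni] := eqVneq i i0; first by rewrite r0E eq_sym.
have [->|nj] := eqVneq j i0; last first.
  by apply: hD; move: h1; rewrite (negbTE ni) (negbTE nj).
have := congr1 (fun M : 'M_n => M i i0) uh; rewrite !mxE (bigD1 i0) //= big1 ?addr0.
  by rewrite adjmxE r0E eqxx rmorph1 mulr1 => ->.
by move=> k /negbTE k0; rewrite adjmxE r0E k0 rmorph0 mulr0.
Qed.

Lemma UB_fix_delta (k : 'M[C]_n) : UB B k -> delta_mx 0 i0 *m k = delta_mx 0 i0 :> 'rV_n.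
Proof.
move=> [_ hk]; rewrite -rowE; apply/rowP => j.
by rewrite mxE hk ?inE ?eqxx // !mxE eqxx /= eq_sym.
Qed.

Lemma row_unitary_nrm (g : 'M[C]_n) i : unitary g -> nrm (row i g) = 1.
Proof.
move=> ug; rewrite /nrm rowE /dotr adjmxM !mulmxA -(mulmxA _ g) ug mulmx1.
rewrite -[X in (_ *m X)]/(adjmx _) mxE (bigD1 i) //= big1 ?addr0.
  have -> : (delta_mx 0 i : 'rV[C]_n) 0 i = 1 by rewrite mxE !eqxx.
  by rewrite adjmxE mxE !eqxx rmorph1 mulr1.
by move=> k /negbTE ki; rewrite mxE ki andbF mul0r.
Qed.

(* double cosets of [U(D \ i0) x U(1)] in [U(D)] are separated by [`|g i0 i0|] *)
Lemma zonal_double_coset x x' g g' : zonal x -> zonal x' -> UB D g -> UB D g' ->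
  `|g i0 i0| = `|g' i0 i0| -> dotr (x *m rho g) x' = dotr (x *m rho g') x'.
Proof.
move=> [xB xz] [x'B _] Dg Dg' gg'.
have [z z1 zg] : exists2 z, `|z| = 1 & z * g i0 i0 = g' i0 i0.
  have [g0|g0] := eqVneq (g i0 i0) 0.
    by exists 1; rewrite ?normr1 // g0 mulr0; apply/esym/eqP; rewrite -normr_eq0 -gg' g0 normr0.
  exists (g' i0 i0 / g i0 i0); last by rewrite divfK.
  by rewrite normrM normfV gg' mulfV // -gg' normr_eq0.
have Ddz : UB D (dz i0 z) by apply: UB_sub (dz_UB i0 z1); rewrite sub1set.
pose g1 := dz i0 z *m g.
have Dg1 : UB D g1 by apply: UBM.
have g100 : g1 i0 i0 = g' i0 i0 by rewrite dz_mulE eqxx.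
(* After the phase correction the two pole rows share their [i0] entry. What remains of them has
   equal norm and support in [B], so some [k] in [U_B] makes the rows equal; the discrepancy [h]
   then fixes the pole row and lies in [U_B]. *)
pose u := row i0 g1 - g' i0 i0 *: delta_mx 0 i0; pose v := row i0 g' - g' i0 i0 *: delta_mx 0 i0.
have supp (a : 'M[C]_n) : UB D a -> a i0 i0 = g' i0 i0 ->
    forall i, i \notin B -> (row i0 a - g' i0 i0 *: delta_mx 0 i0) 0 i = 0.
  move=> [_ ha] a0 i; rewrite !inE !mxE negb_and negbK eqxx /=.
  have [->|ni] /= := eqVneq i i0; first by rewrite a0 mulr1 subrr.
  by move=> iD; rewrite ha ?iD ?orbT // eq_sym (negbTE ni) mulr0 subr0.
have nrm_a (a : 'M[C]_n) : UB D a -> a i0 i0 = g' i0 i0 ->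
    nrm (row i0 a - g' i0 i0 *: delta_mx 0 i0) = 1 - g' i0 i0 * (g' i0 i0)^*.
  move=> [ua _] a0; have <- := row_unitary_nrm i0 ua.
  rewrite /nrm !dotrE (bigD1 i0) //= [in RHS](bigD1 i0) //= !mxE !eqxx a0 mulr1 subrr mul0r add0r.
  rewrite addrC addrK; apply: eq_bigr => j /negbTE j0'.
  by rewrite !mxE j0' andbF mulr0 subr0.
have [k Bk uk] : exists2 k, UB B k & u *m k = v.
  apply: UB_transitive; [by rewrite !nrm_a|exact: supp|exact: supp].
have Dk : UB D k by apply: UB_sub Bk; apply: subD1set.
have ug1k : unitary (g1 *m k) by apply: unitaryM; [exact: UB_unitary Dg1|exact: UB_unitary Bk].
have rowk : row i0 (g1 *m k) = row i0 g'.
  rewrite row_mul -[row i0 g1](subrK (g' i0 i0 *: delta_mx 0 i0)) mulmxDl uk.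
  by rewrite -scalemxAl UB_fix_delta // subrK.
pose h := g' *m adjmx (g1 *m k).
have Bh : UB B h.
  apply: UB_row; first by apply: UBM => //; apply: UB_adj; apply: UBM.
  rewrite row_mul -rowk -row_mul ug1k; apply/rowP => j; rewrite !mxE eqxx /= eq_sym //.
have -> : g' = h *m (g1 *m k) by rewrite /h -mulmxA unitary_adjl // mulmx1.
have ug1 := UB_unitary Dg1; have uk' := UB_unitary Bk.
rewrite (urepM rhoP (UB_unitary Bh)) // mulmxA (xB h Bh) (urepM rhoP) // mulmxA.
rewrite [RHS](urep_dot rhoP) // x'B; last exact: UB_adj.
by rewrite /g1 (urepM rhoP (UB_unitary Ddz) (UB_unitary Dg)) mulmxA xz.
Qed.

Lemma gz_UB_D (z : C) : `|z| = 1 -> UB D (gz i0 j0 z).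
Proof.
move=> z1; apply: UB_sub (gz_UB ij z1).
by apply/subsetP => k; rewrite !inE => /orP[]/eqP->.
Qed.

Lemma norm2_half (z : C) : `|z| = 1 -> `|(1 + z) / 2| ^+ 2 = (2 + z + z^-1) / 4.
Proof.
move=> z1; have zz := conj_unit z1.
have z0 : z != 0 by rewrite -normr_eq0 z1 oner_eq0.
have -> : z^-1 = z^* by apply: (mulfI z0); rewrite zz mulfV.
rewrite normCK fmorph_div rmorphD rmorph1 rmorph_nat /=.
by set y := z^* in zz *; field: zz.
Qed.

(** The expression is [(1 + Re z) / 2], so the real part has to be [a = 2 t - 1]. *)
Lemma circle_point (t : C) : 0 <= t <= 1 -> exists2 z : C, `|z| = 1 & (2 + z + z^-1) / 4 = t.
Proof.
move=> /andP[t0 t1]; pose a := 2 * t - 1; pose b := sqrtC (1 - a ^+ 2).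
have tr : t \is Num.real by apply: ger0_real.
have ar : a \is Num.real by rewrite rpredB ?rpredM ?realn ?real1.
have a1 : 0 <= 1 - a ^+ 2.
  have -> : 1 - a ^+ 2 = 4 * (t * (1 - t)) by rewrite /a; ring.
  by rewrite mulr_ge0 ?ler0n // mulr_ge0 // subr_ge0.
have br : b \is Num.real by apply: ger0_real; rewrite sqrtC_ge0.
have b2 : b ^+ 2 = 1 - a ^+ 2 by rewrite sqrtCK.
have zz : (a + 'i * b) * (a - 'i * b) = 1.
  have i2 : 'i ^+ 2 = -1 :> C by exact: sqrCi.
  have -> : (a + 'i * b) * (a - 'i * b) = a ^+ 2 - 'i ^+ 2 * b ^+ 2 by ring.
  by rewrite i2 b2; ring.
have zc : (a + 'i * b)^* = a - 'i * b.
  by rewrite rmorphD rmorphM /= conjCi !conj_Creal // mulNr.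
exists (a + 'i * b).
  by apply/eqP; rewrite -(@eqrXn2 _ 2) // normCK zc zz expr1n.
have z0 : a + 'i * b != 0 by apply/eqP => e; move: zz; rewrite e mul0r => /eqP; rewrite eq_sym oner_eq0.
have -> : (a + 'i * b)^-1 = a - 'i * b by apply: (mulfI z0); rewrite zz mulfV.
by rewrite /a; field.
Qed.

(** Every double coset meets the circle [gz i0 j0], on which the coefficient is a Laurent polynomial
    in [z]. The points [z] and [z^-1] lie in the same double coset, so it may be symmetrized, and
    [zpow_sum_poly] turns it into a polynomial in the squared corner entry. *)
Lemma zonal_poly x : zonal x -> exists p : {poly C},
  forall g, UB D g -> dotr (x *m rho g) x = p.[`|g i0 i0| ^+ 2].
Proof.
move=> zx; have [P [m [uP hP]]] := gz_diag rhoP ij.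
have /choice[q hq] : forall r, exists q : {poly C}, forall z : C, z != 0 ->
    z ^+ `|m r|%N + z ^- `|m r|%N = q.[(2 + z + z^-1) / 4].
  by move=> r; apply: zpow_sum_poly; rewrite pnatr_eq0.
pose y := x *m adjmx P; pose c r := y 0 r * (y 0 r)^*.
have fE z : `|z| = 1 -> dotr (x *m rho (gz i0 j0 z)) x = \sum_r c r * z ^ m r.
  move=> z1; rewrite hP // !mulmxA dotr_mul dotrE; apply: eq_bigr => r _.
  by rewrite mul_mx_diag !mxE /c !mxE; ring.
have fsym z : `|z| = 1 -> dotr (x *m rho (gz i0 j0 z)) x = \sum_r c r * z^-1 ^ m r.
  move=> z1; have z0 : z != 0 by rewrite -normr_eq0 z1 oner_eq0.
  have zV1 : `|z^-1| = 1 by rewrite normfV z1 invr1.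
  rewrite -fE //; apply: zonal_double_coset => //; try exact: gz_UB_D.
  rewrite !gz_ii //; apply/eqP; rewrite -(@eqrXn2 _ 2) //.
  by rewrite !norm2_half // invrK addrAC.
exists (\sum_r (c r / 2) *: q r) => g Dg.
have [|z z1 zt] := @circle_point (`|g i0 i0| ^+ 2).
  rewrite exprn_ge0 //= exprn_ile1 // unitary_entry_le1 //; exact: UB_unitary Dg.
rewrite -zt (zonal_double_coset zx zx Dg (gz_UB_D z1)); last first.
  by apply/eqP; rewrite -(@eqrXn2 _ 2) // gz_ii // norm2_half // zt.
have z0 : z != 0 by rewrite -normr_eq0 z1 oner_eq0.
have -> : dotr (x *m rho (gz i0 j0 z)) x =
   (\sum_r c r * z ^ m r + \sum_r c r * z^-1 ^ m r) / 2.
  by rewrite -fE // -fsym //; field.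
rewrite -big_split mulr_suml horner_sum; apply: eq_bigr => r _ /=.
rewrite hornerZ -hq //; case: (m r) => k /=.
  by rewrite -!exprnP exprVn; ring.
by rewrite NegzE -!exprnN exprVn invrK; ring.
Qed.

Variable I : {set 'I_n} -> ('M[C]_n -> C) -> C.
Hypothesis hI : forall E, haar_integral (@UB R n E) (I E).
Local Notation M k := (I B (fun A => `|A j0 j0| ^+ 2 ^+ k)).

Let cM k : cont_on_fun (@UB R n B) (fun A => `|A j0 j0| ^+ 2 ^+ k).
Proof. by apply: cont_exp; apply: cont_norm2; apply: cont_entry. Qed.

(** The coefficient at [s k g] is averaged over [k] in [U_B], where [s] exchanges the poles. Only
    the path through [j0] contributes to the corner entry of [s k g], whose squared modulus is
    therefore [|k_jj|^2 (1 - t)]: the last factor is the squared modulus of the [j0, i0] entry of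
    [g]. The moments then come out as coefficients of powers of [1 - 'X]. *)
Lemma zonal_functional_eq x a (p : {poly C}) : zonal x ->
  (forall g, UB D g -> dotr (x *m rho g) x = p.[`|g i0 i0| ^+ 2]) ->
  x *m rho (gz i0 j0 (-1)) *m proj rho I B = a *: x ->
  a *: p = \sum_(k < size p) (p`_k * M k) *: (1 - 'X) ^+ k.
Proof.
move=> zx hp ha; apply: poly_eq_on_unit => t t01.
have [z z1 zt] := circle_point t01.
pose s := gz i0 j0 (-1 : C); pose g := gz i0 j0 z.
have Ds : UB D s by apply: gz_UB_D; rewrite normrN1.
have Dg : UB D g by apply: gz_UB_D.
have g00 : `|g i0 i0| ^+ 2 = t by rewrite gz_ii // norm2_half.
have g10 : `|g j0 i0| ^+ 2 = 1 - t.
  have z0 : z != 0 by rewrite -normr_eq0 z1 oner_eq0.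
  rewrite gz_ji // -[z - 1]opprB mulNr normrN norm2_half ?normrN // invrN -zt.
  by field.
have skg k : UB B k -> `|(s *m k *m g) i0 i0| ^+ 2 = `|k j0 j0| ^+ 2 * (1 - t).
  move=> [_ hk]; rewrite -mulmxA mxE (bigD1 j0) //= big1 ?addr0 => [|l lj]; last first.
    rewrite /s (gzE ij) eqxx /= (negbTE lj) orbF; have [->|li] := eqVneq l i0.
      by rewrite /=; field.
    by rewrite subr0 mul0r.
  rewrite gz_ij // mxE (bigD1 j0) //= big1 ?addr0 => [|l lj]; last first.
    have [->|li] := eqVneq l i0; first by rewrite hk ?inE ?eqxx ?orbT // eq_sym (negbTE ij) mul0r.
    by rewrite /g (gzE ij) (negbTE lj) (negbTE li) subr0 mulr0.
  by rewrite !normrM !exprMn g10 normfV normr_nat -opprD normrN (_ : 1 + 1 = 2 :> C) // normr_nat; field.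
have cB : cont_on (@UB R n B) rho by apply: cont_on_sub (urep_cont rhoP) => A [].
have us := UB_unitary Ds; have ug := UB_unitary Dg.
have : a * dotr (x *m rho g) x = I B (fun k => p.[`|k j0 j0| ^+ 2 * (1 - t)]).
  rewrite -dotrZl scalemxAl -ha -!mulmxA mulmxA.
  have -> : dotr (x *m rho s *m (proj rho I B *m rho g)) x =
     (x *m rho s *m proj rho I B *m (rho g *m adjmx x)) 0 0 by rewrite /dotr !mulmxA.
  rewrite projE -(intmx_mull (hI B) _ cB) -(intmx_mulr (hI B)); last first.
    by apply: cont_on_mulmx => //; apply: cont_on_cst.
  rewrite mxE; apply: (haar_ext (hI B)) => k Bk.
  have uk := UB_unitary Bk; have Dk : UB D k by apply: UB_sub Bk; apply: subD1set.
  rewrite -skg // -hp; last by do 2 apply: UBM => //.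
  by rewrite /dotr !(urepM rhoP) //; [rewrite !mulmxA|apply: unitaryM].
rewrite hp // g00 hornerZ => ->; rewrite horner_sum.
rewrite (haar_ext (hI B) (g := fun A => \sum_(k < size p) p`_k * (1 - t) ^+ k * `|A j0 j0| ^+ 2 ^+ k)).
  rewrite (haar_sum (hI B)) => [|k _]; last exact: cont_scale.
  apply: eq_bigr => k _; rewrite (haar_scale (hI B)) // hornerZ horner_exp !hornerE; ring.
by move=> A _; rewrite horner_coef; apply: eq_bigr => k _; rewrite exprMn; ring.
Qed.

Lemma zonal_eigenvalue x a : zonal x -> x != 0 -> x *m proj rho I D = 0 ->
  x *m rho (gz i0 j0 (-1)) *m proj rho I B = a *: x ->
  exists2 K, (0 < K)%N & a = (-1) ^+ K * M K.
Proof.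
move=> zx x0 xD ha; have [p hp] := zonal_poly zx.
(* comparing leading coefficients in the functional equation *)
have := zonal_functional_eq zx hp ha.
have f1 : nrm x = p.[1].
  by have := hp _ (UB1 R D); rewrite (urep1 rhoP) mulmx1 mxE eqxx normr1 expr1n.
have p0 : p != 0 by apply: contraNneq x0 => p0; rewrite -nrm_eq0 f1 p0 horner0.
pose K := (size p).-1.
have sp : size p = K.+1 by rewrite prednK // lt0n size_poly_eq0.
have pK : p`_K != 0 by rewrite -[K]/(size p).-1 -lead_coefE lead_coef_eq0.
(* A constant [p] would make [x] invariant under [U(D)], against [xD]. *)
have K0 : (0 < K)%N.
  rewrite lt0n; apply: contraNneq x0 => K0.
  have pc : p = (p`_0)%:P by apply: size1_polyC; rewrite sp K0.
  suff : x *m proj rho I D = x by rewrite xD => <-.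
  apply/(proj_fixed rhoP hI) => g Dg.
  apply/eqP; rewrite -subr_eq0 -nrm_eq0.
  have hg : dotr (x *m rho g) x = nrm x by rewrite hp // f1 pc !hornerC.
  rewrite /nrm !(dotrBl, dotrBr) -/(nrm _) (urep_nrm rhoP); last exact: UB_unitary Dg.
  rewrite [dotr x _]dotrC !hg -/(nrm x) (CrealP (ger0_real (nrm_ge0 x))).
  by rewrite !subrr.
have powE k : (1 - 'X : {poly C}) ^+ k = (-1) ^+ k *: ('X - 1%:P) ^+ k.
  by rewrite -exprZn scaleN1r opprB.
move=> e; exists K => //; apply: (mulIf pK).
have := congr1 (fun q : {poly C} => q`_K) e; rewrite coefZ => ->.
rewrite sp big_ord_recr /= coefD coef_sum big1 ?add0r => [|k _]; last first.
  rewrite coefZ [X in _ * X]nth_default ?mulr0 //.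
  by rewrite powE size_scale ?signr_eq0 // size_exp_XsubC ltn_ord.
rewrite coefZ powE coefZ.
have := lead_coef_exp ('X - 1%:P : {poly C}) K.
by rewrite lead_coefXsubC expr1n lead_coefE size_exp_XsubC /= => ->; ring.
Qed.

(** For [K = 1] the value is [- 1 / (m - 1)], which is at least [- 2 / m]. Entries have modulus at
    most 1, so for [K >= 2] the moment is at most the fourth one, [2 / (m (m - 1))], which [mom4]
    gives on [U(m - 1)]. *)
Lemma zonal_eigenvalue_bounds x a : (2 < #|D|)%N -> zonal x -> x != 0 -> x *m proj rho I D = 0 ->
  x *m rho (gz i0 j0 (-1)) *m proj rho I B = a *: x ->
  - (2 / #|D|%:R) <= a <= 2 / (#|D|%:R * (#|D|.-1)%:R).
Proof.
move=> D3 zx x0 xD /(zonal_eigenvalue zx x0 xD)[K K0 ->].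
have cB : #|B| = #|D|.-1 by rewrite [in RHS](cardsD1 i0) Di.
have jB : j0 \in B by rewrite !inE eq_sym ij Dj.
set m := #|D| in D3 cB *.
have mE : m = m.-1.+1 by rewrite prednK // (leq_trans _ D3).
have m0 : 0 < (m%:R : C) by rewrite ltr0n (leq_trans _ D3).
have m1 : 0 < (m.-1%:R : C) by rewrite ltr0n -ltnS -mE (leq_trans _ D3).
have M1 : M 1%N = (m.-1%:R)^-1.
  rewrite -cB -(mom2 (hI B) jB jB); apply: (haar_ext (hI B)) => A _; rewrite expr1 //.
have M2 : M 2%N = 2 / (m%:R * m.-1%:R).
  rewrite [m%:R * _]mulrC [in m%:R]mE -cB -(mom4 (hI B) jB jB).
  by apply: (haar_ext (hI B)) => A _; rewrite -exprM.
have Mge0 k : 0 <= M k by apply: (haar_ge0 (hI B)) => // A _; rewrite !exprn_ge0.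
have M2le : 2 / (m%:R * m.-1%:R) <= 2 / m%:R :> C.
  rewrite ler_pM2l // lef_pV2 ?posrE ?mulr_gt0 // ler_peMr ?(ltW m0) //.
  by rewrite ler1n -ltnS -mE (leq_trans _ D3).
have MK2 k : (2 <= k)%N -> M k <= 2 / (m%:R * m.-1%:R).
  move=> k2; rewrite -M2; apply: (haar_le (hI B)) => // A [uA _].
  by apply: ler_wiXn2l k2; rewrite ?exprn_ge0 // exprn_ile1 // unitary_entry_le1.
have [K1|K1] := eqVneq K 1%N.
  rewrite K1 expr1 mulN1r M1 lerN2; apply/andP; split; last first.
    by apply: (@le_trans _ _ 0); rewrite ?oppr_le0 ?invr_ge0 ?divr_ge0 ?mulr_ge0 ?ltW.
  rewrite -[leLHS]mul1r ler_pdivrMr // mulrAC ler_pdivlMr // mul1r.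
  rewrite -natrM ler_nat; lia.
have K2 : (2 <= K)%N by case: K K0 K1 => [|[|k]].
have nn1 : 0 <= 2 / (m%:R * m.-1%:R) :> C by rewrite divr_ge0 // mulr_ge0 // ltW.
have nn2 : - (2 / m%:R) <= 0 :> C by rewrite oppr_le0 divr_ge0 // ltW.
rewrite -signr_odd; case: (odd K); rewrite ?expr1 ?expr0 ?mulN1r ?mul1r; apply/andP; split.
- by rewrite lerN2; apply: le_trans (MK2 _ K2) M2le.
- by apply: le_trans nn1; rewrite oppr_le0.
- exact: le_trans nn2 _.
- exact: MK2.
Qed.

End Zonal.

(** * The corank-one inequality *)

Section Hermitian.
Variables (R : realType) (d : nat).
Local Notation C := R[i].

Lemma hermitian_diag (A : 'M[C]_d) : adjmx A = A ->
  exists P : 'M[C]_d, exists s : 'rV[C]_d, unitary P /\ A = adjmx P *m diag_mx s *m P.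
Proof.
move=> hA; have : A \is normalmx.
  by apply/normalmxP; rewrite -adjmx_tC hA.
move=> /orthomx_spectralP e; exists (spectralmx A), (spectral_diag A).
split; first by apply: unitarymx_unitary; apply: spectral_unitarymx.
by rewrite adjmx_tC -invmx_unitary ?spectral_unitarymx.
Qed.

Lemma diag_eigenvector (P : 'M[C]_d) s r : unitary P ->
  row r P *m (adjmx P *m diag_mx s *m P) = s 0 r *: row r P.
Proof.
by move=> uP; rewrite !mulmxA -row_mul uP row1 -rowE row_diag_mx -scalemxAl -rowE.
Qed.

Lemma row_unitary_neq0 (P : 'M[C]_d) r : unitary P -> row r P != 0.
Proof. by move=> uP; rewrite -nrm_eq0 row_unitary_nrm // oner_eq0. Qed.

Lemma hermitian_bounds (A : 'M[C]_d) lo hi x : adjmx A = A ->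
  (forall a (v : 'rV[C]_d), v != 0 -> v *m A = a *: v -> lo <= a <= hi) ->
  lo * nrm x <= dotr (x *m A) x <= hi * nrm x.
Proof.
move=> hA h; have [P [s [uP AE]]] := hermitian_diag hA.
have hs r : lo <= s 0 r <= hi.
  by apply: (h _ _ (row_unitary_neq0 r uP)); rewrite AE diag_eigenvector.
pose y := x *m adjmx P.
have -> : nrm x = \sum_r y 0 r * (y 0 r)^*.
  rewrite -dotrE -/(nrm y) /nrm /y dotr_mul adjmxK -mulmxA unitary_adjl // mulmx1 //.
have -> : dotr (x *m A) x = \sum_r s 0 r * (y 0 r * (y 0 r)^*).
  rewrite AE !mulmxA dotr_mul dotrE; apply: eq_bigr => r _.
  by rewrite mul_mx_diag mxE; ring.
rewrite !mulr_sumr; apply/andP; split; apply: ler_sum => r _; have /andP[s1 s2] := hs r.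
all: by apply: ler_wpM2r => //; apply: mul_conjC_ge0.
Qed.

End Hermitian.

Section Gram.
Variables (R : realType) (n d : nat) (rho : 'M[R[i]]_n -> 'M[R[i]]_d).
Local Notation C := R[i].
Hypothesis rhoP : urep rho.
Variable I : {set 'I_n} -> ('M[C]_n -> C) -> C.
Hypothesis hI : forall E, haar_integral (@UB R n E) (I E).
Variable D : {set 'I_n}.
Local Notation P := (proj rho I).

Definition projT i : 'M[C]_d := P (D :\ i) *m P [set i].

Lemma disj_set1 i : [disjoint D :\ i & [set i]].
Proof. by rewrite disjoint_sym disjoints1 !inE eqxx. Qed.

Lemma proj_oproj E : oproj (P E).
Proof. by split; [exact: proj_adj|exact: proj_idem]. Qed.

Lemma projT_oproj i : oproj (projT i).
Proof. by apply: oproj_comm (proj_oproj _) (proj_oproj _) _; apply: proj_comm (disj_set1 i). Qed.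

Lemma UB_set1 i (h : 'M[C]_n) : UB [set i] h -> exists2 z, `|z| = 1 & h = dz i z.
Proof.
move=> [uh hh]; exists (h i i).
  have := congr1 (fun M : 'M_n => M i i) uh; rewrite !mxE (bigD1 i) //= big1 ?addr0.
    rewrite eqxx adjmxE -normCK => e; apply/eqP.
    by rewrite -(@eqrXn2 _ 2) // e expr1n.
  by move=> k ki; rewrite adjmxE hh ?inE ?ki ?orbT // eq_sym (negbTE ki) mul0r.
apply/matrixP => j k; rewrite !mxE; have [->|jk] := eqVneq j k.
  by have [->|ki] := eqVneq k i; rewrite ?mulr1n // hh ?inE ?ki // eqxx.
rewrite mulr0n hh; first by rewrite (negbTE jk).
by rewrite !inE -negb_and; apply: contraNN jk => /andP[/eqP-> /eqP->].
Qed.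

Lemma zonalP i x : zonal rho D i x <-> x *m projT i = x.
Proof.
have pT := proj_oproj.
split=> [[h1 h2]|e].
  rewrite /projT mulmxA (_ : x *m P (D :\ i) = x); last exact/(proj_fixed rhoP hI).
  apply/(proj_fixed rhoP hI) => h /UB_set1[z z1 ->]; exact: h2.
split.
  apply/(proj_fixed rhoP hI); rewrite -e /projT (proj_comm rhoP hI (disj_set1 i)).
  by rewrite -!mulmxA proj_idem.
move=> z z1; have : UB [set i] (dz i z) by apply: dz_UB.
move: (dz i z); apply/(proj_fixed rhoP hI).
by rewrite -e /projT -!mulmxA proj_idem.
Qed.

Lemma projTE i : projT i = P (D :\ i) *m P [set i]. Proof. by []. Qed.

Local Opaque projT.

(** At [z = -1] the element [gz] is the reflection sending [e_i] to [- e_j] and [e_j] to [- e_i]; it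
    conjugates the circle at one pole into the circle at the other. *)
Lemma gzN1_dz (i j : 'I_n) (z : C) : i != j ->
  gz i j (-1) *m dz i z = dz j z *m gz i j (-1).
Proof.
move=> ij; have := gzE ij (-1 : C); move: (gz i j (-1)) => G hG.
rewrite mul_mx_diag mul_diag_mx; apply/matrixP => k l; rewrite !mxE !hG.
have e1 : (1 - -1) / 2 = 1 :> C by field.
rewrite e1; have [->|kj] := eqVneq k j; have [->|li] := eqVneq l i.
- by rewrite eq_sym (negbTE ij) orbT /= mulrC.
- rewrite orbT /= (_ : (j == l)%:R - _ = 0 :> C) ?mulr0 ?mul0r // eq_sym.
  by case: eqP => _; rewrite subrr.
- rewrite orbF /= (_ : (k == i)%:R - _ = 0 :> C) ?mulr0 ?mul0r //.
  by case: eqP => _; rewrite subrr.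
- by rewrite mulrC.
Qed.

Lemma gzN1_sq (i j : 'I_n) : i != j -> gz i j (-1) *m gz i j (-1) = 1%:M :> 'M[C]_n.
Proof. by move=> ij; rewrite gzM // mulrNN mulr1 gz1. Qed.

Lemma gzN1_adj (i j : 'I_n) : adjmx (gz i j (-1) : 'M[C]_n) = gz i j (-1).
Proof. by rewrite /gz refl_adj fmorph_div rmorphB rmorphN rmorph1 rmorph_nat. Qed.

Lemma UB_D_gz (i j : 'I_n) : i \in D -> j \in D -> i != j -> UB D (gz i j (-1 : C)).
Proof. by move=> iD jD ij; apply: gz_UB_D; rewrite ?normrN1. Qed.

Lemma zonal_gz i j x : i \in D -> j \in D -> i != j ->
  zonal rho D i x -> zonal rho D j (x *m rho (gz i j (-1))).
Proof.
move=> iD jD ij [h1 h2]; set t := gz i j (-1).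
have Dt : UB D t by apply: UB_D_gz.
have ut := UB_unitary Dt; have tt : t *m t = 1%:M by apply: gzN1_sq.
split=> [h Bh|z z1].
  have uh := UB_unitary Bh; have Dh : UB D h by apply: UB_sub Bh; apply: subD1set.
  have : UB (D :\ i) (t *m h *m t).
    apply: UB_row; first by do 2 apply: UBM => //.
    rewrite !row_mul; have -> : row i t = - delta_mx 0 j.
      apply/rowP => k; rewrite mxE [RHS]mxE [in RHS]mxE eqxx /t (gzE ij) eqxx /=.
      have e1 : (1 - -1) / 2 = 1 :> C by field.
      rewrite e1 eq_sym; have [->|ki] := eqVneq k i; first by rewrite (negbTE ij) subrr oppr0.
      by rewrite /= sub0r; case: (k == j).
    have -> : (- delta_mx 0 j *m h : 'rV_n) = - delta_mx 0 j by rewrite mulNmx (UB_fix_delta Bh).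
    rewrite mulNmx -rowE; apply/rowP => k; rewrite mxE mxE [RHS]mxE eqxx /t (gzE ij) eqxx orbT /=.
    have e1 : (1 - -1) / 2 = 1 :> C by field.
    rewrite e1 [j == k]eq_sym; have [->|kj] := eqVneq k j.
      by rewrite orbT subrr oppr0 eq_sym (negbTE ij).
    by rewrite orbF sub0r; case: eqP => _; rewrite ?opprK ?oppr0.
  move=> /h1 e.
  have e2 : rho (t *m h *m t) *m rho t = rho t *m rho h.
    rewrite -(urepM rhoP) //; last by do 2 apply: unitaryM => //.
    by rewrite -mulmxA tt mulmx1 (urepM rhoP).
  by rewrite -mulmxA -e2 mulmxA e.
have udz (k : 'I_n) : unitary (dz k z) by apply: UB_unitary (dz_UB k z1).
rewrite -mulmxA -(urepM rhoP) // /t -[gz i j (-1) *m dz j z]/(t *m dz j z).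
have -> : t *m dz j z = dz i z *m t.
  have e := gzN1_dz z ij; rewrite -/t in e.
  by rewrite -[RHS]mul1mx -tt -!mulmxA [t *m (dz i z *m t)]mulmxA e -!mulmxA tt mulmx1.
by rewrite (urepM rhoP) // mulmxA h2.
Qed.

Hypothesis D3 : (2 < #|D|)%N.
Local Notation m := #|D|.

Lemma zonal_quadratic_bounds i j y : i \in D -> j \in D -> i != j ->
  zonal rho D i y -> y *m P D = 0 ->
  - (2 / m%:R) * nrm y <= dotr (y *m rho (gz i j (-1))) y <= 2 / (m%:R * m.-1%:R) * nrm y.
Proof.
move=> iD jD ij zy yD; set s := gz i j (-1).
have Ds : UB D s by apply: UB_D_gz.
have us := UB_unitary Ds.
have [aN NN] := projT_oproj i; have [aD DD] := proj_oproj D.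
have sND : projT i *m P D = P D.
  by rewrite projTE -mulmxA !proj_subL // ?subD1set // sub1set.
have sDN : P D *m projT i = P D by rewrite -[LHS]adjmxK adjmxM aN aD sND aD.
(* Compression of [rho s] to the zonal vectors, with the invariants, on which [s] acts as 1,
   subtracted. An eigenvector for a nonzero eigenvalue lies in the range of [A], hence is zonal and
   orthogonal to the invariants; the eigenvalue 0 satisfies the bounds anyway. *)
pose A := projT i *m rho s *m projT i - P D.
have aA : adjmx A = A.
  rewrite /A adjmxB aD; congr (_ - _).
  by rewrite (adjmxM (_ *m rho s)) (adjmxM _ (rho s)) aN -(urep_adj rhoP us) gzN1_adj mulmxA.
have AN : A *m projT i = A by rewrite /A mulmxBl sDN -(mulmxA (_ *m rho s)) NN.
have AD : A *m P D = 0.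
  by rewrite /A mulmxBl DD -(mulmxA (_ *m rho s)) sND -mulmxA (projL rhoP hI Ds) sND subrr.
have yN : y *m projT i = y by apply/zonalP.
have -> : dotr (y *m rho s) y = dotr (y *m A) y.
  rewrite /A mulmxBr yD subr0 (mulmxA y (_ *m _)) (mulmxA y (projT i)) yN.
  by rewrite [RHS]dotr_mul aN yN.
apply: hermitian_bounds => // a v v0 va.
have m0 : 0 < (m%:R : C) by rewrite ltr0n (leq_trans _ D3).
have [a0|a0] := eqVneq a 0.
  by rewrite a0 oppr_le0 !divr_ge0 ?mulr_ge0 ?(ltW m0) ?ler0n.
have vE : v = a^-1 *: (v *m A) by rewrite va scalerA mulVf // scale1r.
have vN : v *m projT i = v by rewrite vE -scalemxAl -mulmxA AN.
have vD : v *m P D = 0 by rewrite vE -scalemxAl -mulmxA AD mulmx0 scaler0.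
have zv : zonal rho D i v by apply/zonalP.
apply: (zonal_eigenvalue_bounds rhoP iD jD ij hI D3 zv v0 vD).
have e : v *m rho s *m projT i = a *: v.
  by rewrite -va /A mulmxBr vD subr0 (mulmxA v (_ *m _)) (mulmxA v (projT i)) vN.
(* The vector [v *m rho s] is already fixed by the circle at [i]: moving past [s] turns it into the
   circle at [j], which lies in [U_(D \ i)]. So [projT i] acts on it as [P (D :\ i)]. *)
rewrite -e projTE (proj_comm rhoP hI (disj_set1 i)) mulmxA; congr (_ *m _); apply/esym.
apply/(proj_fixed rhoP hI) => h /UB_set1[z z1 ->].
have udz (k : 'I_n) : unitary (dz k z) by apply: UB_unitary (dz_UB k z1).
rewrite -mulmxA -(urepM rhoP us (udz i)) (gzN1_dz z ij) (urepM rhoP (udz j) us) mulmxA; congr (_ *m _).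
case: zv => h1 _; apply: h1; apply: UB_sub (dz_UB j z1).
by rewrite sub1set !inE eq_sym ij.
Qed.

Lemma mean_decomposition (y e : 'I_n -> 'rV[C]_d) (Y : 'rV[C]_d) (A : 'M[C]_d) :
  (forall i, y i = e i + Y) -> \sum_(i in D) e i = 0 ->
  \sum_(i in D) dotr (y i *m A) (y i) =
  \sum_(i in D) dotr (e i *m A) (e i) + m%:R * dotr (Y *m A) Y.
Proof.
move=> yE e0.
have yE' i : dotr (y i *m A) (y i) = (dotr (e i *m A) (e i) + dotr (e i *m A) Y)
    + (dotr (Y *m A) (e i) + dotr (Y *m A) Y).
  by rewrite yE mulmxDl dotrDl !dotrDr.
rewrite (eq_bigr _ (fun i _ => yE' i)) big_split /= big_split /= [X in _ + X]big_split /=.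
have -> : \sum_(i in D) dotr (e i *m A) Y = 0.
  by rewrite -(dotr_suml _ _ (fun i => e i *m A)) -mulmx_suml e0 mul0mx dotr0l.
have -> : \sum_(i in D) dotr (Y *m A) (e i) = 0.
  by rewrite -(dotr_sumr _ _ e) e0 dotrC dotr0l rmorph0.
by rewrite addr0 add0r sumr_const; congr (_ + _); apply/esym/mulr_natl.
Qed.

(** Moving every pole to [i0] places all the vectors in a single space of zonal vectors, where mean
    and deviations make sense. *)
Definition to_pole i0 i : 'M[C]_n := if i == i0 then 1%:M else gz i0 i (-1).

Lemma to_pole_UB i0 i : i0 \in D -> i \in D -> UB D (to_pole i0 i).
Proof.
move=> iD jD; rewrite /to_pole; case: eqP => [_|/eqP ij]; first exact: UB1.
by apply: UB_D_gz; rewrite // eq_sym.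
Qed.

Lemma to_pole_adj i0 i : adjmx (to_pole i0 i) = to_pole i0 i.
Proof. by rewrite /to_pole; case: eqP => _; rewrite ?adjmx1 ?gzN1_adj. Qed.

Lemma to_pole_sq i0 i : to_pole i0 i *m to_pole i0 i = 1%:M.
Proof. by rewrite /to_pole; case: eqP => [_|/eqP]; rewrite ?mulmx1 // eq_sym => /gzN1_sq. Qed.

(** A vanishing corner entry puts all these products in one double coset, that of the pole exchange.
    Hence all overlaps of distinct indices are values of one form, [q] in [gram_bound]. *)
Lemma to_pole_mul00 i0 i j : i != j -> (to_pole i0 i *m to_pole i0 j) i0 i0 = 0.
Proof.
have e1 : (1 - -1) / 2 = 1 :> C by field.
have g0 k : k != i0 -> gz i0 k (-1 : C) i0 i0 = 0.
  by rewrite eq_sym => ik; rewrite gz_ii // subrr mul0r.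
rewrite /to_pole => ij; have [ei|ni] := eqVneq i i0.
  by rewrite mul1mx -ei; case: eqP => [ji|/eqP ji]; [rewrite ji eqxx in ij|rewrite ei g0 // -ei].
have [ej|nj] := eqVneq j i0; first by rewrite mulmx1 g0.
rewrite mxE big1 // => k _; have i0i : i0 != i by rewrite eq_sym.
have i0j : i0 != j by rewrite eq_sym.
rewrite !gzE // !eqxx e1 /= andbT; have [->|ki] := eqVneq k i0; first by rewrite /= subrr mul0r.
have [->|kni] := eqVneq k i; last by rewrite subr0 mul0r.
by rewrite ?(negbTE ni) (negbTE ij) subr0 mulr0.
Qed.

(** The off-diagonal part of the Gram sum is [q S S] minus the sum of the [q (y i) (y i)]. With mean
    [Y] and deviations [e i] it becomes [m (m - 1) q Y Y] minus the sum of the [q (e i) (e i)]. The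
    upper bound for [q] is used on the first term, the lower bound on the second. *)
Lemma gram_bound i0 (y : 'I_n -> 'rV[C]_d) : i0 \in D ->
  (forall i, i \in D -> zonal rho D i0 (y i)) -> (forall i, i \in D -> y i *m P D = 0) ->
  nrm (\sum_(i in D) y i *m rho (to_pole i0 i)) <= (1 + 2 / m%:R) * \sum_(i in D) nrm (y i).
Proof.
move=> iD zy yD.
have [j0 jD ij] : exists2 j0, j0 \in D & i0 != j0.
  have : (0 < #|D :\ i0|)%N by move: D3; rewrite (cardsD1 i0) iD; lia.
  by move=> /card_gt0P[j]; rewrite !inE eq_sym => /andP[ji jD]; exists j.
pose q u v := dotr (u *m rho (gz i0 j0 (-1))) v.
have hq i j : i \in D -> j \in D -> i != j ->
    dotr (y i *m rho (to_pole i0 i)) (y j *m rho (to_pole i0 j)) = q (y i) (y j).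
  move=> Di Dj nij; have u k : k \in D -> unitary (to_pole i0 k).
    by move=> kD; apply: UB_unitary (to_pole_UB iD kD).
  have := urep_dot rhoP (y i *m rho (to_pole i0 i)) (y j) (u j Dj).
  rewrite to_pole_adj => <-; rewrite -mulmxA -(urepM rhoP (u i Di) (u j Dj)).
  apply: (zonal_double_coset rhoP iD (zy _ Di) (zy _ Dj)).
  - by apply: UBM; apply: to_pole_UB.
  - exact: UB_D_gz.
  - by rewrite to_pole_mul00 // gz_ii // subrr mul0r.
pose S := \sum_(i in D) y i.
have -> : nrm (\sum_(i in D) y i *m rho (to_pole i0 i)) =
    \sum_(i in D) nrm (y i) + (q S S - \sum_(i in D) q (y i) (y i)).
  rewrite /nrm dotr_suml.
  have -> : q S S = \sum_(i in D) \sum_(j in D) q (y i) (y j).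
    by rewrite /q /S mulmx_suml dotr_suml; apply: eq_bigr => i _; rewrite dotr_sumr.
  rewrite -sumrB -big_split; apply: eq_bigr => i Di /=.
  rewrite dotr_sumr (bigD1 i) //= [X in _ + (X - _)](bigD1 i) //=.
  rewrite [X in _ + (X - _)]addrC addrK; congr (_ + _).
    exact: (urep_nrm rhoP _ (UB_unitary (to_pole_UB iD Di))).
  by apply: eq_bigr => j /andP[Dj nij]; rewrite hq // eq_sym.
pose Y := m%:R^-1 *: S.
have m0 : 0 < (m%:R : C) by rewrite ltr0n (leq_trans _ D3).
have mn0 : (m%:R : C) != 0 by rewrite gt_eqF.
have m1 : (m.-1%:R : C) != 0 by rewrite pnatr_eq0 -lt0n; move: D3; lia.
have SE : S = m%:R *: Y by rewrite /Y scalerA mulfV // scale1r.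
have qS : q S S = m%:R ^+ 2 * q Y Y.
  by rewrite SE /q -scalemxAl dotrZl dotrZr rmorph_nat; ring.
have zYa u : (u *m projT i0 = u /\ u *m P D = 0) ->
    - (2 / m%:R) * nrm u <= q u u <= 2 / (m%:R * m.-1%:R) * nrm u.
  by move=> [uN uD]; apply: zonal_quadratic_bounds => //; apply/zonalP.
have hY : Y *m projT i0 = Y /\ Y *m P D = 0.
  rewrite /Y -!scalemxAl /S !mulmx_suml; split.
    by congr (_ *: _); apply: eq_bigr => i Di; apply/zonalP; apply: zy.
  by rewrite big1 ?scaler0.
have hz i : i \in D -> (y i - Y) *m projT i0 = y i - Y /\ (y i - Y) *m P D = 0.
  move=> Di; case: hY => Y1 Y2; rewrite !mulmxBl Y1 Y2 yD // subr0; split=> //.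
  by congr (_ - _); apply/zonalP; apply: zy.
pose e i := y i - Y.
have yE i : y i = e i + Y by rewrite /e subrK.
have e0 : \sum_(i in D) e i = 0.
  by rewrite /e sumrB -/S sumr_const -scaler_nat -SE subrr.
have qE : \sum_(i in D) q (y i) (y i) = \sum_(i in D) q (e i) (e i) + m%:R * q Y Y.
  exact: mean_decomposition yE e0.
have nE : \sum_(i in D) nrm (y i) = \sum_(i in D) nrm (e i) + m%:R * nrm Y.
  have := mean_decomposition 1%:M yE e0; rewrite mulmx1.
  by under eq_bigr do rewrite mulmx1; move=> ->; under eq_bigr do rewrite mulmx1.
have {}hz i : i \in D -> - (2 / m%:R) * nrm (e i) <= q (e i) (e i).
  by move=> /hz/zYa/andP[].
have {zYa hY} hY : q Y Y <= 2 / (m%:R * m.-1%:R) * nrm Y by have /andP[] := zYa _ hY.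
rewrite qE nE.
have hs : - \sum_(i in D) q (e i) (e i) <= 2 / m%:R * \sum_(i in D) nrm (e i).
  rewrite -sumrN mulr_sumr; apply: ler_sum => i /hz.
  by rewrite mulNr lerNl.
rewrite mulrDl mul1r lerD2l qS.
move: (q Y Y) (nrm Y) (\sum_(i in D) q (e i) (e i)) (\sum_(i in D) nrm (e i)) hY hs => a b u v hY hs.
have mE : (m%:R : C) = m.-1%:R + 1 by rewrite natr1 prednK // (leq_trans _ D3).
have -> : m%:R ^+ 2 * a - (u + m%:R * a) = - u + m%:R * m.-1%:R * a.
  by rewrite mE; ring.
have -> : 2 / m%:R * (v + m%:R * b) = 2 / m%:R * v + m%:R * m.-1%:R * (2 / (m%:R * m.-1%:R) * b).
  by field; rewrite m1 mn0.
by apply: lerD => //; rewrite ler_wpM2l // mulr_ge0 // ler0n.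
Qed.

Lemma projT_bound x : x *m P D = 0 ->
  \sum_(i in D) nrm (x *m projT i) <= (1 + 2 / m%:R) * nrm x.
Proof.
move=> xD; have [i0 iD] : exists i0, i0 \in D by apply/card_gt0P; apply: leq_trans D3.
pose t i := to_pole i0 i.
have ut i : i \in D -> unitary (t i) by move=> Di; apply: UB_unitary (to_pole_UB iD Di).
pose y i := x *m projT i *m rho (t i).
have Dsub i : i \in D -> projT i *m P D = P D.
  by move=> Di; rewrite projTE -mulmxA !proj_subL // ?subD1set // sub1set.
have zT i : zonal rho D i (x *m projT i).
  by apply/zonalP; rewrite -mulmxA; case: (projT_oproj i) => _ ->.
have zy i : i \in D -> zonal rho D i0 (y i).
  move=> Di; rewrite /y /t /to_pole; case: eqP => [e|/eqP ne].
    by rewrite (urep1 rhoP) mulmx1 -e.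
  have -> : gz i0 i (-1) = gz i i0 (-1) :> 'M[C]_n by rewrite /gz addrC.
  exact: zonal_gz.
have yD i : i \in D -> y i *m P D = 0.
  move=> Di; rewrite /y -mulmxA (projL rhoP hI (to_pole_UB iD Di)) -mulmxA Dsub //.
have xE i : i \in D -> y i *m rho (t i) = x *m projT i.
  by move=> Di; rewrite /y -mulmxA -(urepM rhoP (ut i Di) (ut i Di)) /t to_pole_sq (urep1 rhoP) mulmx1.
have ny i : i \in D -> nrm (y i) = nrm (x *m projT i).
  by move=> Di; apply: (urep_nrm rhoP _ (ut i Di)).
have := gram_bound iD zy yD.
rewrite (eq_bigr _ xE) (eq_bigr _ ny).
set T := \sum_(i in D) nrm _; set X := \sum_(i in D) _; set c := 1 + _ => h.
have c0 : 0 < c by rewrite ltr_pwDl // divr_ge0 // ler0n.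
have cr : c^* = c by apply: CrealP; apply: gtr0_real.
have dX : dotr X x = T.
  rewrite /X dotr_suml; apply: eq_bigr => i _.
  by rewrite oproj_nrm //; apply: projT_oproj.
have dX' : dotr x X = T.
  rewrite dotrC dX; apply: CrealP; apply: ger0_real; apply: sumr_ge0 => i _.
  exact: nrm_ge0.
(* Passage from the Gram operator to its dual: here [T] is the inner product of [X] and [x], and
   [nrm X <= c T], so expanding this square leaves [c (c nrm x - T) >= 0]. *)
have := nrm_ge0 (c *: x - X).
rewrite /nrm !(dotrBl, dotrBr, dotrZl, dotrZr) cr dX dX' -!/(nrm _) => h2.
have h3 : 0 <= c * (c * nrm x - T).
  apply: le_trans h2 _.
  have -> : c * (c * nrm x) - c * T - (c * T - nrm X) = c * (c * nrm x - T) - (c * T - nrm X) by ring.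
  by rewrite gerBl subr_ge0.
by rewrite -subr_ge0; move: h3; rewrite pmulr_rge0.
Qed.

Theorem corank1_bound x : x *m P D = 0 ->
  \sum_(i in D) nrm (x *m P (D :\ i)) <= (1 + 2 / m%:R) * nrm x.
Proof.
move=> xD; have pc i : P (D :\ i) *m P [set i] = P [set i] *m P (D :\ i).
  exact: proj_comm (disj_set1 i).
pose Q i := P (D :\ i) *m (1%:M - P [set i]).
have QE i : Q i = P (D :\ i) - projT i by rewrite /Q mulmxBr mulmx1.
have Qo i : oproj (Q i).
  apply: oproj_comm; [exact: proj_oproj|apply: oprojC; exact: proj_oproj|].
  by rewrite mulmxBr mulmxBl mulmx1 mul1mx pc.
(* For [j] other than [i] the set [D :\ j] contains [i], so the range of [P (D :\ j)] is fixed by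
   the circle at [i], whereas [Q i] retains only what this circle moves. *)
have QP i j : i \in D -> i != j -> Q i *m P (D :\ j) = 0.
  move=> Di ij; rewrite /Q -mulmxA mulmxBl mul1mx proj_subL ?subrr ?mulmx0 //.
  by rewrite sub1set !inE ij.
have QQ i j : i \in D -> i != j -> Q i *m Q j = 0.
  by move=> Di ij; rewrite {2}/Q mulmxA QP // mul0mx.
have QN i j : i \in D -> Q i *m projT j = 0.
  move=> Di; rewrite projTE mulmxA; have [<-|ij] := eqVneq i j; last by rewrite QP // mul0mx.
  rewrite -mulmxA pc mulmxA /Q -(mulmxA (P _)) mulmxBl mul1mx proj_idem //.
  by rewrite subrr mulmx0 mul0mx.
have QD i : i \in D -> Q i *m P D = 0.
  by move=> Di; rewrite /Q -mulmxA mulmxBl mul1mx proj_subL ?sub1set // subrr mulmx0.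
pose S := \sum_(i in D) Q i.
have So : oproj S.
  split; first by rewrite adjmx_sum; apply: eq_bigr => i _; case: (Qo i).
  rewrite {1}/S mulmx_suml; apply: eq_bigr => i Di.
  rewrite /S mulmx_sumr (bigD1 i) //= big1 ?addr0; first by case: (Qo i).
  by move=> j /andP[Dj ji]; rewrite QQ // eq_sym.
(* Removing the parts [Q i] changes none of the zonal components. The norm of [x] thus splits: the
   [Q] parts carry the constant 1, and [x'] the constant of [projT_bound]. *)
pose x' := x *m (1%:M - S).
have x'D : x' *m P D = 0.
  rewrite /x' mulmxBr mulmx1 mulmxBl xD -mulmxA /S mulmx_suml big1 ?mulmx0 ?subrr //.
have x'N i : x' *m projT i = x *m projT i.
  rewrite /x' mulmxBr mulmx1 mulmxBl -(mulmxA x S) /S mulmx_suml big1 ?mulmx0 ?subr0 //.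
  by move=> j Dj; rewrite QN.
have split_nrm i : nrm (x *m P (D :\ i)) = nrm (x' *m projT i) + nrm (x *m Q i).
  rewrite x'N !oproj_nrm //; [|exact: projT_oproj|exact: proj_oproj].
  by rewrite -dotrDl -mulmxDr QE addrC subrK.
have SQ : \sum_(i in D) nrm (x *m Q i) = nrm (x *m S).
  rewrite oproj_nrm // /S mulmx_sumr dotr_suml; apply: eq_bigr => i _.
  by rewrite oproj_nrm.
rewrite (eq_bigr _ (fun i _ => split_nrm i)) big_split /= SQ (oproj_pyth x So) -/x'.
rewrite mulrDr addrC; apply: lerD; last exact: projT_bound.
by rewrite ler_peMl ?nrm_ge0 // lerDl divr_ge0 // ler0n.
Qed.

End Gram.

(** Double counting: a set of size [l] arises from [n - l] larger sets by removing one element. *)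
Lemma sum_remove_one (V : nmodType) n l (g : {set 'I_n} -> V) :
  \sum_(D : {set 'I_n} | #|D| == l.+1) \sum_(i in D) g (D :\ i) =
  (\sum_(B : {set 'I_n} | #|B| == l) g B) *+ (n - l).
Proof.
rewrite (exchange_big_dep xpredT) //= -sumrMnl.
transitivity (\sum_(i < n) \sum_(B : {set 'I_n} | (#|B| == l) && (i \notin B)) g B).
  apply: eq_bigr => i _.
  rewrite (reindex_onto (fun B => i |: B) (fun D => D :\ i)) /=; last first.
    by move=> D /andP[_ iD]; rewrite setD1K.
  apply: eq_big => [B|B]; last by move=> /andP[_ /eqP ->].
  rewrite !inE eqxx andbT; have [iB|iB] := boolP (i \in B).
    rewrite andbF; apply/negP => /andP[_ /eqP e].
    by have := setD11 i (i |: B); rewrite e iB.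
  by rewrite cardsU1 iB /= add1n eqSS setU1K // eqxx andbT.
rewrite (exchange_big_dep (fun B : {set 'I_n} => #|B| == l)) /=; last by move=> i B _ /andP[].
apply: eq_bigr => B /eqP Bl; rewrite (eq_bigl (fun i => i \in ~: B)); last first.
  by move=> i; rewrite Bl eqxx inE.
by rewrite sumr_const cardsCs setCK Bl card_ord.
Qed.

(** * Descent over the levels *)

Section Chain.
Variables (R : realType) (n d : nat) (rho : 'M[R[i]]_n -> 'M[R[i]]_d).
Local Notation C := R[i].
Hypothesis rhoP : urep rho.
Variable I : {set 'I_n} -> ('M[C]_n -> C) -> C.
Hypothesis hI : forall E, haar_integral (@UB R n E) (I E).
Local Notation P := (proj rho I).

Definition defect x (B : {set 'I_n}) : C := nrm x - nrm (x *m P B).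

Lemma defect_ge0 x B : 0 <= defect x B.
Proof. by rewrite subr_ge0; apply/oproj_le/(proj_oproj rhoP hI). Qed.

(** On the levels 2 to [n], the solution of the recursion [level_gapS] that starts with 1 at
    [l = n]. *)
Definition level_gap l : C := n.+1%:R / l.+1%:R * (binomz (n - 2) (l%:Z - 2))%:R.

(** With [m = k.+3] the factor on the left is [m - (1 + 2 / m)], the gain of [corank1_bound]; the
    factor on the right is the multiplicity in [sum_remove_one]. *)
Lemma level_gapS k : (k.+2 < n)%N ->
  (k.+2%:R - 2 / k.+3%:R) * level_gap k.+3 = (n - k.+2)%:R * level_gap k.+2.
Proof.
move=> kn; rewrite /level_gap.
have -> : k.+3%:Z - 2 = k.+1 by rewrite -[k.+3]addn2 PoszD addrK.
have -> : k.+2%:Z - 2 = k by rewrite -[k.+2]addn2 PoszD addrK.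
rewrite /binomz.
have e : k.+1%:R * 'C(n - 2, k.+1)%:R = (n - k.+2)%:R * 'C(n - 2, k)%:R :> C.
  by rewrite -!natrM mul_bin_left -subnDA add2n.
have -> : (n - k.+2)%:R * (n.+1%:R / k.+3%:R * 'C(n - 2, k)%:R) =
   n.+1%:R / k.+3%:R * (k.+1%:R * 'C(n - 2, k.+1)%:R) :> C by rewrite e; ring.
have k3 : k.+3%:R = k.+1%:R + 2 :> C by rewrite -natrD addn2.
have k4 : k.+4%:R = k.+1%:R + 3 :> C by rewrite -natrD addn3.
have k2 : k.+2%:R = k.+1%:R + 1 :> C by rewrite natr1.
have n3 : k.+1%:R + 2 != 0 :> C by rewrite -k3 pnatr_eq0.
have n4 : k.+1%:R + 3 != 0 :> C by rewrite -k4 pnatr_eq0.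
rewrite k3 k4 k2; move: (k.+1%:R) ('C(n - 2, k.+1)%:R) (n.+1%:R) n3 n4 => a b c n3 n4.
by field; rewrite n3 n4.
Qed.

(** Invariants of [U_D] are invariants of each [U_(D \ i)], so both sides depend only on the
    component [x'] of [x] orthogonal to them, to which [corank1_bound] applies. *)
Lemma defect_step x (D : {set 'I_n}) k : #|D| = k.+3 ->
  (k.+2%:R - 2 / k.+3%:R) * defect x D <= \sum_(i in D) defect x (D :\ i).
Proof.
move=> Dk; have D3 : (2 < #|D|)%N by rewrite Dk.
have oD := proj_oproj rhoP hI; pose x' := x *m (1%:M - P D).
have nx' : nrm x' = defect x D by rewrite /defect (oproj_pyth x (oD D)) addrC addKr.
have x'D : x' *m P D = 0.
  by rewrite /x' -mulmxA mulmxBl mul1mx (proj_idem rhoP hI) subrr mulmx0.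
have x'i i : nrm (x' *m P (D :\ i)) = nrm (x *m P (D :\ i)) - nrm (x *m P D).
  rewrite !oproj_nrm // -dotrBl -mulmxBr.
  have oC := oprojC (oD D); case: (oC) => aC pC.
  have -> : P (D :\ i) - P D = (1%:M - P D) *m P (D :\ i).
    by rewrite mulmxBl mul1mx (proj_subR rhoP hI) ?subD1set.
  have e : (1%:M - P D) *m P (D :\ i) = P (D :\ i) *m (1%:M - P D).
    by rewrite mulmxBl mul1mx mulmxBr mulmx1 (proj_subR rhoP hI) ?(proj_subL rhoP hI) ?subD1set.
  by rewrite {2}/x' -{1}aC -dotr_mul /x' -!mulmxA -e (mulmxA (1%:M - P D)) pC.
have -> : \sum_(i in D) defect x (D :\ i) =
    \sum_(i in D) (nrm x' - nrm (x' *m P (D :\ i))).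
  apply: eq_bigr => i _; rewrite x'i nx' /defect.
  by move: (nrm x) (nrm _) (nrm _) => a b c; ring.
rewrite sumrB sumr_const Dk -nx'.
have := corank1_bound rhoP hI D3 x'D; rewrite Dk => h.
rewrite lerBrDr; apply: le_trans (lerD (lexx _) h) _.
rewrite -[leRHS]mulr_natl -mulrDl.
have -> : k.+2%:R - 2 / k.+3%:R + (1 + 2 / k.+3%:R) = k.+3%:R :> C.
  have -> : k.+3%:R = k.+2%:R + 1 :> C by rewrite natr1.
  by ring.
exact: lexx.
Qed.

Lemma level_bound x l : x *m P setT = 0 -> (2 <= l <= n)%N ->
  level_gap l * nrm x <= \sum_(B : {set 'I_n} | #|B| == l) defect x B.
Proof.
move=> xT /andP[l2 ln]; move: l2; rewrite -(subKn ln).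
(* The induction starts at the full set, where the defect is the whole of [nrm x] because [xT]
   excludes invariants. *)
elim: (n - l)%N => [|k IH].
  rewrite subn0 => n2; rewrite (eq_bigl (pred1 setT)) => [|B]; last first.
    rewrite /= eqEcard subsetT /= cardsT card_ord eqn_leq.
    by rewrite -[X in (_ <= X)%N]card_ord max_card.
  rewrite big_pred1_eq /defect xT /nrm dotr0l subr0 -/(nrm x).
  have -> : level_gap n = 1; last by rewrite mul1r.
  rewrite /level_gap divff ?pnatr_eq0 // mul1r.
  by rewrite -[n in n%:Z](subnK n2) PoszD addrK /binomz binn.
move=> h2; set j := (n - k.+1)%N in h2 *.
have [q jE] : exists q, j = q.+2 by exists (j - 2)%N; lia.
have jS : (n - k)%N = q.+3 by rewrite /j in h2 jE; lia.
have qn : (q.+2 < n)%N by lia.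
rewrite jE; rewrite jS in IH; have {}IH := IH isT.
rewrite -(ler_pM2l (x := (n - q.+2)%:R)); last by rewrite ltr0n subn_gt0.
rewrite mulrA -level_gapS // [leRHS]mulr_natl -sum_remove_one.
apply: (@le_trans _ _ ((q.+2%:R - 2 / q.+3%:R) * \sum_(D : {set 'I_n} | #|D| == q.+3) defect x D)).
  rewrite -mulrA ler_wpM2l // subr_ge0 ler_pdivrMr ?ltr0n // -natrM ler_nat; lia.
rewrite mulr_sumr; apply: ler_sum => D /eqP; exact: defect_step.
Qed.

Variable c : nat -> R.
Hypothesis c_ge0 : forall l, (l <= n)%N -> 0 <= c l.
Hypothesis n2 : (2 <= n)%N.

Lemma laplacianE : laplacian c I rho = \sum_(B : {set 'I_n}) real_complex R (c #|B|) *: (1%:M - P B).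
Proof. by []. Qed.

Lemma sum_by_card (V : nmodType) (F : {set 'I_n} -> V) :
  \sum_(B : {set 'I_n}) F B = \sum_(l < n.+1) \sum_(B : {set 'I_n} | #|B| == l) F B.
Proof.
have cB (B : {set 'I_n}) : (#|B| < n.+1)%N by rewrite ltnS -[X in (_ <= X)%N]card_ord max_card.
by rewrite (partition_big (fun B : {set 'I_n} => Ordinal (cB B)) xpredT) //=.
Qed.

Lemma laplacian_form x :
  dotr (x *m laplacian c I rho) x = \sum_(B : {set 'I_n}) real_complex R (c #|B|) * defect x B.
Proof.
rewrite laplacianE mulmx_sumr dotr_suml; apply: eq_bigr => B _.
rewrite -scalemxAr dotrZl mulmxBr mulmx1 dotrBl /defect [in RHS]oproj_nrm //.
exact: proj_oproj.
Qed.

Lemma target_valueE :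
  real_complex R (target_value n c) = \sum_(l < n.+1) real_complex R (c l) * level_gap l.
Proof.
rewrite /target_value rmorph_sum; apply: eq_bigr => l _.
by rewrite -mulrA !rmorphM fmorphV !rmorph_nat.
Qed.

Lemma level_gap_lt2 l : (l < 2)%N -> level_gap l = 0.
Proof. by case: l => [|[|//]] _; rewrite /level_gap mulr0. Qed.

Lemma laplacian_bound x : x *m P setT = 0 ->
  real_complex R (target_value n c) * nrm x <= dotr (x *m laplacian c I rho) x.
Proof.
move=> xT; rewrite laplacian_form target_valueE sum_by_card mulr_suml.
apply: ler_sum => l _.
have cl0 : 0 <= real_complex R (c l) by rewrite ler0c c_ge0 // -ltnS.
rewrite (eq_bigr (fun B => real_complex R (c l) * defect x B)) => [|B /eqP -> //].
rewrite -mulr_sumr -mulrA ler_wpM2l //.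
have [l2|l2] := ltnP l 2; last by apply: level_bound; rewrite // l2 -ltnS /=.
by rewrite level_gap_lt2 // mul0r; apply: sumr_ge0 => B _; apply: defect_ge0.
Qed.

Lemma laplacian_eigenvalue_bound z : (forall x : 'rV[C]_d, x *m P setT = 0) ->
  eigenvalue (laplacian c I rho) z -> real_complex R (target_value n c) <= z.
Proof.
move=> h /eigenvalueP[v ve v0]; have := laplacian_bound (h v).
by rewrite ve dotrZl -/(nrm v) ler_pM2r // nrm_gt0.
Qed.

End Chain.

(** * Unitarization *)

Section Conjugation.
Variables (R : realType) (n d : nat) (rho : 'M[R[i]]_n -> 'M[R[i]]_d).
Local Notation C := R[i].
Variable S : 'M[C]_d.
Hypothesis uS : S \in unitmx.
Local Notation rho' := (fun A => invmx S *m rho A *m S).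

Lemma conj_rhoE A : rho A = S *m (invmx S *m rho A *m S) *m invmx S.
Proof. by rewrite !mulmxA mulmxV // mul1mx -mulmxA mulmxV // mulmx1. Qed.

Lemma is_rep_conj : is_rep rho -> is_rep rho'.
Proof.
move=> [r1 rM rc]; split; first by rewrite r1 mulmx1 mulVmx.
  move=> A B uA uB; rewrite rM // !mulmxA; congr (_ *m _ *m _).
  by rewrite -(mulmxA (_ *m rho A)) mulmxV // mulmx1.
by apply: cont_on_mulmx; [apply: cont_on_mulmx rc|]; apply: cont_on_cst.
Qed.

Lemma irrep_conj : irrep rho -> irrep rho'.
Proof.
move=> [rr d0 hirr]; split=> // [|W hW]; first exact: is_rep_conj.
have rW : \rank (W *m invmx S) = \rank W by rewrite mxrankMfree // row_free_unit unitmx_inv.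
have [|rk|rk] := hirr (W *m invmx S).
- move=> A uA; have := submxMr (invmx S) (hW A uA).
  by rewrite !mulmxA -(mulmxA _ S) mulmxV // mulmx1.
- by left; rewrite -rW.
- by right; rewrite -rW.
Qed.

Lemma iso_triv_conj : iso_triv rho' -> iso_triv rho.
Proof.
by move=> [d1 h]; split=> // A uA; rewrite conj_rhoE h // mulmx1 mulmxV.
Qed.

Lemma is_weight_conj nu : is_weight rho' nu <-> is_weight rho nu.
Proof.
have wt (T : 'M[C]_d) (f g : 'M[C]_n -> 'M[C]_d) : T \in unitmx ->
    (forall A, f A = T *m g A *m invmx T) -> is_weight g nu -> is_weight f nu.
  move=> uT e [v v0 hv]; exists (T *m v).
    by apply: contraNneq v0 => /(congr1 (mulmx (invmx T))); rewrite mulmxA mulVmx // mul1mx mulmx0 => ->.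
  move=> t t1; rewrite e -!mulmxA [invmx T *m _]mulmxA mulVmx // mul1mx hv //.
  by rewrite -scalemxAr.
split; first by apply: (wt S) => // A; apply: conj_rhoE.
by apply: (wt (invmx S)); rewrite ?unitmx_inv // => A; rewrite invmxK.
Qed.

Lemma highest_weight_conj mu : highest_weight rho mu -> highest_weight rho' mu.
Proof.
by move=> [h1 h2]; split; [apply/is_weight_conj|move=> nu /is_weight_conj; apply: h2].
Qed.

Variable I : {set 'I_n} -> ('M[C]_n -> C) -> C.
Hypothesis hI : forall E, haar_integral (@UB R n E) (I E).

Lemma laplacian_conj c : is_rep rho ->
  laplacian c I rho' = invmx S *m laplacian c I rho *m S.
Proof.
move=> [_ _ rc]; rewrite /laplacian mulmx_sumr mulmx_suml; apply: eq_bigr => B _.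
rewrite -scalemxAr -scalemxAl; congr (_ *: _).
rewrite mulmxBr mulmx1 mulmxBl mulVmx //; congr (_ - _).
have cB : cont_on (@UB R n B) rho by apply: cont_on_sub rc => A [].
rewrite -[X in _ *m X *m _]/(intmx (I B) rho) -(intmx_mull (hI B)) // -(intmx_mulr (hI B)) //.
by apply: cont_on_mulmx cB; apply: cont_on_cst.
Qed.

Lemma eigenvalue_conj (M : 'M[C]_d) z : eigenvalue (invmx S *m M *m S) z = eigenvalue M z.
Proof.
have ev (T A B : 'M[C]_d) : T \in unitmx -> A = T *m B *m invmx T ->
    eigenvalue B z -> eigenvalue A z.
  move=> uT -> /eigenvalueP[v vB v0]; apply/eigenvalueP; exists (v *m invmx T).
    by rewrite !mulmxA -(mulmxA v) mulVmx // mulmx1 vB -scalemxAl.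
  by apply: contraNneq v0 => /(congr1 (mulmx^~ T)); rewrite /= -mulmxA mulVmx // mulmx1 mul0mx => ->.
apply/idP/idP; last by apply: (ev (invmx S)); rewrite ?unitmx_inv // invmxK.
by apply: (ev S) => //; rewrite !mulmxA mulmxV // mul1mx -mulmxA mulmxV // mulmx1.
Qed.

End Conjugation.

Section Unitarization.
Variables (R : realType) (n d : nat) (rho : 'M[R[i]]_n -> 'M[R[i]]_d).
Local Notation C := R[i].

(** A nonzero invariant vector spans an invariant line; irreducibility makes it everything, and the
    representation would be trivial. *)
Lemma irrep_invariant_eq0 (v : 'rV[C]_d) : irrep rho -> ~ iso_triv rho ->
  (forall A, unitary A -> v *m rho A = v) -> v = 0.
Proof.
move=> [_ d0 hirr] ntriv hv; apply/eqP; apply: contraT => v0; case: ntriv.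
have [|rk|rk] := hirr <<v>>%MS.
- by move=> A uA; rewrite (eqmxMr _ (genmxE v)) genmxE hv.
- by move: rk; rewrite genmxE => /eqP; rewrite mxrank_eq0 (negbTE v0).
have d1 : d = 1%N by rewrite -rk genmxE rank_rV v0.
split=> // A uA; have sv : row_full v by rewrite /row_full rank_rV v0 d1.
by apply: (row_full_inj sv); rewrite hv // mulmx1.
Qed.

Lemma mxtrace_sq_ge0 m (A : 'M[C]_m) : 0 <= \tr (A *m adjmx A).
Proof.
rewrite /mxtrace sumr_ge0 // => k _; rewrite mxE sumr_ge0 // => l _.
by rewrite adjmxE mul_conjC_ge0.
Qed.

Variable I : ('M[C]_n -> C) -> C.
Hypothesis hI : haar_integral (@UB R n setT) I.

Lemma haar_gram_neq0 : is_rep rho -> (0 < d)%N -> intmx I (fun A => rho A *m adjmx (rho A)) != 0.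
Proof.
(* otherwise the mean of the square norm of [s rho(A) - rho(A^-1)^*] would be negative for large [s],
   because [tr (rho(A) rho(A^-1)) = d] *)
move=> [r1 rM rc] d0; apply/eqP => H0.
have cR : cont_on (@UB R n setT) rho by apply: cont_on_sub rc => A [].
have cR' : cont_on (@UB R n setT) (fun A => rho (adjmx A)).
  by apply: cont_on_comp rc; [move=> A [uA _]; apply: unitary_adj|apply: cont_on_adj; apply: cont_on_id].
pose X A := rho A; pose Y A := adjmx (rho (adjmx A)).
have cX : cont_on (@UB R n setT) (fun A => X A *m adjmx (X A)).
  by apply: cont_on_mulmx => //; apply: cont_on_adj.
have cY : cont_on (@UB R n setT) (fun A => Y A *m adjmx (Y A)).
  by apply: cont_on_mulmx; do ?apply: cont_on_adj.
pose K := I (fun A => \tr (Y A *m adjmx (Y A))).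
have ctr F : cont_on (@UB R n setT) F -> cont_on_fun (@UB R n setT) (fun A => \tr (F A : 'M_d)).
  by move=> /cont_on_entries cF; apply: cont_sum => k _; apply: cF.
have K0 : 0 <= K.
  by apply: (haar_ge0 hI) => [|A _]; [exact: ctr|exact: mxtrace_sq_ge0].
pose s := K + 1.
have s0 : 0 <= s by rewrite addr_ge0.
have sr : s^* = s by apply: CrealP; apply: ger0_real.
have fE A : UB setT A -> \tr ((s *: X A - Y A) *m adjmx (s *: X A - Y A)) =
    s ^+ 2 * \tr (X A *m adjmx (X A)) + (\tr (Y A *m adjmx (Y A)) - 2 * s * d%:R).
  move=> [uA _]; have XY : X A *m adjmx (Y A) = 1%:M.
    by rewrite /X /Y adjmxK -rM // ?uA //; exact: unitary_adj.
  have YX : Y A *m adjmx (X A) = 1%:M by rewrite -[LHS]adjmxK adjmxM adjmxK XY adjmx1.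
  rewrite adjmxB adjmxZ sr mulmxBl !mulmxBr -!scalemxAl -!scalemxAr XY YX.
  rewrite scalerA !raddfB /= !mxtraceZ mxtrace1.
  by move: (\tr _) (\tr _) => a b; ring.
have : 0 <= I (fun A => s ^+ 2 * \tr (X A *m adjmx (X A)) + (\tr (Y A *m adjmx (Y A)) - 2 * s * d%:R)).
  apply: (haar_ge0 hI) => [|A BA]; last by rewrite -fE // mxtrace_sq_ge0.
  apply: cont_add; first by apply: cont_scale; apply: ctr.
  by apply: cont_add; [apply: ctr|apply: cont_cst].
rewrite (haar_add hI); first last.
- by apply: cont_add; [apply: ctr|apply: cont_cst].
- by apply: cont_scale; apply: ctr.
rewrite (haar_scale hI); last exact: ctr.
rewrite (intmx_tr hI cX) H0 mxtrace0 mulr0 add0r (haar_sub hI); [|exact: ctr|exact: cont_cst].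
rewrite (haar_cst hI) -/K subr_ge0 => h.
have : s * 1 <= s * (2 * d%:R) by rewrite ler_wpM2l // -natrM ler1n muln_gt0.
rewrite mulr1 mulrCA mulrA => h'; have := le_trans h' h.
by rewrite /s gerDl ler10.
Qed.

(** Weyl's averaging: the mean [H] of [rho A *m adjmx (rho A)] is an invariant positive semidefinite
    form. Its kernel is an invariant subspace, so by irreducibility [H] is invertible unless it is
    zero, and [haar_gram_neq0] rules that out. *)
Theorem unitarization : irrep rho ->
  exists2 S : 'M[C]_d, S \in unitmx & urep (fun A => invmx S *m rho A *m S).
Proof.
move=> [rr d0 hirr]; have [r1 rM rc] := rr.
have cR : cont_on (@UB R n setT) rho by apply: cont_on_sub rc => A [].
pose F A := rho A *m adjmx (rho A).
have cF : cont_on (@UB R n setT) F by apply: cont_on_mulmx => //; apply: cont_on_adj.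
pose H := intmx I F.
have Hinv g : unitary g -> rho g *m H *m adjmx (rho g) = H.
  move=> ug; rewrite /H -(intmx_mull hI _ cF) -(intmx_mulr hI); last first.
    by apply: cont_on_mulmx cF; apply: cont_on_cst.
  have Ug : UB setT g by apply/UBT.
  rewrite -[RHS](intmx_inv hI cF Ug); apply: (intmx_ext hI) => A [uA _].
  by rewrite /F rM // adjmxM !mulmxA.
have Hadj : adjmx H = H.
  rewrite /H -(intmx_adj hI cF); apply: (intmx_ext hI) => A _.
  by rewrite /F adjmxM adjmxK.
have Hpos x : 0 <= dotr (x *m H) x.
  have -> : dotr (x *m H) x = I (fun A => (x *m F A *m adjmx x) 0 0).
    rewrite /dotr /H -(intmx_mull hI _ cF) -(intmx_mulr hI) ?mxE //.
    by apply: cont_on_mulmx cF; apply: cont_on_cst.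
  apply: (haar_ge0 hI) => [|A _].
    have : cont_on (@UB R n setT) (fun A => x *m F A *m adjmx x).
      by apply: cont_on_mulmx; [apply: cont_on_mulmx cF|]; apply: cont_on_cst.
    by move=> /cont_on_entries; apply.
  have -> : x *m F A *m adjmx x = (x *m rho A) *m adjmx (x *m rho A).
    by rewrite /F adjmxM !mulmxA.
  exact: nrm_ge0.
have Hunit : H \in unitmx.
  have [|rk|rk] := hirr (kermx H).
  - move=> g ug; apply/sub_kermxP.
    have e : rho g *m H = H *m adjmx (rho (adjmx g)).
      have uga := unitary_adj ug.
      rewrite -[in RHS](Hinv g ug) -(mulmxA _ (adjmx (rho g))) -adjmxM -rM // unitary_adjl // r1 adjmx1.
      by rewrite mulmx1.
    by rewrite -mulmxA e mulmxA mulmx_ker mul0mx.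
  - by rewrite -row_free_unit -kermx_eq0 -mxrank_eq0 rk.
  - have := haar_gram_neq0 rr d0; rewrite -/F -/H -mxrank_eq0.
    have := mxrank_ker H; rewrite rk => e.
    by have := rank_leq_row H; case: (\rank H) e => // k e kd; exfalso; lia.
have [P [s [uP HE]]] := hermitian_diag Hadj.
have sE r : s 0 r = dotr (row r P *m H) (row r P).
  by rewrite HE diag_eigenvector // dotrZl -/(nrm _) row_unitary_nrm // mulr1.
have s0 r : 0 <= s 0 r by rewrite sE.
(* From the square roots of the eigenvalues comes [S] with [S *m adjmx S = H]; conjugation by [S]
   turns the invariant form [H] into the standard one. *)
pose D : 'M[C]_d := diag_mx (\row_r sqrtC (s 0 r)).
have DD : D *m adjmx D = diag_mx s.
  apply/matrixP => j k; rewrite mul_diag_mx adjmx_tC tr_diag_mx map_diag_mx !mxE.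
  case: (j == k); last by rewrite !mulr0n mulr0.
  by rewrite !mulr1n /= conj_Creal ?ger0_real ?sqrtC_ge0 // -expr2 sqrtCK.
pose S := adjmx P *m D.
have SS : S *m adjmx S = H by rewrite /S adjmxM adjmxK HE !mulmxA -(mulmxA _ D) DD.
have uS : S \in unitmx by move: Hunit; rewrite -SS unitmx_mul => /andP[].
move: S SS uS => {HE sE s0 DD D} S SS uS.
exists S; first exact: uS.
split; first exact: (is_rep_conj uS rr).
move=> A uA; rewrite /unitary !adjmxM.
have -> : invmx S *m rho A *m S *m (adjmx S *m (adjmx (rho A) *m adjmx (invmx S))) =
   invmx S *m (rho A *m (S *m adjmx S) *m adjmx (rho A)) *m adjmx (invmx S) by rewrite !mulmxA.
rewrite SS (Hinv _ uA) -SS (mulmxA (invmx S)) (mulVmx uS) mul1mx -adjmxM (mulVmx uS) adjmx1 //.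
Qed.

End Unitarization.

Lemma sum_enum_val (V : nmodType) (T : finType) (F : T -> V) :
  \sum_(i < #|T|) F (enum_val i) = \sum_(x : T) F x.
Proof.
rewrite (reindex _ (onW_bij _ (enum_rank_bij T))) /=.
by apply: eq_bigr => x _; rewrite enum_rankK.
Qed.

Lemma unit_pow_inj (R : realType) (a b : int) :
  (forall z : R[i], `|z| = 1 -> z ^ a = z ^ b) -> a = b.
Proof.
move=> h; apply/eqP; rewrite -subr_eq0; apply: contraT => ab.
(* The angle is chosen so that the power [a - b] of [z] is -1. *)
pose z : R[i] := expi (pi / (a - b)%:~R).
have z1 : `|z| = 1 by apply: norm_expi.
have : z ^ (a - b) = 1.
  by rewrite expfzDr ?expi_neq0 // h // -expfzDr ?expi_neq0 // subrr.
rewrite /z -expiMz -mulrzr divfK ?intr_eq0 // /expi cospi sinpi.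
by move=> [] /eqP; rewrite eq_sym -subr_eq0 opprK -(natrD _ 1 1) pnatr_eq0.
Qed.

(** * The tensor representation *)

Section Tensor.
Variables (R : realType) (n : nat).
Local Notation C := R[i].
Local Notation Om := {ffun 'I_4 -> 'I_n}.
Local Notation N := #|{: Om}|.
Implicit Types (A : 'M[C]_n) (f g : Om).
Local Notation ev a := (enum_val a : Om).

Definition ent (j : 'I_4) A k l : C := if (j < 2)%N then A k l else (A k l)^*.

(* the representation on V (x) V (x) V^* (x) V^*, in the basis indexed by [Om] *)
Definition tens A : 'M[C]_N :=
  \matrix_(a, b) \prod_j ent j A (ev a j) (ev b j).

Lemma entM j A B k l : ent j (A *m B) k l = \sum_m ent j A k m * ent j B m l.
Proof.
rewrite /ent; case: ifP => _; rewrite mxE // rmorph_sum.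
by apply: eq_bigr => m _; rewrite rmorphM.
Qed.

Lemma ent_adj j A k l : ent j (adjmx A) k l = (ent j A l k)^*.
Proof. by rewrite /ent adjmxE; case: ifP. Qed.

Lemma tensM A B : tens (A *m B) = tens A *m tens B.
Proof.
apply/matrixP => a b; rewrite !mxE.
under [RHS]eq_bigr => c _ do rewrite !mxE -big_split /=.
rewrite (sum_enum_val (fun g : Om => \prod_j (ent j A (ev a j) (g j) * ent j B (g j) (ev b j)))).
rewrite -(bigA_distr_bigA (fun j m => ent j A (ev a j) m * ent j B m (ev b j))).
by apply: eq_bigr => j _; rewrite entM.
Qed.

Lemma tens_adj A : tens (adjmx A) = adjmx (tens A).
Proof.
apply/matrixP => a b; rewrite adjmxE !mxE rmorph_prod.
by apply: eq_bigr => j _; rewrite ent_adj.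
Qed.

Lemma tens_diag (t : 'rV[C]_n) a b : tens (diag_mx t) a b =
  (if a == b then \prod_j ent j (diag_mx t) (ev a j) (ev a j) else 0).
Proof.
rewrite mxE; have [->//|ab] := eqVneq a b.
have [j nj] : exists j, ev a j != ev b j.
  apply/existsP; rewrite -negb_forall; apply: contra ab => /forallP h.
  by apply/eqP/enum_val_inj/ffunP => j; apply/eqP.
rewrite (bigD1 j) //= /ent !mxE (negbTE nj) mulr0n.
by case: ifP; rewrite ?rmorph0 mul0r.
Qed.

Lemma tens1 : tens 1%:M = 1%:M.
Proof.
rewrite -diag_const_mx; apply/matrixP => a b; rewrite tens_diag mxE.
have [_|//] := eqVneq a b.
rewrite big1 ?mxE ?mulr1n // => j _; rewrite /ent !mxE eqxx mulr1n.
by case: ifP; rewrite ?rmorph1.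
Qed.

Lemma tens_urep : urep tens.
Proof.
split; last by move=> A uA; rewrite /unitary -tens_adj -tensM uA tens1.
split; [exact: tens1|by move=> A B _ _; exact: tensM|].
apply/cont_on_entries => a b.
apply: (cont_ext (f := fun A => \prod_j ent j A (ev a j) (ev b j))).
  by move=> A _; rewrite mxE.
apply: cont_prod => j _; rewrite /ent; case: (j < 2)%N; first exact: cont_entry.
by apply: cont_conj; apply: cont_entry.
Qed.

Definition sgn (j : 'I_4) : int := if (j < 2)%N then 1 else -1.
(** The torus weight of the basis tensor indexed by [f]; the slots of the dual space count
    negatively. *)
Definition wt f (i : 'I_n) : int := \sum_j sgn j * (f j == i)%:R.

Lemma wtE (t : 'rV[C]_n) f : (forall i, `|t 0 i| = 1) ->
  \prod_j ent j (diag_mx t) (f j) (f j) = \prod_i t 0 i ^ wt f i.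
Proof.
move=> t1; have t0 i : t 0 i != 0 by rewrite -normr_eq0 t1 oner_eq0.
have -> : \prod_i t 0 i ^ wt f i = \prod_i \prod_j t 0 i ^ (sgn j * (f j == i)%:R).
  apply: eq_bigr => i _; rewrite /wt.
  by apply: (big_morph (fun m => t 0 i ^ m)) => [a b|]; rewrite ?expfzDr.
rewrite exchange_big /=; apply: eq_bigr => j _.
rewrite (bigD1 (f j)) //= eqxx mulr1 big1 ?mulr1; last first.
  by move=> i /negbTE; rewrite eq_sym => ->; rewrite mulr0.
rewrite /ent /sgn !mxE eqxx mulr1n; case: ifP => _ //.
apply: (mulfI (t0 (f j))); rewrite conj_unit // -[X in X * _]expr1z -expfzDr ?subrr //.
Qed.

Lemma torus_weight_inj (nu nu' : 'I_n -> int) :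
  (forall t : 'rV[C]_n, (forall i, `|t 0 i| = 1) ->
     \prod_i t 0 i ^ nu i = \prod_i t 0 i ^ nu' i) -> nu =1 nu'.
Proof.
move=> h i; apply: (@unit_pow_inj R) => z z1.
pose t : 'rV[C]_n := \row_k (if k == i then z else 1).
have single (m : 'I_n -> int) : \prod_k t 0 k ^ m k = z ^ m i.
  rewrite (bigD1 i) //= big1 ?mulr1 => [|k /negbTE ki]; first by rewrite mxE eqxx.
  by rewrite mxE ki exp1rz.
rewrite -!single; apply: h => k; rewrite mxE; case: ifP; by rewrite ?normr1.
Qed.

Lemma tens_weight_support (v : 'cV[C]_N) (nu : 'I_n -> int) a :
  (forall t : 'rV[C]_n, (forall i, `|t 0 i| = 1) ->
     tens (diag_mx t) *m v = (\prod_i t 0 i ^ nu i) *: v) ->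
  v a 0 != 0 -> wt (ev a) =1 nu.
Proof.
move=> hv va; apply: torus_weight_inj => t t1.
have : \sum_b tens (diag_mx t) a b * v b 0 = (\prod_i t 0 i ^ nu i) * v a 0.
  by have /matrixP/(_ a 0) := hv t t1; rewrite mxE [X in _ = X -> _]mxE.
rewrite (bigD1 a) //= big1 ?addr0 => [|c ca]; last first.
  by rewrite tens_diag eq_sym (negbTE ca) mul0r.
by rewrite tens_diag eqxx wtE // => /(mulIf va).
Qed.

Lemma sum_I4 (V : nmodType) (F : 'I_4 -> V) :
  \sum_j F j = F (inord 0) + F (inord 1) + F (inord 2) + F (inord 3).
Proof.
rewrite !big_ord_recr big_ord0 /= add0r.
by do !congr (_ + _); congr F; apply: val_inj; rewrite /= inordK.
Qed.

Lemma prod_I4 (F : 'I_4 -> C) :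
  \prod_j F j = F (inord 0) * F (inord 1) * (F (inord 2) * F (inord 3)).
Proof.
rewrite !big_ord_recr big_ord0 /= mul1r -mulrA.
by do !congr (_ * _); congr F; apply: val_inj; rewrite /= inordK.
Qed.

Variables (i1 iN : 'I_n).
Hypotheses (i1E : val i1 = 0%N) (iNE : val iN = n.-1) (i1N : i1 != iN).

Definition top_tensor : Om := [ffun j : 'I_4 => if (j < 2)%N then i1 else iN].

Lemma mu20m2E i : @mu20m2 n i = if i1 == i then 2 else if iN == i then -2 else 0.
Proof. by rewrite /mu20m2 -!(inj_eq val_inj) i1E iNE !(eq_sym (val i)). Qed.

Lemma wt_top : wt top_tensor =1 @mu20m2 n.
Proof.
move=> i; rewrite /wt sum_I4 /sgn !ffunE !inordK //= mu20m2E.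
have [<-|_] := eqVneq i1 i; first by rewrite eq_sym (negbTE i1N).
by case: (iN == i).
Qed.

(** The weight has multiplicity one: a coordinate 2 uses up both slots of [V], a coordinate -2 both
    slots of the dual. This is the source of irreducibility in [compression_irrep] and of the
    proportionality in [top_eigenvector]. *)
Lemma wt_eq_top f : wt f =1 @mu20m2 n -> f = top_tensor.
Proof.
move=> h.
have f01 : f (inord 0) = i1 /\ f (inord 1) = i1.
  move: (h i1); rewrite /wt sum_I4 /sgn !inordK //= mu20m2E eqxx.
  by do 4 case: eqP => ? //=.
have f23 : f (inord 2) = iN /\ f (inord 3) = iN.
  move: (h iN); rewrite /wt sum_I4 /sgn !inordK //= mu20m2E eqxx (negbTE i1N).
  by do 4 case: eqP => ? //=.
apply/ffunP => j; rewrite ffunE.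
have -> : j = inord (val j) by apply: val_inj; rewrite /= inordK.
case: j => [[|[|[|[|//]]]] hj] /=; rewrite inordK //=.
all: by case: f01 => ? ?; case: f23 => ? ?.
Qed.

Lemma sum_wt (P : pred 'I_n) f : \sum_(i | P i) wt f i = \sum_j sgn j * (P (f j))%:R.
Proof.
rewrite /wt exchange_big /=; apply: eq_bigr => j _; rewrite -mulr_sumr; congr (_ * _).
have [Pf|Pf] := boolP (P (f j)).
  rewrite (bigD1 (f j)) //= eqxx big1 ?addr0 // => i /andP[_ /negbTE].
  by rewrite eq_sym => ->.
rewrite big1 // => i Pi; case: eqP => // e; by rewrite -e (negbTE Pf) in Pi.
Qed.

(** Dominance holds slot by slot: partial sums are largest when a slot of [V] holds the first index
    and a slot of the dual the last. *)
Lemma wt_dom_le f : dom_le (wt f) (@mu20m2 n).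
Proof.
have topE (P : pred 'I_n) : \sum_(i < n | P i) (mu20m2 i - wt f i) =
    \sum_j sgn j * ((P (top_tensor j))%:R - (P (f j))%:R).
  rewrite sumrB sum_wt (eq_bigr (wt top_tensor)) => [|i _]; last by rewrite wt_top.
  by rewrite sum_wt -sumrB; apply: eq_bigr => j _; rewrite mulrBr.
split=> [k|]; last by rewrite topE big1 // => j _; rewrite subrr mulr0.
rewrite topE; apply: sumr_ge0 => j _; rewrite /sgn ffunE; case: ifP => _.
  rewrite mul1r subr_ge0 i1E; case: (ltnP (f j) k) => [fk|//].
  by rewrite (leq_ltn_trans _ fk).
rewrite mulN1r opprB subr_ge0 iNE; case: (ltnP n.-1 k) => [nk|//].
have := ltn_ord (f j); case: (ltnP (f j) k) => // kf fn.
by have := leq_ltn_trans kf fn; lia.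
Qed.

End Tensor.

(** Complements are counted instead of supersets, so the binomial vanishes by itself when [l] is
    below the size of [S]. *)
Lemma card_supersets (T : finType) (S : {set T}) l : (l <= #|T|)%N ->
  #|[set B : {set T} | (S \subset B) && (#|B| == l)]| = 'C(#|T| - #|S|, #|T| - l).
Proof.
move=> lT; have -> : (#|T| - #|S|)%N = #|~: S| by rewrite -(cardsC S) addKn.
rewrite -cards_draws -(card_imset _ (inv_inj (@setCK T))); congr #|pred_of_set _|.
apply/setP => B; rewrite !inE; apply/imsetP/andP => [[E]|[BS /eqP Bl]].
  rewrite inE => /andP[SE /eqP El] ->.
  by rewrite setCS SE -El -(cardsC E) addKn eqxx.
exists (~: B); last by rewrite setCK.
have := cardsC B; rewrite Bl inE -[S]setCK setCS BS /= => e; apply/eqP.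
by apply: (@addnI (#|T| - l)%N); rewrite e subnK.
Qed.

(** * The Laplacian on the diagonal tensor *)

Section SpecialVector.
Variables (R : realType) (n : nat).
Local Notation C := R[i].
Local Notation Om := {ffun 'I_4 -> 'I_n}.
Local Notation N := #|{: Om}|.
Local Notation ev a := (enum_val a : Om).
Variable I : {set 'I_n} -> ('M[C]_n -> C) -> C.
Hypothesis hI : forall E, haar_integral (@UB R n E) (I E).
Local Notation P := (proj (@tens R n) I).

Definition const_idx (f : Om) : bool :=
  [&& f (inord 1) == f (inord 0), f (inord 2) == f (inord 0) & f (inord 3) == f (inord 0)].

(* the sum of the tensors [e_i (x) e_i (x) e_i^* (x) e_i^*] *)
Definition diag_tensor : 'rV[C]_N := \row_b (const_idx (ev b))%:R.

(** Coordinates of the sum of the two invariant tensors that match the slots of [V] with those of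
    the dual. *)
Definition pairing (f : Om) : C :=
  ((f (inord 0) == f (inord 2)) && (f (inord 1) == f (inord 3)))%:R +
  ((f (inord 0) == f (inord 3)) && (f (inord 1) == f (inord 2)))%:R.

Lemma const_idxP f i : const_idx f -> f (inord 0) = i -> f = [ffun => i].
Proof.
move=> /and3P[/eqP f1 /eqP f2 /eqP f3] f0; apply/ffunP => j; rewrite ffunE.
have -> : j = inord (val j) by apply: val_inj; rewrite /= inordK.
by case: j => [[|[|[|[|//]]]] hj] /=; rewrite ?f1 ?f2 ?f3.
Qed.

Lemma const_idx_ffun (i : 'I_n) : const_idx [ffun => i].
Proof. by rewrite /const_idx !ffunE !eqxx. Qed.

Lemma sum_const_idx (F : Om -> C) :
  \sum_f (const_idx f)%:R * F f = \sum_i F [ffun => i].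
Proof.
rewrite (bigID const_idx) /= [X in _ + X]big1 ?addr0; last first.
  by move=> f /negbTE ->; rewrite mul0r.
rewrite (reindex_onto (fun i : 'I_n => [ffun => i] : Om) (fun f : Om => f (inord 0))) /=.
  by apply: eq_big => i; rewrite const_idx_ffun ?ffunE ?eqxx // => _; rewrite mul1r.
by move=> f cf; apply/esym/const_idxP.
Qed.

Lemma mom_UB B i (f : Om) :
  mom (I B) i (f (inord 0)) (f (inord 1)) (f (inord 2)) (f (inord 3)) =
  if i \in B then
    ((f (inord 0) \in B) && (f (inord 1) \in B))%:R * pairing f / (#|B|%:R * #|B|.+1%:R)
  else (f == [ffun => i])%:R.
Proof.
case: ifP => iB; last first.
  rewrite /mom -[RHS](haar_cst (hI B)); apply: (haar_ext (hI B)) => A [_ hA].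
  rewrite !hA ?iB ?orbT // !rmorph_nat -!natrM !mulnb; congr (_%:R); congr nat_of_bool.
  apply/andP/eqP => [[/andP[/eqP f0 /eqP f1] /andP[/eqP f2 /eqP f3]]|->].
    by apply: (const_idxP _ f0); rewrite /const_idx f0 f1 f2 f3 !eqxx.
  by rewrite !ffunE !eqxx.
have z (a b c d : 'I_n) : ~~ ((a \in B) && (b \in B)) -> mom (I B) i a b c d = 0.
  move=> h; rewrite /mom -[RHS](haar_cst (hI B)); apply: (haar_ext (hI B)) => A [_ hA].
  move: h; rewrite negb_and => /orP[aB|bB].
    rewrite (hA a) ?aB // (_ : a == i = false) ?mul0r //.
    by apply: contraNF aB => /eqP ->.
  rewrite (hA b) ?bB // (_ : b == i = false) ?mulr0 ?mul0r //.
  by apply: contraNF bB => /eqP ->.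
have [/andP[aB bB]|h] := boolP ((f (inord 0) \in B) && (f (inord 1) \in B)).
  by rewrite (momE (hI B) iB) // mul1r -mulrDl.
by rewrite z // !mul0r.
Qed.

(** As [P B] is Hermitian, its entries may be read off from the transposed index, which turns each
    summand into a moment of a single column [i]. Columns outside [B] are basis vectors and give the
    Kronecker term; the [#|B|] columns inside contribute equally and cancel the factor [#|B|] of the
    moment. *)
Lemma diag_tensor_proj B b (f := ev b) :
  (diag_tensor *m P B) 0 b = (const_idx f && (f (inord 0) \notin B))%:R +
    ((f (inord 0) \in B) && (f (inord 1) \in B))%:R * pairing f / #|B|.+1%:R.
Proof.
have PE a : P B a b = (I B (fun A => tens A b a))^*.
  by rewrite -{1}(proj_adj (tens_urep R n) hI B) adjmxE mxE.
rewrite mxE (eq_bigr (fun a => (const_idx (ev a))%:R *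
    (I B (fun A => \prod_j ent j A (f j) (ev a j)))^*)); last first.
  move=> a _; rewrite PE mxE; congr (_ * _^*); apply: (haar_ext (hI B)) => A _.
  by rewrite mxE.
rewrite (sum_enum_val (fun g : Om => (const_idx g)%:R *
    (I B (fun A => \prod_j ent j A (f j) (g j)))^*)) sum_const_idx.
rewrite (eq_bigr (fun i => (mom (I B) i (f (inord 0)) (f (inord 1)) (f (inord 2)) (f (inord 3)))^*)).
  rewrite (bigID (mem B)) /= addrC; congr (_ + _).
    rewrite (eq_bigr (fun i => (f == [ffun => i])%:R)); last first.
      by move=> i /negbTE iB; rewrite mom_UB iB rmorph_nat.
    have [/andP[cf fB]|h] := boolP (const_idx f && (f (inord 0) \notin B)).
      have fE := const_idxP cf erefl.
      rewrite (bigD1 (f (inord 0))) //= -fE eqxx big1 ?addr0 // => i /andP[_ ni].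
      by case: eqP => // e; rewrite e ffunE eqxx in ni.
    rewrite big1 // => i iB; case: eqP => // e; move: h.
    by rewrite e const_idx_ffun ffunE iB.
  set X := _%:R * pairing f.
  have Xr : X^* = X by rewrite /X /pairing rmorphM rmorphD !rmorph_nat.
  rewrite (eq_bigr (fun=> X / (#|B|%:R * #|B|.+1%:R))); last first.
    move=> i iB; rewrite mom_UB iB -/X fmorph_div /= [X in _ / X]rmorphM !rmorph_nat.
    by congr (_ / _).
  rewrite sumr_const -[LHS]mulr_natl; have [B0|B0] := eqVneq #|B| 0%N.
    move/eqP: B0; rewrite cards_eq0 /X => /eqP ->.
    by rewrite cards0 !inE !mul0r.
  rewrite mulrCA; congr (_ * _); rewrite invfM mulrA mulfV ?mul1r //.
  by rewrite pnatr_eq0.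
move=> i _; congr (_^*); rewrite /mom; apply: (haar_ext (hI B)) => A _.
by rewrite prod_I4 /ent !inordK // !ffunE.
Qed.

Hypothesis n2 : (2 <= n)%N.

Lemma pairing_invariant b : (diag_tensor *m P setT) 0 b = pairing (ev b) / n.+1%:R.
Proof. by rewrite diag_tensor_proj !inE andbF add0r mul1r cardsT card_ord. Qed.

(** The binomial counts the sets of size [l] containing two given points: this is the coefficient of
    [pairing] contributed by level [l] at indices whose first two values differ. *)
Definition kap l : C := - ('C(n - 2, n - l)%:R / l.+1%:R).

(** Compatibility of two kinds of coordinates: at a constant index [pairing] is 2 and the sets
    containing one point count, on the left; the right side is the sought eigenvalue plus the
    invariant correction found at the other indices. *)
Lemma level_gap_kap l : (l <= n)%N ->
  'C(n - 1, n - l)%:R * (1 - 2 / l.+1%:R) = level_gap R n l + 2 * kap l.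
Proof.
move=> ln; have [l2|l2] := ltnP l 2.
  rewrite level_gap_lt2 // /kap add0r; case: l l2 ln => [|[|//]] _ _.
    by rewrite subn0 !bin_small ?mul0r ?oppr0 ?mulr0 //; lia.
  rewrite [X in _ = 2 * - (X%:R / _)]bin_small; last by lia.
  by rewrite mul0r oppr0 mulr0 divff ?pnatr_eq0 // subrr mulr0.
case: l l2 ln => [|[|k]] // _ ln; rewrite /level_gap /kap.
case: n n2 ln => [|[|m]] // _; rewrite !ltnS => km.
have -> : k.+2%:Z - 2 = k by rewrite -[k.+2]addn2 PoszD addrK.
rewrite /binomz !subSS !subn0 bin_sub //.
have e : k.+1%:R * 'C(m.+1, m - k)%:R = m.+1%:R * 'C(m, k)%:R :> C.
  have -> : (m - k)%N = (m.+1 - k.+1)%N by rewrite subSS.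
  by rewrite bin_sub // -!natrM -mul_bin_diag.
have k3 : k.+3%:R = k.+1%:R + 2 :> C by rewrite -natrD addn2.
have m3 : m.+3%:R = m.+1%:R + 2 :> C by rewrite -natrD addn2.
have n3 : k.+1%:R + 2 != 0 :> C by rewrite -k3 pnatr_eq0.
rewrite k3 m3; move: (k.+1%:R) ('C(m.+1, m - k)%:R) (m.+1%:R) ('C(m, k)%:R) e n3 => a b c d e n3.
have -> : b * (1 - 2 / (a + 2)) = (a * b) / (a + 2) by field.
by rewrite e; field.
Qed.

Variable c : nat -> R.

Lemma diag_tensor_laplacian : exists K : C,
  diag_tensor *m laplacian c I (@tens R n) =
  real_complex R (target_value n c) *: diag_tensor + K *: (diag_tensor *m P setT).
Proof.
exists (n.+1%:R * \sum_(l < n.+1) real_complex R (c l) * kap l).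
apply/rowP => b; set f := ev b.
have -> : (diag_tensor *m laplacian c I (@tens R n)) 0 b =
    \sum_(B : {set 'I_n}) real_complex R (c #|B|) * (diag_tensor 0 b - (diag_tensor *m P B) 0 b).
  rewrite laplacianE mulmx_sumr summxE; apply: eq_bigr => B _.
  rewrite -scalemxAr mxE mulmxBr mulmx1 mxE; congr (_ * (_ + _)).
  by rewrite mxE.
rewrite [RHS]mxE [X in X + _]mxE [X in _ + X]mxE pairing_invariant -/f.
have -> : diag_tensor 0 b = (const_idx f)%:R by rewrite mxE.
rewrite target_valueE // sum_by_card.
have n0 : n.+1%:R != 0 :> C by rewrite pnatr_eq0.
have -> : n.+1%:R * (\sum_(l < n.+1) real_complex R (c l) * kap l) * (pairing f / n.+1%:R) =
    (\sum_(l < n.+1) real_complex R (c l) * kap l) * pairing f.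
  by move: (\sum_(l < n.+1) _) (pairing f) (n.+1%:R) n0 => x y z z0; field.
rewrite !mulr_suml -big_split /=; apply: eq_bigr => l _.
have ln : (l <= n)%N by rewrite -ltnS.
have cnt (S : {set 'I_n}) : \sum_(B : {set 'I_n} | #|B| == l) (S \subset B)%:R =
    'C(n - #|S|, n - l)%:R :> C.
  have := @card_supersets 'I_n S l; rewrite card_ord => <- //.
  rewrite -sum1_card natr_sum big_mkcond [RHS]big_mkcond; apply: eq_bigr => B _.
  by rewrite inE; case: (S \subset B); case: (#|B| == l).
(* The conditions on [B] become inclusions of one or two given points, so that [cnt] evaluates the
   sum. Afterwards three kinds of index remain: constant ones, non-constant ones with equal first
   two values, where [pairing] vanishes, and those with distinct first two values. *)
rewrite (eq_bigr (fun B : {set 'I_n} => real_complex R (c l) *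
    ((const_idx f)%:R * ([set f (inord 0)] \subset B)%:R -
     pairing f / l.+1%:R * ([set f (inord 0); f (inord 1)] \subset B)%:R))); last first.
  move=> B /eqP Bl; rewrite diag_tensor_proj -/f Bl subUset !sub1set; congr (_ * _).
  case: (const_idx f); case: (f (inord 0) \in B); case: (f (inord 1) \in B) => /=; ring.
rewrite -mulr_sumr sumrB -!mulr_sumr !cnt cards1 cards2 -!mulrA -mulrDr; congr (_ * _).
have [/and3P[/eqP f1 /eqP f2 /eqP f3]|cf] := boolP (const_idx f).
  have -> : pairing f = 2 by rewrite /pairing f1 f2 f3 !eqxx.
  have := level_gap_kap ln; rewrite /level_gap f1 eqxx /= !mul1r !mulr1.
  by rewrite [kap l * 2]mulrC [n.+1%:R * (_ * _)]mulrA => <-; ring.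
rewrite !mulr0 mul0r !add0r; case: eqP => [f01|_].
  suff -> : pairing f = 0 by rewrite !mul0r oppr0 mulr0.
  rewrite /pairing -f01; move: cf; rewrite /const_idx -f01 eqxx /= ![_ == f (inord 0)]eq_sym.
  by case: eqP => _; case: eqP => _ //=; rewrite addr0.
by rewrite /kap /=; ring.
Qed.

End SpecialVector.

(** * Existence of the representation *)

Section OrthonormalBasis.
Variables (R : realType) (r : nat).
Local Notation C := R[i].

Lemma orthonormal_basis m (W : 'M[C]_(m, r)) : exists k (Q : 'M[C]_(k, r)),
  [/\ k = \rank W, Q *m adjmx Q = 1%:M & (Q :=: W)%MS].
Proof.
exists (\rank W), (schmidt (row_base W)); split=> //.
  by rewrite adjmx_tC; apply/unitarymxP/schmidt_unitarymx/rank_leq_col.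
apply: eqmx_trans (eq_row_base W); apply: eqmx_schmidt_free; exact: row_base_free.
Qed.

Lemma gram_oproj k (Q : 'M[C]_(k, r)) : Q *m adjmx Q = 1%:M -> oproj (adjmx Q *m Q).
Proof.
move=> QQ; split; first by rewrite adjmxM adjmxK.
by rewrite mulmxA -(mulmxA _ Q) QQ mulmx1.
Qed.

Lemma gram_fix k (Q : 'M[C]_(k, r)) p (x : 'M[C]_(p, r)) :
  Q *m adjmx Q = 1%:M -> (x <= Q)%MS -> x *m (adjmx Q *m Q) = x.
Proof. by move=> QQ /submxP[D ->]; rewrite mulmxA -(mulmxA D) QQ mulmx1. Qed.

Lemma oproj_basis (P : 'M[C]_r) : oproj P -> exists k (Q : 'M[C]_(k, r)),
  [/\ k = \rank P, Q *m adjmx Q = 1%:M & adjmx Q *m Q = P].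
Proof.
move=> [aP pP]; have [k [Q [kE QQ eQ]]] := orthonormal_basis P; exists k, Q; split=> //.
have h1 : P *m (adjmx Q *m Q) = P by apply: gram_fix => //; rewrite eQ.
have h2 : (adjmx Q *m Q) *m P = adjmx Q *m Q.
  have /submxP[D QE] : (Q <= P)%MS by rewrite eQ.
  by rewrite -mulmxA {2 4}QE -(mulmxA D) pP.
by rewrite -[LHS]h2 -aP -[in LHS](gram_oproj QQ).1 -adjmxM aP h1.
Qed.

End OrthonormalBasis.

Section WeightAdjoint.
Variables (R : realType) (n d : nat) (rho : 'M[R[i]]_n -> 'M[R[i]]_d).
Local Notation C := R[i].
Hypothesis rhoP : urep rho.
Variable nu : 'I_n -> int.

Lemma adjmx_diag (t : 'rV[C]_n) : adjmx (diag_mx t) = diag_mx (map_mx Num.conj t).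
Proof. by rewrite adjmx_tC tr_diag_mx map_diag_mx. Qed.

Let conj_torus (t : 'rV[C]_n) : (forall i, `|t 0 i| = 1) -> forall i, `|map_mx Num.conj t 0 i| = 1.
Proof. by move=> t1 i; rewrite mxE norm_conjC. Qed.

Let conj_monomial (t : 'rV[C]_n) :
  (\prod_i map_mx Num.conj t 0 i ^ nu i)^* = \prod_i t 0 i ^ nu i.
Proof. by rewrite rmorph_prod; apply: eq_bigr => i _; rewrite mxE -fmorphXz /= conjCK. Qed.

Lemma weight_row_adj (v : 'rV[C]_d) :
  (forall t : 'rV[C]_n, (forall i, `|t 0 i| = 1) ->
     v *m rho (diag_mx t) = (\prod_i t 0 i ^ nu i) *: v) ->
  forall t : 'rV[C]_n, (forall i, `|t 0 i| = 1) ->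
     rho (diag_mx t) *m adjmx v = (\prod_i t 0 i ^ nu i) *: adjmx v.
Proof.
move=> h t t1; have u := diag_unitary t1.
by rewrite -[rho _]adjmxK -(urep_adj rhoP u) -adjmxM adjmx_diag h ?adjmxZ ?conj_monomial //; apply: conj_torus.
Qed.

Lemma weight_col_adj (v : 'cV[C]_d) :
  (forall t : 'rV[C]_n, (forall i, `|t 0 i| = 1) ->
     rho (diag_mx t) *m v = (\prod_i t 0 i ^ nu i) *: v) ->
  forall t : 'rV[C]_n, (forall i, `|t 0 i| = 1) ->
     adjmx v *m rho (diag_mx t) = (\prod_i t 0 i ^ nu i) *: adjmx v.
Proof.
move=> h t t1; have u := diag_unitary t1.
by rewrite -[rho _]adjmxK -(urep_adj rhoP u) -adjmxM adjmx_diag h ?adjmxZ ?conj_monomial //; apply: conj_torus.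
Qed.

End WeightAdjoint.

Section Existence.
Variables (R : realType) (n : nat).
Local Notation C := R[i].
Local Notation Om := {ffun 'I_4 -> 'I_n}.
Local Notation N := #|{: Om}|.
Variables (i1 iN : 'I_n).
Hypotheses (i1E : val i1 = 0%N) (iNE : val iN = n.-1) (i1N : i1 != iN).
Local Notation T := (@tens R n).

Definition top_row : 'rV[C]_N := delta_mx 0 (enum_rank (top_tensor i1 iN)).

Lemma top_row_neq0 : top_row != 0.
Proof.
apply/eqP => /rowP/(_ (enum_rank (top_tensor i1 iN))).
by rewrite !mxE !eqxx => /eqP; rewrite oner_eq0.
Qed.

Lemma top_row_weight (t : 'rV[C]_n) : (forall i, `|t 0 i| = 1) ->
  top_row *m T (diag_mx t) = (\prod_i t 0 i ^ @mu20m2 n i) *: top_row.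
Proof.
move=> t1; rewrite /top_row -rowE; apply/rowP => b.
rewrite [LHS]mxE tens_diag [RHS]mxE [X in _ * X]mxE eqxx /= eq_sym.
have [_|_] := eqVneq b (enum_rank _); last by rewrite mulr0.
rewrite mulr1 wtE // enum_rankK; apply: eq_bigr => i _.
by rewrite wt_top.
Qed.

Lemma top_weight_line (w : 'rV[C]_N) :
  (forall t : 'rV[C]_n, (forall i, `|t 0 i| = 1) ->
     w *m T (diag_mx t) = (\prod_i t 0 i ^ @mu20m2 n i) *: w) ->
  exists a, w = a *: top_row.
Proof.
move=> h; set top := enum_rank (top_tensor i1 iN).
exists (w 0 top); apply/rowP => b; rewrite [RHS]mxE [X in _ * X]mxE eqxx /=.
have [->|bt] := eqVneq b top; first by rewrite mulr1.
rewrite mulr0; apply/eqP; apply: contraNT bt => wb.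
have hc := weight_row_adj (tens_urep R n) h.
have : wt (enum_val b) =1 @mu20m2 n.
  by apply: (tens_weight_support hc); rewrite adjmxE conjC_eq0.
by move/(wt_eq_top i1E iNE i1N) => e; rewrite /top -e enum_valK.
Qed.

(** An invariant subspace containing [top_row] is encoded by an orthonormal basis, the rows of [B];
    its dimension is then the height of the matrix, which can be minimized, and [adjmx B *m B] is
    the orthogonal projection. *)
Definition top_basis r (B : 'M[C]_(r, N)) : Prop :=
  [/\ B *m adjmx B = 1%:M,
      (forall g, unitary g -> B *m T g = B *m T g *m (adjmx B *m B)) &
      top_row *m (adjmx B *m B) = top_row].

Lemma top_basis_min : exists r, exists B : 'M[C]_(r, N),
  top_basis B /\ forall r' (B' : 'M[C]_(r', N)), top_basis B' -> (r <= r')%N.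
Proof.
pose P r := `[< exists B : 'M[C]_(r, N), top_basis B >].
have exP : exists r, P r.
  exists N; apply/asboolP; exists 1%:M; split; rewrite ?adjmx1 ?mulmx1 //.
  by move=> g _; rewrite mulmx1 mul1mx.
have [r /asboolP[B hB] hmin] := ex_minnP exP.
by exists r, B; split=> // r' B' hB'; apply: hmin; apply/asboolP; exists B'.
Qed.

Section Compression.
Variables (r : nat) (B : 'M[C]_(r, N)).
Hypothesis hB : top_basis B.
Hypothesis hmin : forall r' (B' : 'M[C]_(r', N)), top_basis B' -> (r <= r')%N.
Let rho (g : 'M[C]_n) := B *m T g *m adjmx B.

Let BB : B *m adjmx B = 1%:M. Proof. by case: hB. Qed.

Let rhoB g : unitary g -> B *m T g = rho g *m B.
Proof. by move=> ug; case: hB => _ h _; rewrite h // !mulmxA. Qed.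

Lemma compression_urep : urep rho.
Proof.
have cT := urep_cont (tens_urep R n).
split; last first.
  move=> g ug; rewrite /unitary {2}/rho !adjmxM adjmxK -tens_adj mulmxA -rhoB // !mulmxA.
  by rewrite -(mulmxA B) -tensM ug tens1 mulmx1.
split; first by rewrite /rho tens1 mulmx1.
  by move=> g h ug uh; rewrite {1}/rho tensM !mulmxA rhoB // -(mulmxA _ B) -[LHS]mulmxA -/(rho h).
by apply: cont_on_mulmx; [apply: cont_on_mulmx cT|]; apply: cont_on_cst.
Qed.

Let rhoA g : unitary g -> T g *m adjmx B = adjmx B *m rho g.
Proof.
move=> ug; apply: adjmx_inj; rewrite (adjmxM (T g)) (adjmxM (adjmx B)) adjmxK -tens_adj.
by rewrite (rhoB (unitary_adj ug)) (urep_adj compression_urep ug).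
Qed.

Let eps := top_row *m adjmx B.

Let epsB : eps *m B = top_row.
Proof. by case: hB => _ _ h; rewrite /eps -mulmxA. Qed.

Let eps_neq0 : eps != 0.
Proof. by apply: contraNneq top_row_neq0 => e; rewrite -epsB e mul0mx. Qed.

Let eps_weight (t : 'rV[C]_n) : (forall i, `|t 0 i| = 1) ->
  eps *m rho (diag_mx t) = (\prod_i t 0 i ^ @mu20m2 n i) *: eps.
Proof.
move=> t1; rewrite /rho !mulmxA epsB top_row_weight // /eps.
by rewrite -scalemxAl.
Qed.

(** The range of such a projection, carried back to the tensor space, is again a [top_basis], and
    minimality bounds its height. *)
Let oproj_rank (P : 'M[C]_r) : oproj P ->
  (forall g, unitary g -> P *m rho g = rho g *m P) -> eps *m P = eps -> (r <= \rank P)%N.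
Proof.
move=> oP cP eP; have [k [Q [kE QQ QP]]] := oproj_basis oP; rewrite -kE.
have QPE : Q *m P = Q by rewrite -QP mulmxA QQ mul1mx.
have QB : adjmx (Q *m B) *m (Q *m B) = adjmx B *m P *m B by rewrite adjmxM -QP !mulmxA.
apply: (hmin (B' := Q *m B)); split.
- by rewrite adjmxM !mulmxA -(mulmxA Q) BB mulmx1.
- move=> g ug; rewrite QB -(mulmxA Q) (rhoB ug) (mulmxA Q).
  rewrite -(mulmxA (adjmx B) P B) (mulmxA (Q *m rho g *m B)) -(mulmxA (Q *m rho g) B) BB mulmx1.
  by rewrite (mulmxA (Q *m rho g)) -(mulmxA Q (rho g) P) -(cP _ ug) (mulmxA Q P) QPE.
- by rewrite QB !mulmxA -/eps eP epsB.
Qed.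

Lemma compression_irrep : irrep rho.
Proof.
have [rr urho] := compression_urep.
split=> //; first by move: eps_neq0; case: (r) eps => // e; rewrite [e]thinmx0 eqxx.
move=> W hW; have [k [Q [_ QQ QW]]] := orthonormal_basis W.
pose P := adjmx Q *m Q; have oP : oproj P := gram_oproj QQ.
have half g : unitary g -> P *m rho g *m P = P *m rho g.
  move=> ug; apply: gram_fix => //; rewrite QW.
  apply: submx_trans (hW g ug); apply: submxMr.
  by rewrite -QW submxMl.
have cP g : unitary g -> P *m rho g = rho g *m P.
  move=> ug; rewrite -half //; apply: adjmx_inj.
  rewrite (adjmxM (P *m rho g)) (adjmxM P) (adjmxM (rho g)) -(urep_adj compression_urep ug) oP.1 mulmxA half //.
  exact: unitary_adj.
have rP : \rank P = \rank W.
  rewrite -QW; apply/eqP; rewrite eqn_leq mxrankM_maxr /=.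
  have {1}-> : Q = Q *m P by rewrite gram_fix.
  by rewrite mxrankM_maxr.
(* The projection [P] commutes with the action, hence preserves the weight, and multiplicity one
   makes [eps] an eigenvector, with eigenvalue 0 or 1. So [eps] lies in the range of [P] or of its
   complement, which is then everything by minimality. *)
have [a aE] : exists a, eps *m P *m B = a *: top_row.
  apply: top_weight_line => t t1; have ut := diag_unitary t1.
  by rewrite -(mulmxA (eps *m P) B) (rhoB ut) (mulmxA (eps *m P)) -(mulmxA eps P) (cP _ ut) (mulmxA eps) eps_weight // -!scalemxAl.
have epsP : eps *m P = a *: eps.
  by rewrite -[LHS]mulmx1 -BB mulmxA aE /eps -scalemxAl.
have a2 : a * a = a.
  apply/eqP; rewrite -subr_eq0; have : (a * a - a) *: eps = 0.
    have : eps *m P *m P = (a * a) *: eps by rewrite epsP -scalemxAl epsP scalerA.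
    by rewrite -(mulmxA eps) oP.2 epsP scalerBl => ->; rewrite subrr.
  by move/eqP; rewrite scaler_eq0 (negbTE eps_neq0) orbF.
have [a0|a0] := eqVneq a 0.
  left; have oP' := oprojC oP.
  have cP' g : unitary g -> (1%:M - P) *m rho g = rho g *m (1%:M - P).
    by move=> ug; rewrite mulmxBl mulmxBr mul1mx mulmx1 cP.
  have eP' : eps *m (1%:M - P) = eps by rewrite mulmxBr mulmx1 epsP a0 scale0r subr0.
  have rk : row_full (1%:M - P).
    by rewrite /row_full eqn_leq rank_leq_col (oproj_rank oP' cP' eP').
  have : (1%:M - P) *m P = 0 by rewrite mulmxBl mul1mx oP.2 subrr.
  rewrite -(mulmx0 _ (1%:M - P)) => /(row_full_inj rk) P0.
  by rewrite -rP P0 mxrank0.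
right; have a1 : a = 1 by apply: (mulfI a0); rewrite a2 mulr1.
apply/eqP; rewrite eqn_leq rank_leq_col -rP; apply: oproj_rank => //.
by rewrite epsP a1 scale1r.
Qed.

Lemma compression_highest_weight : highest_weight rho (@mu20m2 n).
Proof.
split.
  exists (adjmx eps); first by apply: contraNneq eps_neq0 => e; rewrite -[eps]adjmxK e adjmx0.
  exact: (weight_row_adj compression_urep eps_weight).
move=> nu [v v0 hv].
have w0 : adjmx B *m v != 0.
  by apply: contraNneq v0 => /(congr1 (mulmx B)); rewrite mulmxA BB mul1mx mulmx0 => ->.
have hw (t : 'rV[C]_n) : (forall i, `|t 0 i| = 1) ->
    T (diag_mx t) *m (adjmx B *m v) = (\prod_i t 0 i ^ nu i) *: (adjmx B *m v).
  by move=> t1; rewrite mulmxA (rhoA (diag_unitary t1)) -mulmxA hv // -scalemxAr.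
have [b wb] : exists b, (adjmx B *m v) b 0 != 0.
  by move/cV0Pn: w0.
have wtb := tens_weight_support hw wb.
have [h1 h2] := wt_dom_le i1E iNE i1N (enum_val b).
split=> [k|]; first by rewrite (eq_bigr _ (fun i _ => congr1 (fun x => mu20m2 i - x) (esym (wtb i)))).
by rewrite (eq_bigr _ (fun i _ => congr1 (fun x => mu20m2 i - x) (esym (wtb i)))).
Qed.

End Compression.

Theorem highest_weight_exists : exists (d : nat) (rho : 'M[C]_n -> 'M[C]_d),
  irrep rho /\ highest_weight rho (@mu20m2 n).
Proof.
have [r [B [hB hmin]]] := top_basis_min.
exists r, (fun g => B *m T g *m adjmx B); split.
  exact: (compression_irrep hB hmin).
exact: (compression_highest_weight hB).
Qed.

End Existence.

(** * Characters and intertwiners *)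

Section Orthogonality.
Variables (R : realType) (n : nat).
Local Notation C := R[i].
Variable I : ('M[C]_n -> C) -> C.
Hypothesis hI : haar_integral (@UB R n setT) I.

Lemma schur_scalar d (rho : 'M[C]_n -> 'M[C]_d) (M : 'M[C]_d) : irrep rho ->
  (forall g, unitary g -> rho g *m M = M *m rho g) -> exists a, M = a%:M.
Proof.
move=> [_ d0 hirr] cM.
have [a ea] := eigenvalue_closed M d0; exists a.
have [|rk|rk] := hirr (eigenspace M a).
- move=> g ug; apply/eigenspaceP; rewrite -mulmxA cM // mulmxA.
  have /eigenspaceP -> := submx_refl (eigenspace M a).
  by rewrite -scalemxAl.
- by move: ea; rewrite /eigenvalue -mxrank_eq0 rk.
have /eigenspaceP : (1%:M <= eigenspace M a)%MS by rewrite submx_full // /row_full rk.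
by rewrite mul1mx scalemx1.
Qed.

Section TwoReps.
Variables (d e : nat) (rho : 'M[C]_n -> 'M[C]_d) (tau : 'M[C]_n -> 'M[C]_e).
Hypotheses (rhoP : urep rho) (tauP : urep tau).

Let contU p (sigma : 'M[C]_n -> 'M[C]_p) : urep sigma -> cont_on (@UB R n setT) sigma.
Proof. by move=> h; apply: cont_on_sub (urep_cont h) => A []. Qed.

Let cont_entries p (sigma : 'M[C]_n -> 'M[C]_p) k l :
  urep sigma -> cont_on_fun (@UB R n setT) (fun g => sigma g k l).
Proof. by move=> h; have /cont_on_entries := contU h; apply. Qed.

Definition mean_intertwiner (X : 'M[C]_(d, e)) := intmx I (fun g => rho g *m X *m adjmx (tau g)).

Lemma mean_intertwinerP X h : unitary h ->
  rho h *m mean_intertwiner X = mean_intertwiner X *m tau h.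
Proof.
move=> uh; have Uh : UB setT h by apply/UBT.
have cF : cont_on (@UB R n setT) (fun g => rho g *m X *m adjmx (tau g)).
  apply: cont_on_mulmx; last by apply: cont_on_adj; apply: contU.
  by apply: cont_on_mulmx; [apply: contU|apply: cont_on_cst].
have cG : cont_on (@UB R n setT) (fun g => rho g *m X *m adjmx (tau g) *m tau h).
  by apply: cont_on_mulmx cF _; apply: cont_on_cst.
rewrite /mean_intertwiner -(intmx_mull hI _ cF) -(intmx_mulr hI _ cF).
rewrite -[RHS](intmx_inv hI cG Uh); apply: (intmx_ext hI) => g [ug _].
rewrite (urepM rhoP uh ug) (urepM tauP uh ug) adjmxM -!mulmxA.
by rewrite (unitary_adjl (urep_unitary tauP uh)) mulmx1.
Qed.

Lemma mean_intertwiner_delta i j k l :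
  mean_intertwiner (delta_mx j l) i k = I (fun g => rho g i j * (tau g k l)^*).
Proof.
rewrite mxE; apply: (haar_ext hI) => g _; rewrite -[delta_mx j l](mul_delta_mx (0 : 'I_1)).
rewrite mulmxA -colE -mulmxA -rowE mxE big_ord1 !mxE.
by [].
Qed.

(** A product of an entry of [rho] and a conjugate entry of [tau] has as its mean an entry of the
    averaged elementary matrix, an intertwiner, hence 0. *)
Lemma trace_orthogonal (X : 'M[C]_e) :
  (forall Z : 'M[C]_(d, e), (forall g, unitary g -> rho g *m Z = Z *m tau g) -> Z = 0) ->
  I (fun g => \tr (rho g) * (\tr (X *m tau g))^*) = 0.
Proof.
move=> hZ.
rewrite (haar_ext hI (g := fun g =>
  \sum_i \sum_k \sum_l (X k l)^* * (rho g i i * (tau g l k)^*))); last first.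
  move=> g _; rewrite {1}/mxtrace mulr_suml; apply: eq_bigr => i _.
  rewrite /mxtrace rmorph_sum mulr_sumr; apply: eq_bigr => k _.
  rewrite mxE rmorph_sum mulr_sumr; apply: eq_bigr => l _.
  by rewrite rmorphM mulrCA.
have c i k l : cont_on_fun (@UB R n setT) (fun g => rho g i i * (tau g l k)^*).
  by apply: cont_mul; [|apply: cont_conj]; apply: cont_entries.
have c1 i k l : cont_on_fun (@UB R n setT) (fun g => (X k l)^* * (rho g i i * (tau g l k)^*)).
  exact: cont_scale.
rewrite (haar_sum hI) => [|i _]; last by do 2 (apply: cont_sum => ? _).
apply: big1 => i _; rewrite (haar_sum hI) => [|k _]; last by apply: cont_sum => ? _.
apply: big1 => k _; rewrite (haar_sum hI) => [|l _]; last exact: c1.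
apply: big1 => l _; rewrite (haar_scale hI _ (c _ _ _)) -mean_intertwiner_delta.
by rewrite (hZ _ (@mean_intertwinerP _)) mxE mulr0.
Qed.

End TwoReps.

(** By Schur's lemma the average of [X] is scalar, and averaging preserves the trace, so the scalar
    is [\tr X / d]; elementary matrices then give the [d] equal contributions [1 / d]. *)
Lemma character_norm d (rho : 'M[C]_n -> 'M[C]_d) : urep rho -> irrep rho ->
  I (fun g => \tr (rho g) * (\tr (rho g))^*) = 1.
Proof.
move=> rhoP irr; have d0 : (0 < d)%N by case: irr.
have dn0 : d%:R != 0 :> C by rewrite pnatr_eq0 -lt0n.
have cR : cont_on (@UB R n setT) rho by apply: cont_on_sub (urep_cont rhoP) => A [].
have c1 i k : cont_on_fun (@UB R n setT) (fun g => rho g i i * (rho g k k)^*).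
  by move/cont_on_entries: cR => cR; apply: cont_mul; [|apply: cont_conj]; apply: cR.
have meanE X : mean_intertwiner rho rho X = (\tr X / d%:R)%:M.
  have [a aE] := schur_scalar irr (@mean_intertwinerP _ _ _ _ rhoP rhoP X).
  rewrite aE; congr (_%:M); have := congr1 mxtrace aE.
  rewrite mxtrace_scalar -(intmx_tr hI); last first.
    apply: cont_on_mulmx; last exact: cont_on_adj.
    by apply: cont_on_mulmx cR _; apply: cont_on_cst.
  rewrite (haar_ext hI (g := fun=> \tr X)); last first.
    by move=> g [ug _]; rewrite mxtrace_mulC mulmxA (unitary_adjl (urep_unitary rhoP ug)) mul1mx.
  by rewrite (haar_cst hI) => ->; rewrite -[a *+ d]mulr_natr mulfK.
rewrite (haar_ext hI (g := fun g => \sum_i \sum_k rho g i i * (rho g k k)^*)); last first.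
  move=> g _; rewrite {1}/mxtrace mulr_suml; apply: eq_bigr => i _.
  by rewrite /mxtrace rmorph_sum mulr_sumr.
rewrite (haar_sum hI) => [|i _]; last by apply: cont_sum => k _.
have -> : 1 = \sum_(i < d) d%:R^-1 :> C.
  by rewrite sumr_const card_ord -[RHS]mulr_natl mulfV.
apply: eq_bigr => i _; rewrite (haar_sum hI) => [|k _]; last exact: c1.
rewrite (bigD1 i) //= big1 ?addr0.
  have tr1 : \tr (delta_mx i i : 'M[C]_d) = 1.
    by rewrite -(mul_delta_mx (0 : 'I_1)) mxtrace_mulC mul_delta_mx /mxtrace big_ord1 mxE.
  by rewrite -mean_intertwiner_delta meanE mxE eqxx mulr1n tr1 mul1r.
by move=> k ki; rewrite -mean_intertwiner_delta meanE !mxE eq_sym (negbTE ki).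
Qed.

Lemma common_constituent d e (rho : 'M[C]_n -> 'M[C]_d) (tau : 'M[C]_n -> 'M[C]_e) X :
  urep rho -> irrep rho -> urep tau ->
  (forall g, unitary g -> \tr (rho g) = \tr (X *m tau g)) ->
  exists2 Z : 'M[C]_(d, e), Z != 0 & forall g, unitary g -> rho g *m Z = Z *m tau g.
Proof.
move=> rhoP irr tauP chiE; apply: contrapT => noZ.
have := character_norm rhoP irr.
rewrite (haar_ext hI (g := fun g => \tr (rho g) * (\tr (X *m tau g))^*)); last first.
  by move=> g [ug _]; rewrite -chiE.
rewrite (trace_orthogonal rhoP tauP) => [/eqP|Z hZ]; first by rewrite eq_sym oner_eq0.
by apply: contrapT => /eqP Z0; apply: noZ; exists Z.
Qed.

End Orthogonality.

(** Points are treated one at a time: a transposition corrects the image of the new point, and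
    injectivity keeps it away from the images already fixed. *)
Lemma injection_extend_perm (T : finType) (S : {set T}) (h : T -> T) :
  {in S &, injective h} -> exists s : {perm T}, {in S, s =1 h}.
Proof.
have seqP (r : seq T) : {in r &, injective h} -> exists s : {perm T}, {in r, s =1 h}.
  elim: r => [|x r IH] hi; first by exists 1%g.
  have [|s hs] := IH; first by move=> y z yr zr; apply: hi; rewrite inE ?yr ?zr orbT.
  have [xr|xr] := boolP (x \in r).
    by exists s => y; rewrite inE => /predU1P[->|]; apply: hs.
  exists (s * tperm (s x) (h x))%g => y; rewrite permM inE => /predU1P[->|yr].
    by rewrite tpermL.
  have xy : x != y by apply: contraNneq xr => ->.
  rewrite tpermD ?(inj_eq perm_inj) ?hs //.
  by apply: contra xy => /eqP e; apply/eqP/hi; rewrite // !inE ?eqxx ?yr ?orbT.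
move=> hi; have [|s hs] := seqP (enum S).
  by move=> x y; rewrite !mem_enum; apply: hi.
by exists s => x xS; apply: hs; rewrite mem_enum.
Qed.

(** * Class functions among the coefficients of the tensor representation *)

Section TensorSpan.
Variables (R : realType) (n : nat).
Local Notation C := R[i].
Local Notation Om := {ffun 'I_4 -> 'I_n}.
Local Notation N := #|{: Om}|.
Implicit Types (J : {set 'I_4}) (F G : 'M[C]_n -> C) (f x y : Om).

(** Combinations of products of one entry per slot of [J]. Recording [J] lets products over disjoint
    slot sets keep this form, and the full set yields the coefficients of [tens]. *)
Definition tspan J F : Prop := exists a : Om -> Om -> C,
  forall A, F A = \sum_x \sum_y a x y * \prod_(j in J) ent j A (x j) (y j).

Lemma tspan_ext J F G : F =1 G -> tspan J F -> tspan J G.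
Proof. by move=> FG [a aE]; exists a => A; rewrite -FG. Qed.

Lemma tspan_add J F G : tspan J F -> tspan J G -> tspan J (fun A => F A + G A).
Proof.
move=> [a aE] [b bE]; exists (fun x y => a x y + b x y) => A.
rewrite aE bE -big_split; apply: eq_bigr => x _; rewrite -big_split.
by apply: eq_bigr => y _; rewrite mulrDl.
Qed.

Lemma tspan_scale J F k : tspan J F -> tspan J (fun A => k * F A).
Proof.
move=> [a aE]; exists (fun x y => k * a x y) => A.
rewrite aE mulr_sumr; apply: eq_bigr => x _; rewrite mulr_sumr.
by apply: eq_bigr => y _; rewrite mulrA.
Qed.

Lemma tspan0 J : tspan J (fun=> 0).
Proof.
by exists (fun _ _ => 0) => A; rewrite big1 // => x _; rewrite big1 // => y _; rewrite mul0r.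
Qed.

Lemma tspan_sum J (K : Type) (r : seq K) (H : K -> 'M[C]_n -> C) :
  (forall k, tspan J (H k)) -> tspan J (fun A => \sum_(k <- r) H k A).
Proof.
move=> hH; elim: r => [|k r IH].
  by apply: tspan_ext (tspan0 J) => A; rewrite big_nil.
by apply: tspan_ext (tspan_add (hH k) IH) => A; rewrite big_cons.
Qed.

Lemma tspan_monomial J x y : tspan J (fun A => \prod_(j in J) ent j A (x j) (y j)).
Proof.
exists (fun x' y' => ((x' == x) && (y' == y))%:R) => A.
rewrite (bigD1 x) //= (bigD1 y) //= !eqxx mul1r [X in _ + X + _]big1 ?addr0; last first.
  by move=> y' yy; rewrite (negbTE yy) mul0r.
rewrite [X in _ + X]big1 ?addr0 // => x' xx.
by apply: big1 => y' _; rewrite (negbTE xx) mul0r.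
Qed.

Lemma tspan_mul J J' F G : [disjoint J & J'] -> tspan J F -> tspan J' G ->
  tspan (J :|: J') (fun A => F A * G A).
Proof.
move=> dJ [a aE] [b bE].
pose mg (u v : Om) : Om := [ffun j => if j \in J then u j else v j].
apply: (tspan_ext (F := fun A => \sum_x \sum_y \sum_u \sum_v (a x y * b u v) *
    \prod_(j in J :|: J') ent j A (mg x u j) (mg y v j))).
  move=> A; rewrite aE bE mulr_suml; apply: eq_bigr => x _.
  rewrite mulr_suml; apply: eq_bigr => y _; rewrite mulr_sumr; apply: eq_bigr => u _.
  rewrite mulr_sumr; apply: eq_bigr => v _; rewrite mulrACA; congr (_ * _).
  rewrite (eq_bigl [predU J & J']) => [|j]; last by rewrite !inE.
  rewrite bigU //; congr (_ * _); apply: eq_bigr => j jJ; first by rewrite !ffunE jJ.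
  by rewrite !ffunE (disjointFl dJ jJ).
do 4 (apply: tspan_sum => ?).
by apply: tspan_scale; apply: tspan_monomial.
Qed.

Lemma tspan_trace F : tspan setT F -> exists X : 'M[C]_N, forall A, F A = \tr (X *m tens A).
Proof.
move=> [a aE]; exists (\matrix_(l, k) a (enum_val k) (enum_val l)) => A.
rewrite aE mxtrace_mulC /mxtrace -(sum_enum_val (fun x => \sum_y a x y * _)).
apply: eq_bigr => k _; rewrite mxE.
rewrite -(sum_enum_val (fun y => a (enum_val k) y * _)).
apply: eq_bigr => l _; rewrite !mxE mulrC; congr (_ * _).
by apply: eq_bigl => j; rewrite inE.
Qed.

Variable i0 : 'I_n.

Lemma tspan_cst k : tspan set0 (fun=> k).
Proof.
apply: tspan_ext (tspan_scale k (tspan_monomial set0 [ffun=> i0] [ffun=> i0])) => A.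
by rewrite big_set0 mulr1.
Qed.

Definition slot (j : 'I_4) (A : 'M[C]_n) := if (j < 2)%N then A else adjmx A.

Lemma tspan_slot j k l : tspan [set j] (fun A => slot j A k l).
Proof.
rewrite /slot; case j2: (j < 2)%N.
  apply: tspan_ext (tspan_monomial [set j] [ffun=> k] [ffun=> l]) => A.
  by rewrite big_set1 !ffunE /ent j2.
apply: tspan_ext (tspan_monomial [set j] [ffun=> l] [ffun=> k]) => A.
by rewrite big_set1 !ffunE /ent j2 adjmxE.
Qed.

Lemma slot_conj j U A : slot j (adjmx U *m A *m U) = adjmx U *m slot j A *m U.
Proof. by rewrite /slot; case: ifP => // _; rewrite !adjmxM adjmxK mulmxA. Qed.

Lemma slot_diag j (t : 'rV[C]_n) k l : slot j (diag_mx t) k l = (k == l)%:R * ent j (diag_mx t) k k.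
Proof.
rewrite /slot /ent; case: ifP => _; rewrite ?adjmxE !mxE 1?[l == k]eq_sym eqxx mulr1n.
  by case: eqP; rewrite ?mul1r ?mulr1n ?mul0r.
by case: eqP => [->|_]; rewrite ?mul1r ?mulr1n ?mul0r ?mulr0n ?rmorph0.
Qed.

Definition slots (w : seq 'I_4) (A : 'M[C]_n) := foldr (fun j M => slot j A *m M) 1%:M w.

Lemma tspan_slots w k l : uniq w -> tspan [set j in w] (fun A => slots w A k l).
Proof.
elim: w k => [|j w IH] k /=.
  move=> _; have -> : [set j in [::]] = set0 :> {set 'I_4} by apply/setP => j; rewrite !inE.
  exact: tspan_cst.
move=> /andP[jw uw].
apply: (tspan_ext (F := fun A => \sum_m slot j A k m * slots w A m l)).
  by move=> A; rewrite mxE.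
apply: tspan_sum => m; rewrite set_cons; apply: tspan_mul; [|exact: tspan_slot|exact: IH].
by rewrite disjoints1 inE.
Qed.

Lemma slots_conj w U A : unitary U -> slots w (adjmx U *m A *m U) = adjmx U *m slots w A *m U.
Proof.
move=> uU; elim: w => [|j w IH] /=; first by rewrite mulmx1 unitary_adjl.
by rewrite IH slot_conj !mulmxA -(mulmxA _ U) uU mulmx1.
Qed.

Lemma slots_diag w (t : 'rV[C]_n) k l :
  slots w (diag_mx t) k l = (k == l)%:R * \prod_(j <- w) ent j (diag_mx t) k k.
Proof.
elim: w k => [|j w IH] k /=; first by rewrite big_nil mulr1 mxE.
rewrite mxE (bigD1 k) //= big1 ?addr0 => [|m mk].
  by rewrite slot_diag eqxx mul1r IH big_cons mulrCA.
by rewrite slot_diag eq_sym (negbTE mk) !mul0r.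
Qed.

Definition block f (c : 'I_n) : seq 'I_4 := [seq j <- enum 'I_4 | f j == c].

(** Counterpart of a product of power sums, with one trace per value [c] and each slot used once. A
    value missed by [f] contributes the trace of the identity, in agreement with the free choice of
    [h c] in [power_trace_diag]. *)
Definition power_trace f A : C := \prod_c \tr (slots (block f c) A).

Lemma tspan_power_trace f : tspan setT (power_trace f).
Proof.
suff h (s : seq 'I_n) : uniq s ->
    tspan [set j | f j \in s] (fun A => \prod_(c <- s) \tr (slots (block f c) A)).
  have := h (index_enum _) (index_enum_uniq _).
  rewrite (_ : [set j | _] = setT) //; apply/setP => j; by rewrite !inE mem_index_enum.
elim: s => [|c s IH] /=.
  move=> _; rewrite (_ : [set j | _] = set0); last by apply/setP => j; rewrite !inE.
  by apply: tspan_ext (tspan_cst 1) => A; rewrite big_nil.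
move=> /andP[cs us].
apply: (tspan_ext (F := fun A => \tr (slots (block f c) A) * \prod_(c <- s) \tr (slots (block f c) A))).
  by move=> A; rewrite big_cons.
have -> : [set j | f j \in c :: s] = [set j in block f c] :|: [set j | f j \in s].
  by apply/setP => j; rewrite !inE mem_filter mem_enum andbT.
apply: tspan_mul; last exact: IH.
  rewrite -setI_eq0; apply/eqP/setP => j; rewrite !inE mem_filter mem_enum andbT.
  by apply/negP => /andP[/eqP -> ]; rewrite (negbTE cs).
by apply: tspan_sum => k; apply: tspan_slots; rewrite filter_uniq // enum_uniq.
Qed.

Lemma power_trace_conj f U A : unitary U -> power_trace f (adjmx U *m A *m U) = power_trace f A.
Proof.
move=> uU; apply: eq_bigr => c _; rewrite slots_conj // mxtrace_mulC mulmxA.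
by rewrite uU mul1mx.
Qed.

Definition torus_monomial f (t : 'rV[C]_n) : C := \prod_j ent j (diag_mx t) (f j) (f j).

Definition relabel (h : 'I_n -> 'I_n) f : Om := [ffun j => h (f j)].

Lemma power_trace_diag f t :
  power_trace f (diag_mx t) = \sum_(h : {ffun 'I_n -> 'I_n}) torus_monomial (relabel h f) t.
Proof.
rewrite /power_trace.
rewrite (eq_bigr (fun c => \sum_k \prod_(j | f j == c) ent j (diag_mx t) k k)); last first.
  move=> c _; apply: eq_bigr => k _; rewrite slots_diag eqxx mul1r.
  by rewrite big_filter big_enum_cond.
rewrite (bigA_distr_bigA (fun c k => \prod_(j | f j == c) ent j (diag_mx t) k k)).
apply: eq_bigr => h _; rewrite /torus_monomial (partition_big f xpredT) //=.
by apply: eq_bigr => c _; apply: eq_bigr => j /eqP <-; rewrite ffunE.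
Qed.

Definition class_span (m : 'rV[C]_n -> C) : Prop := exists F, [/\ tspan setT F,
  forall U A, unitary U -> F (adjmx U *m A *m U) = F A &
  forall t, F (diag_mx t) = m t].

Lemma class_span_ext m m' : m =1 m' -> class_span m -> class_span m'.
Proof. by move=> e [F [h1 h2 h3]]; exists F; split=> // t; rewrite h3 e. Qed.

Lemma class_span_add m m' : class_span m -> class_span m' -> class_span (fun t => m t + m' t).
Proof.
move=> [F [h1 h2 h3]] [G [k1 k2 k3]]; exists (fun A => F A + G A); split.
- exact: tspan_add.
- by move=> U A uU; rewrite h2 // k2.
- by move=> t; rewrite h3 k3.
Qed.

Lemma class_span_scale k m : class_span m -> class_span (fun t => k * m t).
Proof.
move=> [F [h1 h2 h3]]; exists (fun A => k * F A); split; first exact: tspan_scale.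
  by move=> U A uU; rewrite h2.
by move=> t; rewrite h3.
Qed.

Lemma class_span_sum (K : finType) (P : pred K) (m : K -> 'rV[C]_n -> C) :
  (forall k, P k -> class_span (m k)) -> class_span (fun t => \sum_(k | P k) m k t).
Proof.
move=> h; have {h}/fin_all_exists[F hF] (k : K) : exists F, P k -> [/\ tspan setT F,
    forall U A, unitary U -> F (adjmx U *m A *m U) = F A & forall t, F (diag_mx t) = m k t].
  have [/h[F hF]|_] := boolP (P k); first by exists F.
  by exists (fun=> 0).
exists (fun A => \sum_(k | P k) F k A); split.
- apply: (tspan_ext (F := fun A => \sum_(k <- enum P) F k A)).
    by move=> A; rewrite big_enum.
  have : {in enum P, forall k, P k} by move=> k; rewrite mem_enum.
  elim: (enum P) => [|k s IH] hs.
    by apply: tspan_ext (tspan0 setT) => A; rewrite big_nil.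
  apply: (tspan_ext (F := fun A => F k A + \sum_(k <- s) F k A)).
    by move=> A; rewrite big_cons.
  apply: tspan_add; last by apply: IH => l ls; apply: hs; rewrite inE ls orbT.
  by have [] := hF k (hs k (mem_head _ _)).
- by move=> U A uU; apply: eq_bigr => k Pk; have [_ h2 _] := hF k Pk; apply: h2.
- by move=> t; apply: eq_bigr => k Pk; have [_ _ ->] := hF k Pk.
Qed.

Definition sym_monomial f t : C := \sum_(s : {perm 'I_n}) torus_monomial (relabel s f) t.

Lemma sym_monomial_inj f (h : 'I_n -> 'I_n) t :
  {in [set f j | j : 'I_4] &, injective h} -> sym_monomial (relabel h f) t = sym_monomial f t.
Proof.
move=> /injection_extend_perm[s hs]; rewrite /sym_monomial [RHS](reindex_inj (mulgI s)) /=.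
apply: eq_bigr => u _; congr (torus_monomial _ t); apply/ffunP => j.
by rewrite !ffunE permM hs // imset_f.
Qed.

(** Composition with a fixed permutation permutes the maps [h], so every permutation contributes the
    same sum. *)
Lemma sum_relabel f t :
  \sum_(h : {ffun 'I_n -> 'I_n}) sym_monomial (relabel h f) t =
  #|{perm 'I_n}|%:R * \sum_(h : {ffun 'I_n -> 'I_n}) torus_monomial (relabel h f) t.
Proof.
rewrite exchange_big /= mulr_natl -sumr_const; apply: eq_bigr => s _.
rewrite [RHS](reindex (fun h : {ffun 'I_n -> 'I_n} => [ffun k => s (h k)])) /=.
  by apply: eq_bigr => h _; congr (torus_monomial _ t); apply/ffunP => j; rewrite !ffunE.
exists (fun h : {ffun 'I_n -> 'I_n} => [ffun k => (s^-1)%g (h k)]) => h _.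
  by apply/ffunP => k; rewrite !ffunE permK.
by apply/ffunP => k; rewrite !ffunE permKV.
Qed.

(* by induction on the number of values of [f]: a relabelling that is not injective has fewer values *)
Lemma class_span_sym f : class_span (sym_monomial f).
Proof.
have [k] := ubnP #|[set f j | j : 'I_4]|; elim: k f => // k IH f fk.
pose inj (h : {ffun 'I_n -> 'I_n}) := #|[set h c | c in [set f j | j : 'I_4]]| == #|[set f j | j : 'I_4]|.
have N0 : #|inj|%:R != 0 :> C.
  rewrite pnatr_eq0 -lt0n; apply/card_gt0P; exists [ffun c => c]; rewrite unfold_in.
  apply/eqP/card_in_imset; by move=> c d _ _; rewrite !ffunE.
(* By [sum_relabel], the power trace times the number of permutations is the sum of
   [sym_monomial (relabel h f)] over all [h]. Each [h] injective on the values of [f] gives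
   [sym_monomial f] itself, and the relation is solved for it. *)
apply: (class_span_ext (m := fun t => #|inj|%:R^-1 *
   (#|{perm 'I_n}|%:R * power_trace f (diag_mx t) +
    -1 * \sum_(h : {ffun 'I_n -> 'I_n} | ~~ inj h) sym_monomial (relabel h f) t))).
  move=> t; rewrite power_trace_diag -sum_relabel (bigID inj) /= mulN1r addrK.
  rewrite (eq_bigr (fun=> sym_monomial f t)) => [|h /imset_injP ih]; last exact: sym_monomial_inj.
  by rewrite sumr_const -[sym_monomial f t *+ _]mulr_natl mulKf.
apply: class_span_scale.
have h1 : class_span (fun t => #|{perm 'I_n}|%:R * power_trace f (diag_mx t)).
  apply: class_span_scale; exists (power_trace f); split=> //.
    exact: tspan_power_trace.
  by move=> U A; apply: power_trace_conj.
have h2 : class_span (fun t => -1 * \sum_(h : {ffun 'I_n -> 'I_n} | ~~ inj h) sym_monomial (relabel h f) t).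
  apply: class_span_scale; apply: class_span_sum => h nh; apply: IH.
  have -> : [set relabel h f j | j : 'I_4] = [set h c | c in [set f j | j : 'I_4]].
    by rewrite -imset_comp; apply: eq_imset => j; rewrite ffunE.
  rewrite -ltnS (leq_trans _ fk) // ltnS ltn_neqAle nh leq_imset_card.
  by [].
exact: class_span_add h1 h2.
Qed.

End TensorSpan.

Lemma unitary_spectral (R : realType) n (A : 'M[R[i]]_n) : unitary A ->
  exists (U : 'M[R[i]]_n) (t : 'rV[R[i]]_n), [/\ unitary U, forall i, `|t 0 i| = 1 & A = adjmx U *m diag_mx t *m U].
Proof.
move=> uA; have nA : A \is normalmx.
  by apply/normalmxP; rewrite -adjmx_tC uA unitary_adjl.
have /orthomx_spectralP := nA; rewrite (invmx_unitary (spectral_unitarymx A)) -adjmx_tC => AE.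
have uU := unitarymx_unitary (spectral_unitarymx A).
exists (spectralmx A), (spectral_diag A); split=> // i.
move: (spectralmx A) (spectral_diag A) uU AE => U t uU AE.
have DE : diag_mx t = U *m A *m adjmx U.
  by rewrite AE !mulmxA uU mul1mx -mulmxA uU mulmx1.
have : unitary (diag_mx t).
  by rewrite DE; apply: unitaryM; [exact: unitaryM|exact: unitary_adj].
move=> /matrixP/(_ i i); rewrite mul_diag_mx mxE adjmxE !mxE eqxx !mulr1n -normCK => /eqP.
by rewrite sqrp_eq1 // => /eqP.
Qed.

(** * Coordinate permutations, weights and characters *)

Section Permutations.
Variables (R : realType) (n d : nat) (rho : 'M[R[i]]_n -> 'M[R[i]]_d).
Local Notation C := R[i].
Hypothesis rhoP : urep rho.

Lemma adjmx_perm (s : {perm 'I_n}) : adjmx (perm_mx s : 'M[C]_n) = perm_mx s^-1.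
Proof. by rewrite adjmx_tC tr_perm_mx map_perm_mx. Qed.

Lemma perm_unitary (s : {perm 'I_n}) : unitary (perm_mx s : 'M[C]_n).
Proof. by rewrite /unitary adjmx_perm -perm_mxM mulgV perm_mx1. Qed.

Lemma perm_diag (s : {perm 'I_n}) (t : 'rV[C]_n) :
  perm_mx s *m diag_mx t *m adjmx (perm_mx s) = diag_mx (\row_i t 0 (s i)).
Proof.
rewrite adjmx_perm -col_permE -row_permE; apply/matrixP => i j.
by rewrite !mxE (inj_eq perm_inj).
Qed.

Lemma trace_perm (s : {perm 'I_n}) (t : 'rV[C]_n) : (forall i, `|t 0 i| = 1) ->
  \tr (rho (diag_mx (\row_i t 0 (s i)))) = \tr (rho (diag_mx t)).
Proof.
move=> t1; have us := perm_unitary s; have ut := diag_unitary t1.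
rewrite -perm_diag (urepM rhoP (unitaryM us ut) (unitary_adj us)) (urepM rhoP us ut).
rewrite mxtrace_mulC mulmxA -(urepM rhoP (unitary_adj us) us) unitary_adjl //.
by rewrite (urep1 rhoP) mul1mx.
Qed.

Lemma is_weight_perm nu (s : {perm 'I_n}) : is_weight rho nu -> is_weight rho (nu \o s).
Proof.
move=> [v v0 hv]; have us := perm_unitary s^-1%g; have us' := unitary_adj us.
have ur := urep_unitary rhoP us'.
exists (rho (adjmx (perm_mx s^-1%g)) *m v).
  by apply: contraNneq v0 => /(congr1 (mulmx (adjmx (rho (adjmx (perm_mx s^-1%g))))));
    rewrite mulmxA unitary_adjl // mul1mx mulmx0 => ->.
move=> t t1; have ut := diag_unitary t1.
set p := perm_mx s^-1%g in us us' ur *.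
have pt1 i : `|(\row_i t 0 ((s^-1)%g i)) 0 i| = 1 :> C by rewrite mxE.
have e : diag_mx t *m adjmx p = adjmx p *m diag_mx (\row_i t 0 ((s^-1)%g i)).
  by rewrite -perm_diag -/p !mulmxA unitary_adjl // mul1mx.
rewrite mulmxA -(urepM rhoP ut us') e (urepM rhoP us' (diag_unitary pt1)) -mulmxA hv //.
rewrite -scalemxAr; congr (_ *: _); rewrite (reindex_inj (@perm_inj _ s)) /=.
by apply: eq_bigr => i _; rewrite mxE permK.
Qed.

End Permutations.

Lemma sum2_decompose n (m : 'I_n -> nat) : (\sum_i m i = 2)%N ->
  exists a b, forall i, (m i = (a == i) + (b == i))%N.
Proof.
move=> hm; have pick (m' : 'I_n -> nat) k : (\sum_i m' i = k.+1)%N ->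
    exists a, exists2 m'' : 'I_n -> nat, (\sum_i m'' i = k)%N & forall i, m' i = ((a == i) + m'' i)%N.
  move=> h; have [a ma] : exists a, (0 < m' a)%N.
    apply/existsP; apply: contraT; rewrite negb_exists => /forallP z.
    by move: h; rewrite big1 // => i _; apply/eqP; have := z i; rewrite lt0n negbK.
  exists a, (fun i => m' i - (a == i))%N.
    have e i : m' i = ((a == i) + (m' i - (a == i)))%N.
      by case: eqP => [<-|_]; rewrite ?subn0 // subnKC.
    move: h; rewrite (eq_bigr _ (fun i _ => e i)) big_split /= (bigD1 a) //= eqxx big1.
      by rewrite addn0 add1n => -[].
    by move=> i /negbTE; rewrite eq_sym => ->.
  by move=> i; case: eqP => [<-|_]; rewrite ?subn0 // subnKC.
have [a [m1 /pick[b [m2 /eqP s0 e2]] e1]] := pick m 1%N hm.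
exists a, b => i; rewrite e1 e2; move: s0; rewrite sum_nat_eq0 => /forallP/(_ i)/eqP ->.
by rewrite addn0.
Qed.

Section TopWeights.
Variables (R : realType) (n d : nat) (rho : 'M[R[i]]_n -> 'M[R[i]]_d).
Local Notation C := R[i].
Local Notation Om := {ffun 'I_4 -> 'I_n}.
Hypothesis rhoP : urep rho.
Variables (i1 iN : 'I_n).
Hypotheses (i1E : val i1 = 0%N) (iNE : val iN = n.-1) (i1N : i1 != iN).
Hypothesis top : highest_weight rho (@mu20m2 n).

Lemma sum_mu20m2 (P : pred 'I_n) : \sum_(i | P i) @mu20m2 n i = 2 * ((P i1)%:R - (P iN)%:R).
Proof.
rewrite (eq_bigr (wt (top_tensor i1 iN))) => [|i _]; last by rewrite wt_top.
by rewrite sum_wt sum_I4 /sgn !ffunE !inordK //=; ring.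
Qed.

Lemma weight_sum0 nu : is_weight rho nu -> \sum_i nu i = 0.
Proof.
move=> /(proj2 top)[_]; rewrite sumrB (sum_mu20m2 xpredT) subrr mulr0 sub0r.
by move/eqP; rewrite oppr_eq0 => /eqP.
Qed.

(** Dominance controls initial segments only; a coordinate permutation takes one of them onto [S],
    and the permuted weight is again a weight. *)
Lemma weight_subset_le2 nu (S : {set 'I_n}) : is_weight rho nu -> \sum_(i in S) nu i <= 2.
Proof.
move=> hw; pose k := #|S|.
have kn : (k <= n)%N by rewrite -[X in (_ <= X)%N]card_ord max_card.
have sk : size (enum S) = k by rewrite -cardE.
have [s hs] : exists s : {perm 'I_n}, {in [set i : 'I_n | (i < k)%N], s =1 (fun i : 'I_n => nth i1 (enum S) i)}.
  apply: injection_extend_perm => i j; rewrite !inE => ik jk /eqP.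
  by rewrite nth_uniq ?sk ?enum_uniq // => /eqP/val_inj.
have [h _] := proj2 top _ (is_weight_perm rhoP s hw).
have := h k; rewrite sumrB subr_ge0 sum_mu20m2.
have -> : \sum_(i < n | (i < k)%N) (nu \o s) i = \sum_(i in S) nu i.
  rewrite -[RHS]big_enum [RHS](big_nth i1) sk big_mkord (big_ord_widen n (fun i => nu (nth i1 (enum S) i)) kn).
  by apply: eq_bigr => i ik /=; rewrite hs // inE.
by move=> /le_trans; apply; case: (_ < _)%N; case: (_ < _)%N.
Qed.

(** The positive and negative parts of [nu] have equal totals, since its sum is 0, and at most 2, by
    [weight_subset_le2] for the nonnegative coordinates. *)
Lemma weight_tensor nu : is_weight rho nu -> exists f : Om, nu =1 wt f.
Proof.
move=> hw; pose p0 i := if 0 <= nu i then `|nu i|%N else 0%N.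
pose q0 i := if 0 <= nu i then 0%N else `|nu i|%N.
have nuE i : nu i = (p0 i)%:Z - (q0 i)%:Z by rewrite /p0 /q0; case: ifP => h; lia.
have psum (F : 'I_n -> nat) : (\sum_i F i)%N%:Z = \sum_i (F i)%:Z.
  exact: (big_morph Posz PoszD erefl).
pose p := (\sum_i p0 i)%N; pose q := (\sum_i q0 i)%N.
have pE : p%:Z = \sum_(i in [set i | 0 <= nu i]) nu i.
  rewrite /p psum big_mkcond [RHS]big_mkcond; apply: eq_bigr => i _.
  by rewrite /p0 inE; case: ifP => h; lia.
have p2 : (p <= 2)%N by have := weight_subset_le2 [set i | 0 <= nu i] hw; rewrite -pE; lia.
have pq : p = q.
  have := weight_sum0 hw; rewrite (eq_bigr _ (fun i _ => nuE i)) sumrB -!psum -/p -/q; lia.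
(* Both parts are filled up to total 2 with copies of the first basis weight, which cancel between
   [V] and its dual. *)
have pad (m : 'I_n -> nat) : (\sum_i m i = p -> \sum_i (m i + (2 - p) * (i1 == i)) = 2)%N.
  move=> h; rewrite big_split /= h -big_distrr /= (bigD1 i1) //= eqxx big1 => [|i]; first by lia.
  by rewrite eq_sym => /negbTE ->.
have [a [b ab]] := sum2_decompose (pad p0 erefl).
have [c [e ce]] := sum2_decompose (pad q0 (esym pq)).
exists [ffun j : 'I_4 => if (j == 0 :> nat) then a else if (j == 1 :> nat)%N then b else
   if (j == 2 :> nat)%N then c else e] => i.
rewrite /wt sum_I4 /sgn !ffunE !inordK //= nuE; have := ab i; have := ce i.
by move: (2 - p)%N (p0 i) (q0 i) => x y z; case: (a == i); case: (b == i); case: (c == i); case: (e == i) => /=; lia.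
Qed.

Lemma character_tensor_span : exists X : 'M[C]_(#|{: Om}|),
  forall g, unitary g -> \tr (rho g) = \tr (X *m tens g).
Proof.
have [P [nu [uP rE]]] := torus_diag rhoP.
have wnu r : is_weight rho (nu r).
  exists (adjmx P *m delta_mx r 0).
    apply/eqP => /(congr1 (mulmx P)); rewrite mulmxA uP mul1mx mulmx0 => /matrixP/(_ r 0).
    by rewrite !mxE !eqxx => /eqP; rewrite oner_eq0.
  move=> t t1; rewrite rE // -!mulmxA (mulmxA P) uP mul1mx scalemxAr; congr (_ *m _).
  apply/colP => j; rewrite mul_diag_mx !mxE; case: eqP => [->//|_].
  by rewrite !mulr0.
have /fin_all_exists[f fE] (r : 'I_d) : exists f : Om, nu r =1 wt f by apply: weight_tensor.
have chiE (t : 'rV[C]_n) : (forall i, `|t 0 i| = 1) ->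
    \tr (rho (diag_mx t)) = \sum_r torus_monomial (f r) t.
  move=> t1; rewrite rE // mxtrace_mulC mulmxA uP mul1mx mxtrace_diag; apply: eq_bigr => r _.
  by rewrite mxE /torus_monomial wtE //; apply: eq_bigr => i _; rewrite fE.
(* A single monomial does not extend to a class function. The character is symmetric by
   [trace_perm], so summing over permutations replaces each monomial by its symmetrization, which
   does extend. *)
have symE (t : 'rV[C]_n) : (forall i, `|t 0 i| = 1) ->
    #|{perm 'I_n}|%:R * \tr (rho (diag_mx t)) = \sum_r sym_monomial (f r) t.
  move=> t1; rewrite exchange_big /= mulr_natl -sumr_const; apply: eq_bigr => s _.
  rewrite -(trace_perm rhoP s t1) chiE => [|i]; last by rewrite mxE.
  apply: eq_bigr => r _; apply: eq_bigr => j _.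
  by rewrite /ent !mxE !ffunE !eqxx.
have N0 : #|{perm 'I_n}|%:R != 0 :> C.
  by rewrite pnatr_eq0 -lt0n; apply/card_gt0P; exists 1%g.
have [F [/tspan_trace[X FX] Fconj Fdiag]] : class_span (fun t : 'rV[C]_n =>
    #|{perm 'I_n}|%:R^-1 * \sum_r sym_monomial (f r) t).
  apply: class_span_scale; apply: class_span_sum => r _; by apply: class_span_sym.
exists X => g ug; rewrite -FX; have [U [t [uU t1 ->]]] := unitary_spectral ug.
have ut := diag_unitary t1; have uU' := unitary_adj uU.
rewrite Fconj // Fdiag -symE // mulKf //.
rewrite (urepM rhoP (unitaryM uU' ut) uU) (urepM rhoP uU' ut) mxtrace_mulC mulmxA.
by rewrite -(urepM rhoP uU uU') uU (urep1 rhoP) mul1mx.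
Qed.

End TopWeights.

Lemma proj_setT_eq0 (R : realType) n d (rho : 'M[R[i]]_n -> 'M[R[i]]_d)
    (I : {set 'I_n} -> ('M[R[i]]_n -> R[i]) -> R[i]) :
  (forall B, haar_integral (@UB R n B) (I B)) ->
  urep rho -> irrep rho -> ~ iso_triv rho -> proj rho I setT = 0.
Proof.
move=> hI rhoP irr nt; apply/row_matrixP => k; rewrite row0.
apply: (irrep_invariant_eq0 irr nt) => A uA.
by rewrite -row_mul (projR rhoP hI) //; apply/UBT.
Qed.

(** * The extremal eigenvector *)

Section TopEigenvalue.
Variables (R : realType) (n d : nat) (rho : 'M[R[i]]_n -> 'M[R[i]]_d).
Local Notation C := R[i].
Local Notation Om := {ffun 'I_4 -> 'I_n}.
Local Notation N := #|{: Om}|.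
Variable I : {set 'I_n} -> ('M[C]_n -> C) -> C.
Hypothesis hI : forall E, haar_integral (@UB R n E) (I E).
Hypotheses (n2 : (2 <= n)%N) (rhoP : urep rho) (irr : irrep rho).
Hypothesis top : highest_weight rho (@mu20m2 n).
Variables (i1 iN : 'I_n).
Hypotheses (i1E : val i1 = 0%N) (iNE : val iN = n.-1) (i1N : i1 != iN).

Lemma highest_weight_not_triv : ~ iso_triv rho.
Proof.
move=> [_ triv]; have [[v v0 hv] _] := top.
suff /torus_weight_inj/(_ i1) : forall t : 'rV[C]_n, (forall i, `|t 0 i| = 1) ->
    \prod_i t 0 i ^ @mu20m2 n i = \prod_i t 0 i ^ (0 : int).
  by rewrite (mu20m2E i1E iNE) eqxx.
move=> t t1; rewrite [RHS]big1 //; have := hv t t1.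
rewrite triv ?mul1mx; last exact: diag_unitary.
move=> /eqP; rewrite eq_sym -subr_eq0 -[X in _ - X]scale1r -scalerBl scaler_eq0 (negbTE v0) orbF.
by rewrite subr_eq0 => /eqP.
Qed.

(* witnessed by an element of U(2) mixing the first and the last coordinate *)
Lemma diag_tensor_meets_top : exists2 g, unitary g &
  (diag_tensor R n *m tens g) 0 (enum_rank (top_tensor i1 iN)) != 0.
Proof.
have i_unit : `|'i : C| = 1 by rewrite normCi.
(* At [z = 1] and [z = -1] every term of the coordinate has a zero factor; at ['i] the two terms
   that occur are both -1/4. *)
exists (gz i1 iN 'i); first by have := gz_UB i1N i_unit => -[].
set g := gz i1 iN 'i.
have -> : (diag_tensor R n *m tens g) 0 (enum_rank (top_tensor i1 iN)) =
    \sum_i (g i i1) ^+ 2 * ((g i iN)^*) ^+ 2.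
  rewrite mxE (eq_bigr (fun a => (const_idx (enum_val a))%:R *
      (\prod_j ent j g (enum_val a j) (top_tensor i1 iN j)))) => [|a _]; last first.
    by rewrite [X in X * _]mxE [X in _ * X]mxE enum_rankK.
  rewrite (sum_enum_val (fun f : Om => (const_idx f)%:R * \prod_j ent j g (f j) (top_tensor i1 iN j))).
  rewrite sum_const_idx; apply: eq_bigr => i _.
  by rewrite prod_I4 /ent /top_tensor !ffunE !inordK // !expr2.
rewrite (bigD1 i1) //= (bigD1 iN) ?(eq_sym iN) //= big1 ?addr0; last first.
  move=> i /andP[ii1 iiN]; rewrite /g gzE // (negbTE ii1) (negbTE iiN) /= subr0.
  by rewrite expr0n mul0r.
rewrite /g gz_ii // gz_jj // gz_ij // gz_ji //.
have c2 : (2^-1)^* = 2^-1 :> C by rewrite fmorphV rmorph_nat.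
have -> : ((1 + 'i) / 2)^* = (1 - 'i) / 2 :> C by rewrite rmorphM rmorphD rmorph1 /= conjCi c2.
have -> : (('i - 1) / 2)^* = (- 'i - 1) / 2 :> C by rewrite rmorphM rmorphB rmorph1 /= conjCi c2.
have i2 : 'i ^+ 2 = -1 :> C by apply: sqrCi.
have -> : ((1 + 'i) / 2) ^+ 2 * ((- 'i - 1) / 2) ^+ 2 + (('i - 1) / 2) ^+ 2 * ((1 - 'i) / 2) ^+ 2 =
   - 2^-1 :> C by field: i2.
by rewrite oppr_eq0 invr_eq0 pnatr_eq0.
Qed.

Section Intertwiner.
Variable Z : 'M[C]_(d, N).
Hypotheses (Z0 : Z != 0) (hZ : forall g, unitary g -> rho g *m Z = Z *m tens g).

Lemma adj_intertwiner g : unitary g -> tens g *m adjmx Z = adjmx Z *m rho g.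
Proof.
move=> ug; apply: adjmx_inj; rewrite (adjmxM (tens g)) (adjmxM (adjmx Z)) adjmxK.
rewrite -tens_adj -(urep_adj rhoP ug) hZ //; exact: unitary_adj.
Qed.

Lemma adj_intertwiner_proj B : proj (@tens R n) I B *m adjmx Z = adjmx Z *m proj rho I B.
Proof.
have cT : cont_on (@UB R n B) (@tens R n) by apply: cont_on_sub (urep_cont (tens_urep R n)) => A [].
have cR : cont_on (@UB R n B) rho by apply: cont_on_sub (urep_cont rhoP) => A [].
rewrite !projE -(intmx_mulr (hI B) _ cT) -(intmx_mull (hI B) _ cR).
by apply: (intmx_ext (hI B)) => g [ug _]; apply: adj_intertwiner.
Qed.

Lemma adj_intertwiner_laplacian c :
  laplacian c I (@tens R n) *m adjmx Z = adjmx Z *m laplacian c I rho.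
Proof.
rewrite !laplacianE mulmx_suml mulmx_sumr; apply: eq_bigr => B _.
by rewrite -scalemxAl -scalemxAr mulmxBl mulmxBr mul1mx mulmx1 adj_intertwiner_proj.
Qed.

Lemma intertwiner_free : row_free Z.
Proof.
have [_ _ hirr] := irr; rewrite -kermx_eq0 -mxrank_eq0.
have [|->//|rk] := hirr (kermx Z).
  by move=> g ug; apply/sub_kermxP; rewrite -mulmxA hZ // mulmxA mulmx_ker mul0mx.
have /sub_kermxP : (1%:M <= kermx Z)%MS by rewrite submx_full // /row_full rk.
by rewrite mul1mx => /eqP; rewrite (negbTE Z0).
Qed.

(** The highest weight vector goes to a nonzero multiple of [top_row], by multiplicity one. If the
    projected tensor were zero, so would be that of every translate by [g], and pairing it with this
    vector would make the coordinate of [diag_tensor_meets_top] vanish. *)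
Lemma top_eigenvector : diag_tensor R n *m adjmx Z != 0.
Proof.
have [[v v0 hv] _] := top.
have hr := weight_col_adj rhoP hv.
have u0 : adjmx v *m Z != 0.
  apply: contraNneq v0 => e; rewrite -[v]adjmxK -(adjmx0 R 1 d); apply/eqP; congr adjmx.
  by apply: (row_free_inj intertwiner_free); rewrite e mul0mx.
have [a aE] : exists a, adjmx v *m Z = a *: top_row R i1 iN.
  apply: (top_weight_line i1E iNE i1N) => t t1; have ut := diag_unitary t1.
  by rewrite -mulmxA -hZ // mulmxA hr // -scalemxAl.
have a0 : a != 0 by apply: contraNneq u0 => e; rewrite aE e scale0r.
have [g ug] := diag_tensor_meets_top; apply: contraNneq => y0.
have : diag_tensor R n *m tens g *m (adjmx Z *m v) = 0.
  by rewrite -mulmxA (mulmxA (tens g)) adj_intertwiner // !mulmxA y0 !mul0mx.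
have -> : adjmx Z *m v = a^* *: adjmx (top_row R i1 iN).
  by rewrite -adjmxZ -aE adjmxM adjmxK.
rewrite -scalemxAr => /eqP; rewrite scaler_eq0 conjC_eq0 (negbTE a0) /= => /eqP/matrixP/(_ 0 0).
rewrite mxE [RHS]mxE => e; apply/eqP; rewrite -[RHS]e.
rewrite (bigD1 (enum_rank (top_tensor i1 iN))) //= big1 ?addr0 => [|b bt].
  by rewrite adjmxE !mxE !eqxx rmorph1 mulr1.
by rewrite adjmxE [X in X^*]mxE (negbTE bt) andbF rmorph0 mulr0.
Qed.

End Intertwiner.

Theorem target_eigenvalue c : eigenvalue (laplacian c I rho) (real_complex R (target_value n c)).
Proof.
have [X hX] := character_tensor_span rhoP i1E iNE i1N top.
have [Z Z0 hZ] := common_constituent (hI setT) rhoP irr (tens_urep R n) hX.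
apply/eigenvalueP; exists (diag_tensor R n *m adjmx Z); last exact: top_eigenvector.
rewrite -mulmxA -adj_intertwiner_laplacian // mulmxA.
have [K ->] := diag_tensor_laplacian hI n2 c.
rewrite mulmxDl -!scalemxAl -(mulmxA _ (proj _ _ _)) adj_intertwiner_proj //.
(* The invariant correction is lost under the intertwiner, because a nontrivial irreducible
   representation has no invariants. *)
by rewrite (proj_setT_eq0 hI rhoP irr highest_weight_not_triv) !mulmx0 scaler0 addr0.
Qed.

End TopEigenvalue.

Theorem theorem1p4 (R : realType) (n : nat) (c : nat -> R)
    (I : {set 'I_n} -> ('M[R[i]]_n -> R[i]) -> R[i]) :
  (2 <= n)%N ->
  (forall l : nat, (l <= n)%N -> 0 <= c l) ->
  (forall B : {set 'I_n}, haar_integral (@UB R n B) (I B)) ->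
  let V := real_complex R (target_value n c) in
  [/\ (* every nontrivial irreducible representation has lambda_min >= V *)
      (forall (d : nat) (rho : 'M[R[i]]_n -> 'M[R[i]]_d),
         irrep rho -> ~ iso_triv rho ->
         forall z, eigenvalue (laplacian c I rho) z -> V <= z),
      (* the representation rho_(2,0,...,0,-2) exists *)
      (exists (d : nat) (rho : 'M[R[i]]_n -> 'M[R[i]]_d),
         irrep rho /\ highest_weight rho (@mu20m2 n)) &
      (* and its smallest Laplacian eigenvalue is exactly V *)
      (forall (d : nat) (rho : 'M[R[i]]_n -> 'M[R[i]]_d),
         irrep rho -> highest_weight rho (@mu20m2 n) ->
         lambda_min (laplacian c I rho) V)].
Proof.
move=> n2 c0 hI V.
have n0 : (0 < n)%N by apply: leq_trans n2.
have nN : (n.-1 < n)%N by rewrite prednK.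
pose i1 : 'I_n := Ordinal n0; pose iN : 'I_n := Ordinal nN.
have i1N : i1 != iN by rewrite -val_eqE /=; case: (n) n2 => [|[|]].
have bound d (rho : 'M[R[i]]_n -> 'M[R[i]]_d) z :
    irrep rho -> ~ iso_triv rho -> eigenvalue (laplacian c I rho) z -> V <= z.
  move=> irr nt; have [S uS urho] := unitarization (hI setT) irr.
  have rr : is_rep rho by case: irr.
  have irr' := irrep_conj uS irr; have nt' : ~ iso_triv (fun A => invmx S *m rho A *m S).
    by move=> /(iso_triv_conj uS).
  rewrite -(eigenvalue_conj uS) -(laplacian_conj uS hI) //.
  apply: laplacian_eigenvalue_bound => // x.
  by rewrite (proj_setT_eq0 hI urho irr' nt') mulmx0.
split.
- by move=> d rho irr nt z; apply: bound.
- exact: (@highest_weight_exists R n i1 iN).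
move=> d rho irr top; have [S uS urho] := unitarization (hI setT) irr.
have rr : is_rep rho by case: irr.
have irr' := irrep_conj uS irr; have top' := highest_weight_conj uS top.
split.
  rewrite -(eigenvalue_conj uS) -(laplacian_conj uS hI) //.
  exact: (@target_eigenvalue R n d _ I hI n2 urho irr' top' i1 iN).
move=> z; apply: bound => //.
by move=> [d1 triv]; apply: (@highest_weight_not_triv R n d rho top i1 iN).
Qed.
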